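(* Let $p$ be an odd prime and let $G$ be a minimally $5$-generated $p$-group of nilpotency class at most two and exponent $p$. Then $G$ is one and only one of the following: (i) isomorphic to a direct product $E\times C_p$, where $E$ is the extra-special $p$-group of order $p^5$ and exponent $p$ and $C_p$ is cyclic of order $p$; (ii) isomorphic to the amalgamated direct product \[ \Bigl(\langle x_1\rangle\amalg^{\mathfrak{N}_2}\langle x_2\rangle\Bigr)\times_{\phi}\Bigl(\langle x_3\rangle\amalg^{\mathfrak{N}_2}\langle x_4\rangle\amalg^{\mathfrak{N}_2}\langle x_5\rangle\Bigr),\] with each $x_i$ of order $p$, and $\phi([x_2,x_1])=[x_4,x_3]$; (iii) isomorphic to the amalgamated direct product \[ \Bigl(\langle x_1\rangle\amalg^{\mathfrak{N}_2}\langle x_2\rangle\Bigr)\times_{\phi}\Bigl(\bigl(\langle x_3\rangle\amalg^{\mathfrak{N}_2}\langle x_4\rangle\amalg^{\mathfrak{N}_2}\langle x_5\rangle\bigr)/\langle[x_5,x_4]\rangle\Bigr),\] with each $x_i$ of order $p$ and $\phi([x_2,x_1])=[x_4,x_3]$; (iv) capable.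
   Context: A group is minimally $5$-generated if it can be generated by $5$ elements but not by fewer. A group $G$ is capable if there exists a group $H$ such that $G\cong H/Z(H)$. For groups $A_1,\ldots,A_m$ of nilpotency class at most $2$, $A_1\amalg^{\mathfrak{N}_2}\cdots\amalg^{\mathfrak{N}_2}A_m$ denotes their $2$-nilpotent product $P/P_3$, where $P=A_1*\cdots*A_m$ is the free product and $P_3=[[P,P],P]$. Commutators are $[x,y]=x^{-1}y^{-1}xy$. Given groups $G_1,G_2$, a subgroup $H\leq Z(G_1)$ and an injective homomorphism $\phi\colon H\to Z(G_2)$, the amalgamated direct product along $\phi$ is $G_1\times_\phi G_2=(G_1\times G_2)/\{(h,\phi(h)^{-1})\mid h\in H\}$. In (ii) and (iii), $H=\langle[x_2,x_1]\rangle$ (cyclic of order $p$), and $\phi$ is determined by the stated value on $[x_2,x_1]$. *)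

(* Defs.v *)
From HB Require Import structures.
From mathcomp Require Import all_boot all_order all_algebra.
From mathcomp Require Import all_fingroup all_solvable.
From mathcomp Require Import generic_quotient boolp.

Set Implicit Arguments.
Unset Strict Implicit.
Unset Printing Implicit Defensive.

Local Open Scope group_scope.
Local Open Scope quotient_scope.

(* Groups are arbitrary, possibly infinite, [groupType]s: free products of    *)
(* finite groups are infinite, and a group H with G isomorphic to H/Z(H) is   *)
(* not assumed finite. Subsets of a [groupType] are Prop-valued predicates.   *)

Definition isomorphic (G H : groupType) : Prop :=
  exists f : {multiplicative G -> H}, bijective f.

Section Subgroups.
Variable G : groupType.

Inductive generated (S : G -> Prop) : G -> Prop :=
| generated_in x : S x -> generated S x
| generated_1 : generated S 1
| generated_M x y : generated S x -> generated S y -> generated S (x * y)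
| generated_V x : generated S x -> generated S x^-1.

Record normal_subgroup := NormalSubgroup {
  nsub_mem :> G -> Prop;
  nsub1 : nsub_mem 1;
  nsubM x y : nsub_mem x -> nsub_mem y -> nsub_mem (x * y);
  nsubV x : nsub_mem x -> nsub_mem x^-1;
  nsubJ x y : nsub_mem x -> nsub_mem (x ^ y)
}.

Definition whole_nsub : normal_subgroup :=
  @NormalSubgroup (fun=> True) I (fun _ _ _ _ => I) (fun _ _ => I)
    (fun _ _ _ => I).

Definition central (z : G) : Prop := forall x, commute z x.

Lemma central1 : central 1.
Proof. by move=> x; apply/commute_sym/commute1. Qed.

Lemma centralM x y : central x -> central y -> central (x * y).
Proof.
by move=> cx cy z; apply/commute_sym/commuteM; apply: commute_sym.
Qed.

Lemma centralV x : central x -> central x^-1.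
Proof. by move=> cx z; apply/commute_sym/commuteV/commute_sym. Qed.

Lemma central_conj x y : central x -> x ^ y = x.
Proof. by move=> cx; rewrite conjgE cx mulgA mulVg mul1g. Qed.

Lemma centralJ x y : central x -> central (x ^ y).
Proof. by move=> cx; rewrite central_conj. Qed.

Definition center_nsub : normal_subgroup :=
  NormalSubgroup central1 centralM centralV centralJ.

Section CentralCycle.
Variables (z : G) (cz : central z).

Lemma generated_central x : generated (eq z) x -> central x.
Proof.
elim=> {x} [x <- | | x y _ cx _ cy | x _ cx] //.
- exact: central1.
- exact: centralM.
- exact: centralV.
Qed.

Lemma central_cycleJ x y : generated (eq z) x -> generated (eq z) (x ^ y).
Proof. by move=> zx; rewrite central_conj //; apply: generated_central. Qed.

(* The cyclic subgroup generated by a central element z. *)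
Definition central_cycle : normal_subgroup :=
  NormalSubgroup (generated_1 (eq z)) (@generated_M (eq z))
    (@generated_V (eq z)) central_cycleJ.

End CentralCycle.

Section Commutator.
Variables M N : normal_subgroup.

Definition is_commutator (z : G) : Prop :=
  exists x y, [/\ M x, N y & z = [~ x, y]].

Lemma generated_commJ x y :
  generated is_commutator x -> generated is_commutator (x ^ y).
Proof.
elim=> [_ [a [b [Ma Nb ->]]] | | a b _ Ja _ Jb | a _ Ja].
- apply: generated_in; exists (a ^ y), (b ^ y).
  by rewrite conjRg; split=> //; apply: nsubJ.
- rewrite conj1g; exact: generated_1.
- by rewrite conjMg; apply: generated_M.
- by rewrite conjVg; apply: generated_V.
Qed.

Definition comm_nsub : normal_subgroup :=
  NormalSubgroup (generated_1 is_commutator) (@generated_M is_commutator)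
    (@generated_V is_commutator) generated_commJ.

End Commutator.

(* [[G, G], G] *)
Definition gamma3 : normal_subgroup :=
  comm_nsub (comm_nsub whole_nsub whole_nsub) whole_nsub.

End Subgroups.

Arguments center_nsub : clear implicits.
Arguments gamma3 : clear implicits.

Section Quotient.
Variables (G : groupType) (N : normal_subgroup G).

Definition coset_eq : rel G := fun x y => `[< N (x^-1 * y) >].

Lemma coset_eq_refl : reflexive coset_eq.
Proof. by move=> x; apply/asboolP; rewrite mulVg; apply: nsub1. Qed.

Lemma coset_eq_sym : symmetric coset_eq.
Proof.
by move=> x y; apply/asboolP/asboolP => /nsubV; rewrite invgM invgK.
Qed.

Lemma coset_eq_trans : transitive coset_eq.
Proof.
move=> y x z /asboolP Nxy /asboolP Nyz; apply/asboolP.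
by have := nsubM Nxy Nyz; rewrite mulgA mulgK.
Qed.

Canonical coset_equiv :=
  EquivRel coset_eq coset_eq_refl coset_eq_sym coset_eq_trans.

Definition quotient_group := {eq_quot coset_equiv}.
HB.instance Definition _ := Choice.on quotient_group.
HB.instance Definition _ := EqQuotient.on quotient_group.

Definition quotient_proj (x : G) : quotient_group := \pi_quotient_group x.

Lemma quotient_projP x y : N (x^-1 * y) <-> quotient_proj x = quotient_proj y.
Proof.
by split=> [Nxy | /eqmodP/asboolP //]; apply/eqmodP/asboolP.
Qed.

Definition quotient_mul (x y : quotient_group) : quotient_group :=
  quotient_proj (repr x * repr y).
Definition quotient_inv (x : quotient_group) : quotient_group :=
  quotient_proj (repr x)^-1.

Lemma quotient_reprK (x : quotient_group) : quotient_proj (repr x) = x.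
Proof. exact: reprK. Qed.

Lemma quotient_projM x y :
  quotient_proj (x * y) = quotient_mul (quotient_proj x) (quotient_proj y).
Proof.
rewrite /quotient_mul; set x' := repr _; set y' := repr _.
have Nx : N (x^-1 * x') by apply/quotient_projP; rewrite quotient_reprK.
have Ny : N (y^-1 * y') by apply/quotient_projP; rewrite quotient_reprK.
apply/quotient_projP.
have ->: (x * y)^-1 * (x' * y') = (x^-1 * x') ^ y * (y^-1 * y').
  by rewrite conjgE invgM !mulgA mulgK.
by apply: nsubM => //; apply: nsubJ.
Qed.

Lemma quotient_projV x : quotient_proj x^-1 = quotient_inv (quotient_proj x).
Proof.
rewrite /quotient_inv; set x' := repr _.
have Nx : N (x^-1 * x') by apply/quotient_projP; rewrite quotient_reprK.
apply/quotient_projP.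
have ->: x^-1^-1 * x'^-1 = ((x^-1 * x')^-1) ^ x^-1.
  by rewrite conjgE !invgM !invgK !mulgA mulgK.
by apply: nsubJ; apply: nsubV.
Qed.

Lemma quotient_mulA : associative quotient_mul.
Proof.
move=> x y z; rewrite -[x]quotient_reprK -[y]quotient_reprK.
by rewrite -[z]quotient_reprK -!quotient_projM mulgA.
Qed.

Lemma quotient_mul1g : left_id (quotient_proj 1) quotient_mul.
Proof. by move=> x; rewrite -[x]quotient_reprK -quotient_projM mul1g. Qed.

Lemma quotient_mulg1 : right_id (quotient_proj 1) quotient_mul.
Proof. by move=> x; rewrite -[x]quotient_reprK -quotient_projM mulg1. Qed.

Lemma quotient_mulVg : left_inverse (quotient_proj 1) quotient_inv quotient_mul.
Proof.
move=> x; rewrite -[x]quotient_reprK -quotient_projV -quotient_projM.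
by rewrite mulVg.
Qed.

Lemma quotient_mulgV :
  right_inverse (quotient_proj 1) quotient_inv quotient_mul.
Proof.
move=> x; rewrite -[x]quotient_reprK -quotient_projV -quotient_projM.
by rewrite mulgV.
Qed.

HB.instance Definition _ := isGroup.Build quotient_group
  quotient_mulA quotient_mul1g quotient_mulg1 quotient_mulVg quotient_mulgV.

HB.instance Definition _ :=
  isMultiplicative.Build G quotient_group quotient_proj quotient_projM.

End Quotient.

Section FreeProduct.
Variables (I : choiceType) (A : I -> groupType).

Definition letter := {i : I & A i}.

(* The congruence on words generated by deleting trivial letters and merging  *)
(* adjacent letters from the same factor.                                     *)
Inductive word_eq : seq letter -> seq letter -> Prop :=
| word_eq_refl w : word_eq w w
| word_eq_sym v w : word_eq v w -> word_eq w v
| word_eq_trans u v w : word_eq u v -> word_eq v w -> word_eq u w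
| word_eq_one u v i : word_eq (u ++ Tagged A (1 : A i) :: v) (u ++ v)
| word_eq_mul u v i (a b : A i) :
    word_eq (u ++ Tagged A a :: Tagged A b :: v) (u ++ Tagged A (a * b) :: v).

Definition word_inv (w : seq letter) : seq letter :=
  rev [seq Tagged A (tagged x : A (tag x))^-1 | x : letter <- w].

Lemma word_eq_cat u u' v v' :
  word_eq u u' -> word_eq v v' -> word_eq (u ++ v) (u' ++ v').
Proof.
move=> uu' vv'; apply: (@word_eq_trans _ (u' ++ v)).
  elim: uu' => {u u'} [w | w w' _ | s t w _ st _ tw | w w' i | w w' i a b].
  - exact: word_eq_refl.
  - exact: word_eq_sym.
  - exact: word_eq_trans st tw.
  - by rewrite -!catA /=; apply: word_eq_one.
  - by rewrite -!catA /=; apply: word_eq_mul.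
elim: vv' => {v v'} [w | w w' _ | s t w _ st _ tw | w w' i | w w' i a b].
- exact: word_eq_refl.
- exact: word_eq_sym.
- exact: word_eq_trans st tw.
- by rewrite !catA; apply: word_eq_one.
- by rewrite !catA; apply: word_eq_mul.
Qed.

Lemma word_eq_inv u v : word_eq u v -> word_eq (word_inv u) (word_inv v).
Proof.
rewrite /word_inv.
elim=> {u v} [w | w w' _ | u v w _ uv _ vw | w w' i | w w' i a b].
- exact: word_eq_refl.
- exact: word_eq_sym.
- exact: word_eq_trans uv vw.
- rewrite !map_cat !rev_cat /= rev_cons cat_rcons /= invg1.
  exact: word_eq_one.
- rewrite !map_cat !rev_cat /= !rev_cons !cat_rcons /= invgM.
  exact: word_eq_mul.
Qed.

Lemma word_eq_mulV w : word_eq (w ++ word_inv w) [::].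
Proof.
elim: w => [|[i a] w IHw]; first exact: word_eq_refl.
rewrite /word_inv /= rev_cons -rcons_cat -cats1.
apply: (@word_eq_trans _ [:: Tagged A a; Tagged A a^-1]).
  rewrite -[[:: Tagged A a; _]]/([:: Tagged A a] ++ [::] ++ [:: Tagged A a^-1]).
  rewrite -cat1s -catA; apply: word_eq_cat; first exact: word_eq_refl.
  rewrite catA; apply: word_eq_cat; [exact: IHw | exact: word_eq_refl].
apply: word_eq_trans (word_eq_mul [::] [::] a a^-1) _.
by rewrite mulgV; apply: (word_eq_one [::] [::]).
Qed.

Lemma word_invK : involutive word_inv.
Proof.
move=> w; rewrite /word_inv map_rev revK -map_comp -[RHS]map_id.
by apply: eq_map => -[i a] /=; rewrite invgK.
Qed.

Lemma word_eq_mulVw w : word_eq (word_inv w ++ w) [::].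
Proof. by rewrite -[X in _ ++ X]word_invK; apply: word_eq_mulV. Qed.

Definition word_rel : rel (seq letter) := fun u v => `[< word_eq u v >].

Lemma word_rel_refl : reflexive word_rel.
Proof. by move=> w; apply/asboolP; apply: word_eq_refl. Qed.

Lemma word_rel_sym : symmetric word_rel.
Proof. by move=> v w; apply/asboolP/asboolP; apply: word_eq_sym. Qed.

Lemma word_rel_trans : transitive word_rel.
Proof.
move=> v u w /asboolP uv /asboolP vw; apply/asboolP.
exact: word_eq_trans uv vw.
Qed.

Canonical word_equiv :=
  EquivRel word_rel word_rel_refl word_rel_sym word_rel_trans.

Definition free_product := {eq_quot word_equiv}.
HB.instance Definition _ := Choice.on free_product.
HB.instance Definition _ := EqQuotient.on free_product.

Definition word_class (w : seq letter) : free_product := \pi_free_product w.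

Lemma word_classP u v : word_eq u v <-> word_class u = word_class v.
Proof.
by split=> [uv | /eqmodP/asboolP //]; apply/eqmodP/asboolP.
Qed.

Definition fp_mul (x y : free_product) : free_product :=
  word_class (repr x ++ repr y).
Definition fp_inv (x : free_product) : free_product :=
  word_class (word_inv (repr x)).

Lemma fp_reprK (x : free_product) : word_class (repr x) = x.
Proof. exact: reprK. Qed.

Lemma word_class_cat u v :
  word_class (u ++ v) = fp_mul (word_class u) (word_class v).
Proof.
by apply/word_classP/word_eq_cat; apply/word_classP; rewrite fp_reprK.
Qed.

Lemma word_class_inv u : word_class (word_inv u) = fp_inv (word_class u).
Proof.
by apply/word_classP/word_eq_inv; apply/word_classP; rewrite fp_reprK.
Qed.

Lemma fp_mulA : associative fp_mul.
Proof.
move=> x y z; rewrite -[x]fp_reprK -[y]fp_reprK -[z]fp_reprK.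
by rewrite -!word_class_cat catA.
Qed.

Lemma fp_mul1g : left_id (word_class [::]) fp_mul.
Proof. by move=> x; rewrite -[x]fp_reprK -word_class_cat. Qed.

Lemma fp_mulg1 : right_id (word_class [::]) fp_mul.
Proof. by move=> x; rewrite -[x]fp_reprK -word_class_cat cats0. Qed.

Lemma fp_mulVg : left_inverse (word_class [::]) fp_inv fp_mul.
Proof.
move=> x; rewrite -[x]fp_reprK -word_class_inv -word_class_cat.
by apply/word_classP; apply: word_eq_mulVw.
Qed.

Lemma fp_mulgV : right_inverse (word_class [::]) fp_inv fp_mul.
Proof.
move=> x; rewrite -[x]fp_reprK -word_class_inv -word_class_cat.
by apply/word_classP; apply: word_eq_mulV.
Qed.

HB.instance Definition _ := isGroup.Build free_product
  fp_mulA fp_mul1g fp_mulg1 fp_mulVg fp_mulgV.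

Definition fp_in (i : I) (a : A i) : free_product :=
  word_class [:: Tagged A a].

Lemma fp_inM i : {morph @fp_in i : a b / a * b}.
Proof.
move=> a b; rewrite -[RHS]word_class_cat; apply/word_classP/word_eq_sym.
exact: (word_eq_mul [::] [::]).
Qed.

HB.instance Definition _ i :=
  isMultiplicative.Build (A i) free_product (@fp_in i) (@fp_inM i).

(* The 2-nilpotent product P / [[P, P], P], with P the free product. *)
Definition nil2_product := quotient_group (gamma3 free_product).

HB.instance Definition _ := Group.on nil2_product.

Definition nil2_in (i : I) (a : A i) : nil2_product :=
  quotient_proj (gamma3 free_product) (fp_in a).

Lemma nil2_comm_central (x y : nil2_product) : central [~ x, y].
Proof.
rewrite -[x]quotient_reprK -[y]quotient_reprK => z.
rewrite -[z]quotient_reprK; set a := repr x; set b := repr y; set c := repr z.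
have /quotient_projP : gamma3 free_product (1^-1 * [~ [~ a, b], c]).
  rewrite invg1 mul1g; apply: generated_in; exists [~ a, b], c; split=> //.
  by apply: generated_in; exists a, b.
pose q := quotient_proj (gamma3 free_product).
have qM : {morph q : u v / u * v} by apply: quotient_projM.
have qV : {morph q : u / u^-1} by apply: quotient_projV.
rewrite -/q => q1; apply/commgP/eqP.
have -> : 1 = q 1 by [].
by rewrite q1 /commg /conjg !(qM, qV).
Qed.

End FreeProduct.

(* phi : H -> Z(G2) is represented by a total map whose values outside H are  *)
(* never used. Any subgroup H <= Z(G1) is normal, so H : normal_subgroup G1   *)
(* is no restriction.                                                         *)
Record amalgamation (G1 G2 : groupType) (H : normal_subgroup G1) :=
  Amalgamation {
    amalg_map :> G1 -> G2;
    amalg_dom_central : forall h, H h -> central h;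
    amalg_central : forall h, H h -> central (amalg_map h);
    amalg_mapM : forall h k, H h -> H k ->
      amalg_map (h * k) = amalg_map h * amalg_map k;
    amalg_inj : forall h k, H h -> H k -> amalg_map h = amalg_map k -> h = k
  }.

Section AmalgamatedProduct.
Variables (G1 G2 : groupType) (H : normal_subgroup G1).
Variable phi : amalgamation G2 H.

Definition amalg_rel (z : (G1 * G2)%type) : Prop :=
  exists2 h, H h & z = (h, (phi h)^-1).

Lemma amalg_map1 : phi 1 = 1.
Proof.
apply: (mulgI (phi 1)).
by rewrite -amalg_mapM ?mulg1 //; apply: nsub1.
Qed.

Lemma amalg_mapV h : H h -> phi h^-1 = (phi h)^-1.
Proof.
move=> Hh; apply: (mulgI (phi h)).
by rewrite -amalg_mapM ?mulgV ?amalg_map1 //; apply: nsubV.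
Qed.

Lemma amalg_rel1 : amalg_rel 1.
Proof. by exists 1; [apply: nsub1 | rewrite amalg_map1 invg1]. Qed.

Lemma amalg_relM x y : amalg_rel x -> amalg_rel y -> amalg_rel (x * y).
Proof.
move=> [h Hh ->] [k Hk ->]; exists (h * k); first exact: nsubM.
rewrite amalg_mapM // invgM; congr pair.
by apply/commuteV/commute_sym/commuteV/amalg_central.
Qed.

Lemma amalg_relV x : amalg_rel x -> amalg_rel x^-1.
Proof.
by move=> [h Hh ->]; exists h^-1; [apply: nsubV | rewrite amalg_mapV].
Qed.

Lemma amalg_relJ x y : amalg_rel x -> amalg_rel (x ^ y).
Proof.
move=> [h Hh ->]; exists h => //; case: y => a b; congr pair.
  exact: (central_conj a (amalg_dom_central phi Hh)).
exact: (central_conj b (centralV (amalg_central phi Hh))).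
Qed.

Definition amalg_kernel : normal_subgroup (G1 * G2)%type :=
  NormalSubgroup amalg_rel1 amalg_relM amalg_relV amalg_relJ.

Definition amalgamated_product := quotient_group amalg_kernel.

HB.instance Definition _ := Group.on amalgamated_product.

End AmalgamatedProduct.

Section Hypotheses.
Variable G : groupType.

Definition is_pgroup (p : nat) : Prop :=
  forall x : G, exists k, x ^+ (p ^ k) = 1.

Definition has_exponent (n : nat) : Prop :=
  [/\ (0 < n)%N, forall x : G, x ^+ n = 1
    & forall m, (0 < m)%N -> (forall x : G, x ^+ m = 1) -> (n <= m)%N].

Definition class_at_most_two : Prop := forall x, gamma3 G x -> x = 1.

Definition n_generated (n : nat) : Prop :=
  exists s : n.-tuple G, forall x, generated (fun y => y \in s) x.

Definition minimally_generated (n : nat) : Prop :=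
  n_generated n /\ forall m, (m < n)%N -> ~ n_generated m.

Definition capable : Prop :=
  exists H : groupType, isomorphic G (quotient_group (center_nsub H)).

End Hypotheses.

Definition exactly_one_of_four (A B C D : Prop) : Prop :=
  [\/ A, B, C | D] /\
  [/\ ~ (A /\ B), ~ (A /\ C) & ~ (A /\ D)] /\
  [/\ ~ (B /\ C), ~ (B /\ D) & ~ (C /\ D)].

Section Cases.
Variables (p : nat) (G : groupType).

(* The [groupType] law on 'Z_p is addition. For p prime it is cyclic of order *)
(* p; for p < 2 it is not, since 'Z_0 and 'Z_1 are 'Z_2.                      *)
Definition Cp : groupType := 'Z_p.
Definition Cp_gen : Cp := Zp1 : 'Z_p.

Definition nil2_power (m : nat) : groupType :=
  nil2_product (fun _ : 'I_m => Cp).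

Definition nil2_gen (m : nat) (i : 'I_m) : nil2_power m :=
  @nil2_in _ (fun _ : 'I_m => Cp) i Cp_gen.

(* x_1, x_2 in the first factor, x_3, x_4, x_5 in the second. *)
Definition gen_x1 : nil2_power 2 := nil2_gen (inord 0).
Definition gen_x2 : nil2_power 2 := nil2_gen (inord 1).

Definition gen_x3 : nil2_power 3 := nil2_gen (inord 0).
Definition gen_x4 : nil2_power 3 := nil2_gen (inord 1).
Definition gen_x5 : nil2_power 3 := nil2_gen (inord 2).

(* <[x_2, x_1]> and <[x_5, x_4]> *)
Definition H21 : normal_subgroup (nil2_power 2) :=
  central_cycle (nil2_comm_central gen_x2 gen_x1).

Definition K54 : normal_subgroup (nil2_power 3) :=
  central_cycle (nil2_comm_central gen_x5 gen_x4).

Definition case_i : Prop :=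
  exists E : finGroupType,
    [/\ extraspecial [set: E], #|[set: E]| = (p ^ 5)%N, exponent [set: E] = p
      & isomorphic G (E * Cp)%type].

Definition case_ii : Prop :=
  exists2 phi : amalgamation (nil2_power 3) H21,
    phi [~ gen_x2, gen_x1] = [~ gen_x4, gen_x3]
    & isomorphic G (amalgamated_product phi).

Definition case_iii : Prop :=
  exists2 phi : amalgamation (quotient_group K54) H21,
    phi [~ gen_x2, gen_x1] =
      [~ quotient_proj K54 gen_x4, quotient_proj K54 gen_x3]
    & isomorphic G (amalgamated_product phi).

End Cases.

(* Main.v *)
(** The alternating forms on G/[G,G] = F_p^5 obtained by composing
the commutator map with the linear functionals of [G,G] form a space U.  A central extension of
G in which an element g of [G,G] stays non-central is given by a cocycle, and up
to coboundaries the cocycles that matter are the elements of the kernel K(U) of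
the wedge product U (x) V^* -> Lambda^3 V^*; hence G is capable if and only if
no proper subspace U' of U satisfies K(U) <= U' (x) V^*.  If such a U' exists,
enlarge it to the kernel of a functional eps on U, and let J in U have
eps J <> 0.  Then J has rank 4 and, for a in V^*, J /\ a in U' /\ V^* forces a = 0, which
leaves only U = <J>, <J, e3 /\ e5> and <J, e3 /\ e5, e4 /\ e5> with
J = e1 /\ e2 + e3 /\ e4, that is, cases (i), (iii) and (ii).  Conversely, in
these groups [x2,x1] = [x4,x3] commutes in every central extension with x3, x4,
x5 (which commute with x1 and x2) and with x1, x2 (which commute with x3 and
x4), so it cannot be non-central.                                            *)

From HB Require Import structures.
From mathcomp Require Import all_boot all_order all_algebra.
From mathcomp Require Import all_fingroup all_solvable.
From mathcomp Require Import generic_quotient boolp ring.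
Require Import Defs.

Set Implicit Arguments.
Unset Strict Implicit.
Unset Printing Implicit Defensive.

Import GRing.Theory.

Local Open Scope group_scope.

(** * Groups of class two and their normal forms *)

(** Cocycles come from products. Suppose w_k in U and sum_k w_k /\ a_k = 0. Read w_k on the
    commutator part of a normal form of g, and a_k on the image of h in V. Then L(g, h) = sum_k
    w_k(g) a_k(h) fails the cocycle identity only by a cubic function on V. The vanishing of the
    3-form makes this function the coboundary of some q, so L + q is a cocycle. For g in [G,G] its
    values at (g, h) and (h, g) differ by sum_k w_k(g) a_k(h). If G is not capable, some g <> 1
    escapes every cocycle, and evaluation at that g is the functional eps. Monomials with a repeated
    index are coboundaries because 2 is invertible.

    Dimension 5 enters as follows. A form J of rank 4 has a line as radical and is symplectic on the
    4-dimensional quotient, where wedging with J is a bijection from linear forms onto 3-forms. So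
    every 3-form u /\ b that vanishes on the radical can be rewritten as J /\ a, and the condition
    on eps then forces a = 0; this pins down u.

    Groups are compared through normal forms: two groups are isomorphic once the same pairs (v, A)
    give the trivial normal form in both. *)

Section Morphisms.
Variables (G H : groupType) (f : G -> H).
Hypothesis fM : {morph f : x y / x * y}.

Lemma morphism1 : f 1 = 1.
Proof. by apply: (mulgI (f 1)); rewrite -fM !mulg1. Qed.

Let F : UMagmaMorphism.type G H :=
  HB.pack f (isUMagmaMorphism.Build G H f (morphism1, fM)).

Lemma morphismV : {morph f : x / x^-1}.
Proof. exact: (gmulfV F). Qed.
Lemma morphismR : {morph f : x y / [~ x, y]}.
Proof. exact: (gmulfR F). Qed.
Lemma morphismX n : {morph f : x / x ^+ n}.
Proof. exact: (gmulfXn F). Qed.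
Lemma morphism_inj : (forall x, f x = 1 -> x = 1) -> injective f.
Proof. by move=> f1 x y fxy; apply/divg1_eq/f1;
  rewrite fM morphismV fxy mulgV. Qed.

Lemma isomorphic_bij : bijective f -> isomorphic G H.
Proof. by move=> bf; exists (F : {multiplicative G -> H}). Qed.

End Morphisms.

Lemma isomorphic_sym (G H : groupType) : isomorphic G H -> isomorphic H G.
Proof.
case=> f [g fK gK]; apply: (@isomorphic_bij _ _ g); last by exists f.
exact: can2_gmulfM fK gK.
Qed.

Lemma isomorphic_trans (G H K : groupType) :
  isomorphic G H -> isomorphic H K -> isomorphic G K.
Proof.
move=> [f bf] [g bg]; apply: (@isomorphic_bij _ _ (g \o f)).
  by move=> x y; rewrite /= !gmulfM.
exact: bij_comp.
Qed.

Lemma surj_inj_bij (A B : choiceType) (f : A -> B) :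
  injective f -> (forall b, exists a, f a = b) -> bijective f.
Proof.
move=> f_inj /choice[g gK]; exists g => // a; exact: f_inj.
Qed.

(** Both groups are the quotient of F by one kernel. A section of [f], obtained by choice and
    followed by [g], gives the isomorphism directly. *)
Lemma isomorphic_of_epi (F X Y : groupType) (f : F -> X) (g : F -> Y) :
    {morph f : a b / a * b} -> {morph g : a b / a * b} ->
    (forall x, exists a, f a = x) -> (forall y, exists a, g a = y) ->
  (forall a, f a = 1 <-> g a = 1) -> isomorphic X Y.
Proof.
move=> fM gM /choice[s sK] g_surj fg.
have fgE a b : f a = f b <-> g a = g b.
  split=> E; apply: divg1_eq; rewrite -morphismV // -?fM -?gM.
    by apply/fg; rewrite fM morphismV // E mulgV.
  by apply/fg; rewrite gM morphismV // E mulgV.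
have gsK a : g (s (f a)) = g a by apply/fgE; rewrite sK.
apply: (@isomorphic_bij _ _ (g \o s)) => [x y /=|].
  by rewrite -gM; apply/fgE; rewrite sK fM !sK.
apply: surj_inj_bij => [x y /fgE|y]; first by rewrite !sK.
by have [a <-] := g_surj y; exists (f a); exact: gsK.
Qed.

Lemma expg_Fp (p : nat) (p_pr : prime p) (G : groupType) (x : G) (n : nat) :
  x ^+ p = 1 -> x ^+ (n%:R : 'F_p)%R = x ^+ n.
Proof.
move=> xp; rewrite val_Fp_nat // [in RHS](divn_eq n p) expgnDr mulnC expgnA.
by rewrite xp expg1n mul1g.
Qed.

Lemma expg_FpD (p : nat) (p_pr : prime p) (G : groupType) (x : G) (a b : 'F_p) :
  x ^+ p = 1 -> x ^+ (a + b)%R = x ^+ a * x ^+ b.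
Proof.
by move=> xp; rewrite -expgnDr -[RHS](expg_Fp p_pr) // natrD !natr_Zp.
Qed.

Lemma expg_FpM (p : nat) (p_pr : prime p) (G : groupType) (x : G) (a b : 'F_p) :
  x ^+ p = 1 -> x ^+ (a * b)%R = x ^+ (a * b)%N.
Proof. by move=> xp; rewrite -[RHS](expg_Fp p_pr) // natrM !natr_Zp. Qed.

Lemma generated_sub (G : groupType) (S T : G -> Prop) x :
  (forall y, S y -> generated T y) -> generated S x -> generated T x.
Proof.
move=> ST; elim=> {x} [x /ST //||x y _ ? _ ?|x _ ?].
- exact: generated_1.
- exact: generated_M.
- exact: generated_V.
Qed.

Lemma generated_morph (G H : groupType) (f : G -> H) (S : G -> Prop) x :
    {morph f : x y / x * y} -> generated S x ->
  generated (fun y => exists2 s, S s & y = f s) (f x).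
Proof.
move=> fM; elim=> {x} [x Sx||x y _ ? _ ?|x _ ?].
- by apply: generated_in; exists x.
- rewrite morphism1 //; exact: generated_1.
- by rewrite fM; exact: generated_M.
- by rewrite morphismV //; exact: generated_V.
Qed.

Lemma generated_X (G : groupType) (S : G -> Prop) x n :
  generated S x -> generated S (x ^+ n).
Proof.
move=> Sx; elim: n => [|n IHn]; first exact: generated_1.
by rewrite expgS; exact: generated_M.
Qed.

Lemma generated_prod (G : groupType) (S : G -> Prop) I (r : seq I) (P : pred I)
    (F : I -> G) :
  (forall i, P i -> generated S (F i)) -> generated S (\prod_(i <- r | P i) F
    i).
Proof.
move=> SF; elim/big_rec: _ => [|i x Pi Sx]; first exact: generated_1.
exact: generated_M (SF _ Pi) Sx.
Qed.

Lemma generated_R (G : groupType) (S : G -> Prop) x y :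
  generated S x -> generated S y -> generated S [~ x, y].
Proof.
move=> Sx Sy; rewrite /commg /conjg; apply: generated_M;
  first exact: generated_V.
by apply: generated_M; [exact: generated_V | exact: generated_M].
Qed.

Lemma comm_centralMg (G : groupType) (x y z : G) :
  central z -> [~ x * z, y] = [~ x, y].
Proof.
move=> cz; rewrite commgEl conjMg (central_conj y cz) invgM -mulgA (mulgA _ _
  z).
by rewrite -commgEl -(cz [~ x, y]) mulKg.
Qed.

Lemma comm_centralgM (G : groupType) (x y z : G) :
  central z -> [~ x, y * z] = [~ x, y].
Proof. by move=> cz; rewrite -invgR comm_centralMg // invgR. Qed.

Definition comm_central (G : groupType) := forall x y : G, central [~ x, y].

Section ClassTwo.
Variables (G : groupType) (G2 : comm_central G).
Implicit Types x y z : G.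

Lemma commMg x y z : [~ x * y, z] = [~ x, z] * [~ y, z].
Proof.
have -> : [~ x * y, z] = y^-1 * [~ x, z] * (y ^ z).
  by rewrite /commg /conjg !gnorm.
by rewrite -(G2 x z y^-1) -mulgA -commgEl.
Qed.

Lemma commgM x y z : [~ x, y * z] = [~ x, y] * [~ x, z].
Proof.
by rewrite -invgR commMg invgM !invgR; exact: G2.
Qed.

Lemma commXg x y n : [~ x ^+ n, y] = [~ x, y] ^+ n.
Proof.
by elim: n => [|n IHn]; rewrite ?comm1g // !expgS commMg IHn.
Qed.

Lemma commgX x y n : [~ x, y ^+ n] = [~ x, y] ^+ n.
Proof.
by elim: n => [|n IHn]; rewrite ?commg1 // !expgS commgM IHn.
Qed.

Lemma central_X z n : central z -> central (z ^+ n).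
Proof. by move=> cz x; apply/commute_sym/commuteX/commute_sym/cz. Qed.

Lemma central_prod I (r : seq I) (P : pred I) (F : I -> G) :
  (forall i, P i -> central (F i)) -> central (\prod_(i <- r | P i) F i).
Proof.
move=> cF; elim/big_rec: _ => [|i x Pi cx]; first exact: central1.
exact: centralM (cF _ Pi) cx.
Qed.

Lemma prodM_central I (r : seq I) (P : pred I) (F H : I -> G) :
    (forall i, P i -> central (H i)) ->
  \prod_(i <- r | P i) (F i * H i) =
  \prod_(i <- r | P i) F i * \prod_(i <- r | P i) H i.
Proof.
move=> cH; elim: r => [|i r IHr]; first by rewrite !big_nil mulg1.
rewrite !big_cons; case: ifP => // Pi; rewrite IHr -!mulgA; congr (_ * _).
by rewrite !mulgA (cH i Pi).
Qed.

Definition comm_prod n (x : 'I_n -> G) (a : 'I_n -> 'I_n -> nat) : G :=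
  \prod_(j < n) \prod_(i < n | (i < j)%N) [~ x j, x i] ^+ a i j.

Lemma comm_prod_central n (x : 'I_n -> G) a : central (comm_prod x a).
Proof.
by apply: central_prod => j _; apply: central_prod => i _; exact: central_X.
Qed.

Lemma comm_prodD n (x : 'I_n -> G) a b :
  comm_prod x (fun i j => (a i j + b i j)%N) = comm_prod x a * comm_prod x b.
Proof.
rewrite /comm_prod -prodM_central => [|j _]; last first.
  by apply: central_prod => i _; exact: central_X.
apply: eq_bigr => j _; rewrite -prodM_central => [|i _]; last exact: central_X.
by apply: eq_bigr => i _; rewrite expgnDr.
Qed.

Lemma comm_prodr I (r : seq I) (P : pred I) y (F : I -> G) :
  [~ y, \prod_(i <- r | P i) F i] = \prod_(i <- r | P i) [~ y, F i].
Proof.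
elim: r => [|i r IHr]; first by rewrite !big_nil commg1.
by rewrite !big_cons; case: ifP => // _; rewrite commgM IHr.
Qed.

(** Moving x_i ^ w_i to the left past x_j ^ v_j with i < j costs the central factor [x_j, x_i] ^
    (v_j w_i). The induction splits off the last generator. *)
Lemma collect n (x : 'I_n -> G) (v w : 'I_n -> nat) :
  \prod_i x i ^+ v i * \prod_i x i ^+ w i =
  \prod_i x i ^+ (v i + w i) * comm_prod x (fun i j => v j * w i)%N.
Proof.
elim: n x v w => [|n IHn] x v w; first by rewrite /comm_prod !big_ord0 mulg1.
rewrite !big_ord_recr /=; set m := ord_max.
have -> : comm_prod x (fun i j => v j * w i)%N =
    comm_prod (x \o widen_ord (leqnSn n))
      (fun i j => v (widen_ord (leqnSn n) j) * w (widen_ord (leqnSn n) i))%N *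
    [~ x m ^+ v m, \prod_(i < n) x (widen_ord (leqnSn n) i) ^+
                                   w (widen_ord (leqnSn n) i)].
  rewrite /comm_prod big_ord_recr /=; congr (_ * _).
    apply: eq_bigr => j _; rewrite big_mkcond big_ord_recr /=.
    by rewrite ltnNge ltnW // mulg1 -big_mkcond.
  rewrite comm_prodr big_mkcond big_ord_recr /= ltnn mulg1.
  by apply: eq_bigr => i _; rewrite ltn_ord commgX commXg -expgnA.
have := IHn (x \o widen_ord (leqnSn n)) (v \o widen_ord (leqnSn n))
  (w \o widen_ord (leqnSn n)); rewrite /=.
set X := bigop _ _ _; set Y := bigop _ _ _; set Z := bigop _ _ _.
set C := comm_prod _ _ => XY; set D := [~ _, _].
have cC : central C by exact: comm_prod_central.
have cD : central D by exact: G2.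
have xY : x m ^+ v m * Y = Y * x m ^+ v m * D by exact: commgC.
move: D cD xY => D cD xY.
rewrite mulgA -(mulgA X) xY !mulgA XY expgnDr.
rewrite -!mulgA; congr (_ * _).
by rewrite cC -!mulgA; congr (_ * _); rewrite cD -!mulgA.
Qed.

End ClassTwo.

Section NormalForm.
Variables (p : nat) (p_pr : prime p) (G : groupType) (G2 : comm_central G).
Variables (n : nat) (x : 'I_n -> G).
Hypothesis x_p : forall i, x i ^+ p = 1.

(** Only the entries of [A] strictly above the diagonal matter. Full matrices are kept so that the
    correction term in a product is simply w^T v. *)
Definition normal_form (v : 'rV['F_p]_n) (A : 'M['F_p]_n) : G :=
  \prod_i x i ^+ v 0%R i * comm_prod x (fun i j => A i j).

Lemma comm_gen_p i j : [~ x i, x j] ^+ p = 1.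
Proof. by rewrite -commXg // x_p comm1g. Qed.

Lemma normal_formM v A w B :
  normal_form v A * normal_form w B =
  normal_form (v + w)%R (A + B + w^T *m v)%R.
Proof.
rewrite /normal_form mulgA -(mulgA _ (comm_prod _ _)).
rewrite [comm_prod _ _ * _](@comm_prod_central _ _ _ _ _ _) // mulgA collect //.
rewrite -!mulgA; congr (_ * _).
  by apply: eq_bigr => i _; rewrite mxE expgnDr expg_FpD.
rewrite -!comm_prodD //; apply: eq_bigr => j _; apply: eq_bigr => i _.
have xp := comm_gen_p j i.
rewrite !mxE big_ord1 !mxE !(expgnDr, expg_FpD, expg_FpM) //.
by rewrite -!expgnDr; congr (_ ^+ _); rewrite addnC mulnC.
Qed.

Lemma comm_prod_only (a : 'I_n -> 'I_n -> nat) (i0 j0 : 'I_n) :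
    (i0 < j0)%N -> (forall i j : 'I_n, (i, j) != (i0, j0) -> a i j = 0%N) ->
  comm_prod x a = [~ x j0, x i0] ^+ a i0 j0.
Proof.
move=> lt_ij a0; rewrite /comm_prod (big_only1 j0) //=.
  by rewrite (big_only1 i0) // => i ne_i _;
    rewrite a0 // xpair_eqE negb_and ne_i.
move=> j ne_j _; rewrite big1 // => i _.
by rewrite a0 // xpair_eqE negb_and ne_j orbT.
Qed.

Lemma comm_prod1 (a : 'I_n -> 'I_n -> nat) : (forall i j : 'I_n, (i < j)%N ->
  [~ x j, x i] ^+ a i j = 1) ->
  comm_prod x a = 1.
Proof.
by move=> a0; rewrite /comm_prod big1 // => j _; rewrite big1 // => i;
  exact: a0.
Qed.

Lemma normal_form0 : normal_form 0%R 0%R = 1.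
Proof.
rewrite /normal_form comm_prod1 ?big1 ?mulg1 // => [i _|i j _];
by rewrite mxE expg0.
Qed.

Lemma normal_form_gen i : normal_form (delta_mx 0 i)%R 0%R = x i.
Proof.
rewrite /normal_form comm_prod1 => [|j k _]; last by rewrite mxE expg0.
rewrite mulg1 (big_only1 i) //= => [|j ne_j _]; rewrite mxE ?eqxx.
  by rewrite (expg_Fp p_pr 1%N) ?expg1.
by rewrite (negPf ne_j) /= expg0.
Qed.

Lemma normal_form_comm (i j : 'I_n) :
  normal_form 0%R (delta_mx i j)%R = if (i < j)%N then [~ x j, x i] else 1.
Proof.
rewrite /normal_form big1 ?mul1g => [|k _]; last by rewrite mxE expg0.
case: ifPn => [lt_ij|ge_ij].
  rewrite (comm_prod_only lt_ij) ?mxE ?eqxx.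
    by rewrite (expg_Fp p_pr 1%N) ?expg1 // comm_gen_p.
  move=> k l; rewrite xpair_eqE mxE negb_and.
  by case/orP=> /negPf-> //; rewrite andbF.
rewrite comm_prod1 // => k l lt_kl; rewrite mxE.
case: andP => [[/eqP ki /eqP lj]|_]; last by rewrite expg0.
by rewrite -ki -lj lt_kl in ge_ij.
Qed.

Lemma normal_formV v A :
  (normal_form v A)^-1 = normal_form (- v)%R (- A + v^T *m v)%R.
Proof.
apply: mulg1_eq; rewrite normal_formM subrr -normal_form0; congr normal_form.
by rewrite linearN /= mulNmx addrA subrr add0r subrr.
Qed.

Hypothesis x_gen : forall g, generated (fun y => exists i, y = x i) g.

Lemma normal_form_surj g : exists v A, g = normal_form v A.
Proof.
elim: (x_gen g) => {g} [g [i ->]||g h _ [v [A ->]] _ [w [B ->]]|g _ [v [A ->]]].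
- by exists (delta_mx 0 i)%R, 0%R; rewrite normal_form_gen.
- by exists 0%R, 0%R; rewrite normal_form0.
- by exists (v + w)%R, (A + B + w^T *m v)%R; rewrite normal_formM.
- by exists (- v)%R, (- A + v^T *m v)%R; rewrite normal_formV.
Qed.

End NormalForm.

Lemma morph_normal_form p (G H : groupType) (f : G -> H) n (x : 'I_n -> G)
    (v : 'rV['F_p]_n) (A : 'M['F_p]_n) :
  {morph f : x y / x * y} -> f (normal_form x v A) = normal_form (f \o x) v A.
Proof.
move=> fM; rewrite /normal_form fM.
have fP I (r : seq I) (P : pred I) (F : I -> G) :
    f (\prod_(i <- r | P i) F i) = \prod_(i <- r | P i) f (F i).
  by apply: big_morph => //; exact: morphism1.
rewrite /comm_prod !fP; congr (_ * _).
  by apply: eq_bigr => i _; rewrite morphismX.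
apply: eq_bigr => j _; rewrite fP; apply: eq_bigr => i _.
by rewrite morphismX // morphismR.
Qed.

(** * Groups on V x W defined by a biadditive map *)

Record biadditive (V W : zmodType) := Biadditive {
  bia_fun :> V -> V -> W;
  biaDl u v w : bia_fun (u + v)%R w = (bia_fun u w + bia_fun v w)%R;
  biaDr u v w : bia_fun u (v + w)%R = (bia_fun u v + bia_fun u w)%R
}.

Definition heis (V W : zmodType) (b : biadditive V W) : Type := (V * W)%type.

Section Heisenberg.
Variables (V W : zmodType) (b : biadditive V W).
Local Open Scope ring_scope.

Lemma bia0l v : b 0 v = 0.
Proof. by apply: (addIr (b 0 v)); rewrite -biaDl !add0r. Qed.
Lemma bia0r v : b v 0 = 0.
Proof. by apply: (addIr (b v 0)); rewrite -biaDr !add0r. Qed.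
Lemma biaNl u v : b (- u) v = - b u v.
Proof. by apply: (addIr (b u v)); rewrite -biaDl !addNr bia0l. Qed.
Lemma biaNr u v : b u (- v) = - b u v.
Proof. by apply: (addIr (b u v)); rewrite -biaDr !addNr bia0r. Qed.

Definition heis_mul (g h : heis b) : heis b :=
  (g.1 + h.1, g.2 + h.2 + b g.1 h.1).
Definition heis_one : heis b := (0, 0).
Definition heis_inv (g : heis b) : heis b := (- g.1, - g.2 + b g.1 g.1).

Lemma heis_mulA : associative heis_mul.
Proof.
move=> [u r] [v s] [w t]; rewrite /heis_mul /=; congr pair; first exact: addrA.
rewrite biaDl biaDr -!addrA; congr (_ + (_ + _)).
by rewrite [b v w + _]addrC -addrA [RHS]addrCA.
Qed.

Lemma heis_mul1g : left_id heis_one heis_mul.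
Proof. by move=> [v w]; rewrite /heis_mul /= bia0l !add0r addr0. Qed.
Lemma heis_mulg1 : right_id heis_one heis_mul.
Proof. by move=> [v w]; rewrite /heis_mul /= bia0r !addr0. Qed.
Lemma heis_mulVg : left_inverse heis_one heis_inv heis_mul.
Proof.
move=> [v w]; congr pair; rewrite /= ?addNr // biaNl.
by rewrite addrAC addrK addNr.
Qed.
Lemma heis_mulgV : right_inverse heis_one heis_inv heis_mul.
Proof.
move=> [v w]; congr pair; rewrite /= ?addrN // biaNr.
by rewrite addrA subrr add0r subrr.
Qed.

HB.instance Definition _ := Choice.on (heis b).
HB.instance Definition _ := isGroup.Build (heis b)
  heis_mulA heis_mul1g heis_mulg1 heis_mulVg heis_mulgV.

Lemma heisME (g h : heis b) : (g * h)%g = (g.1 + h.1, g.2 + h.2 + b g.1 h.1).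
Proof. by []. Qed.

Lemma heis_commE (g h : heis b) : [~ g, h]%g = (0, b g.1 h.1 - b h.1 g.1).
Proof.
apply: (mulgI (h * g)%g); rewrite -commgC !heisME /= bia0r !addr0.
congr pair; first exact: addrC.
by rewrite [g.2 + _]addrC -!addrA [b h.1 _ + _]addrC addrNK.
Qed.

Lemma heis_central (w : W) : central ((0, w) : heis b).
Proof.
move=> [u t]; rewrite /commute !heisME /= bia0l bia0r !addr0 add0r.
by rewrite addrC.
Qed.

Lemma heis_centerM : {morph (fun w => (0, w) : heis b) : u v / u + v >-> (u *
  v)%g}.
Proof. by move=> u v; rewrite heisME /= bia0l !addr0. Qed.

Lemma heis_centerX w n : (((0, w) : heis b) ^+ n)%g = (0, w *+ n).
Proof.
elim: n => [|n IHn]; first by rewrite mulr0n.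
by rewrite expgS IHn mulrS -heis_centerM.
Qed.

Lemma heis_comm_central : comm_central (heis b).
Proof. by move=> g h; rewrite heis_commE; exact: heis_central. Qed.

End Heisenberg.

(** * Alternating forms paired with commutator exponents *)

Section UpperPairing.
Variables (F : fieldType) (n : nat).
Implicit Types (w A B : 'M[F]_n) (u v : 'rV[F]_n).
Local Open Scope ring_scope.

(** The form [w] as a functional on the exponents of a normal form: for i < j it takes the value w i
    j on the commutator [x_j, x_i]. *)
Definition upper_pairing w A : F := \sum_(j < n) \sum_(i < n | (i < j)%N) w i j
  * A i j.

Lemma upper_pairing_is_linear w : linear_for *%R (upper_pairing w).
Proof.
move=> c A B; rewrite /upper_pairing mulr_sumr -big_split /=.
apply: eq_bigr => j _; rewrite mulr_sumr -big_split /=.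
by apply: eq_bigr => i _; rewrite !mxE mulrDr mulrCA.
Qed.

HB.instance Definition _ w :=
  GRing.isLinear.Build F 'M[F]_n F *%R (upper_pairing w)
    (upper_pairing_is_linear w).

Definition form w u v : F := (u *m w *m v^T) 0 0.

Definition alternating w := (forall i, w i i = 0) /\ (forall i j, w j i = - w i
  j).

Lemma formE w u v : form w u v = \sum_i \sum_j u 0 i * w i j * v 0 j.
Proof.
rewrite /form mxE exchange_big; apply: eq_bigr => j _.
by rewrite !mxE mulr_suml.
Qed.

(** Split the double sum at the diagonal: the part below it is minus the part above it with u and v
    exchanged. Hence in a group whose product is corrected by the upper part, the commutator is the
    whole form. *)
Lemma form_upper w u v : alternating w ->
  form w u v = upper_pairing w (u^T *m v) - upper_pairing w (v^T *m u).
Proof.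
move=> [w0 wN]; rewrite formE exchange_big /=.
have split j : \sum_i u 0 i * w i j * v 0 j =
    \sum_(i < n | (i < j)%N) u 0 i * w i j * v 0 j +
    \sum_(i < n | (j < i)%N) u 0 i * w i j * v 0 j.
  rewrite (bigID (fun i : 'I_n => (i < j)%N)) /=; congr (_ + _).
  rewrite (bigD1 j) ?ltnn //= w0 mulr0 mul0r add0r.
  by apply: eq_bigl => i; rewrite -leqNgt andbC ltn_neqAle eq_sym.
rewrite (eq_bigr _ (fun j _ => split j)) big_split /=; congr (_ + _).
  apply: eq_bigr => j _; apply: eq_bigr => i _.
  by rewrite mxE big_ord1 !mxE; ring.
rewrite /upper_pairing -sumrN.
rewrite (exchange_big_dep xpredT) //=; apply: eq_bigr => i _.
rewrite -sumrN; apply: eq_bigr => j _.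
by rewrite mxE big_ord1 !mxE (wN i j); ring.
Qed.

Lemma formDl w u u' v : form w (u + u') v = form w u v + form w u' v.
Proof. by rewrite /form !mulmxDl mxE. Qed.
Lemma formZl w a u v : form w (a *: u) v = a * form w u v.
Proof. by rewrite /form -!scalemxAl mxE. Qed.
Lemma formDr w u v v' : form w u (v + v') = form w u v + form w u v'.
Proof. by rewrite /form linearD mulmxDr mxE. Qed.
Lemma formZr w a u v : form w u (a *: v) = a * form w u v.
Proof. by rewrite /form linearZ -scalemxAr mxE. Qed.

Lemma formC w u v : alternating w -> form w v u = - form w u v.
Proof. by move=> alt_w; rewrite !form_upper // opprB. Qed.
Lemma formuu w u : alternating w -> form w u u = 0.
Proof. by move=> alt_w; rewrite !form_upper // subrr. Qed.
Lemma form_delta w i j : form w (delta_mx 0 i) (delta_mx 0 j) = w i j.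
Proof. by rewrite /form trmx_delta -rowE -colE !mxE. Qed.

End UpperPairing.

(** * Model groups and their recognition *)

Section Models.
Variable F : fieldType.
Local Open Scope ring_scope.

Section Free.
Variable n : nat.
Implicit Types u v w : 'rV[F]_n.

(** The correction term of [normal_formM], so that normal forms are a morphism from the free model.
    The entries on and below the diagonal add a central part that every normal form ignores. *)
Definition free_form v w : 'M[F]_n := w^T *m v.
Lemma free_formDl u v w : free_form (u + v) w = free_form u w + free_form v w.
Proof. exact: mulmxDr. Qed.
Lemma free_formDr u v w : free_form u (v + w) = free_form u v + free_form u w.
Proof. by rewrite /free_form linearD mulmxDl. Qed.
Definition free_bia := Biadditive free_formDl free_formDr.

Variables (m : nat) (Om : 'I_m -> 'M[F]_n).
Definition forms_fun v w : 'rV[F]_m :=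
  \row_k upper_pairing (Om k) (free_form v w).
Lemma forms_funDl u v w : forms_fun (u + v) w = forms_fun u w + forms_fun v w.
Proof. by apply/rowP=> k; rewrite !mxE free_formDl linearD. Qed.
Lemma forms_funDr u v w : forms_fun u (v + w) = forms_fun u v + forms_fun u w.
Proof. by apply/rowP=> k; rewrite !mxE free_formDr linearD. Qed.
Definition forms_bia := Biadditive forms_funDl forms_funDr.

End Free.

Definition free_model n : groupType := heis (free_bia n).
Definition forms_model n m (Om : 'I_m -> 'M[F]_n) : groupType :=
  heis (forms_bia Om).

Definition free_to_forms n m (Om : 'I_m -> 'M[F]_n) (a : free_model n) :
    forms_model Om :=
  (a.1, \row_k upper_pairing (Om k) a.2).

Lemma free_to_formsM n m (Om : 'I_m -> 'M[F]_n) :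
  {morph free_to_forms Om : a b / (a * b)%g}.
Proof.
move=> [v A] [w B]; rewrite /free_to_forms !heisME /=; congr pair.
by apply/rowP=> k; rewrite !mxE !linearD.
Qed.

End Models.

Section Recognition.
Variables (p : nat) (p_pr : prime p) (G : groupType) (G2 : comm_central G).
Variables (n : nat) (x : 'I_n -> G).
Hypothesis x_p : forall i, x i ^+ p = 1.
Hypothesis x_gen : forall g, generated (fun y => exists i, y = x i) g.

(** G and the model are both images of [free_model], and the second hypothesis says that the two
    kernels coincide. *)
Lemma isomorphic_forms_model m (Om : 'I_m -> 'M['F_p]_n) :
    (forall w : 'rV_m, exists A, (\row_k upper_pairing (Om k) A)%R = w) ->
    (forall (v : 'rV_n) A, normal_form x v A = 1 <->
       v = 0%R /\ forall k, upper_pairing (Om k) A = 0%R) ->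
  isomorphic G (forms_model Om).
Proof.
move=> Om_surj kerE.
apply: (@isomorphic_of_epi (free_model 'F_p n) _ _
  (fun a => normal_form x a.1 a.2) (free_to_forms Om)).
- by move=> [v A] [w B]; rewrite heisME /= normal_formM.
- exact: free_to_formsM.
- by move=> g; have [v [A ->]] := normal_form_surj p_pr G2 x_p x_gen g;
  exists (v, A).
- by move=> [v w]; have [A wE] := Om_surj w; exists (v, A);
  rewrite /free_to_forms wE.
- move=> [v A]; rewrite kerE /=; split=> [[-> A0]|[-> /rowP A0]].
    by congr pair; apply/rowP=> k; rewrite !mxE A0.
  by split=> // k; have := A0 k; rewrite !mxE.
Qed.

End Recognition.

(** * Minimal generation and relations between commutators *)

Lemma comm_central_of_class2 (G : groupType) :
  class_at_most_two G -> comm_central G.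
Proof.
move=> G2 x y z; apply/commgP/eqP/G2; apply: generated_in.
by exists [~ x, y], z; split=> //; apply: generated_in; exists x, y.
Qed.

Lemma generated_or_central (G : groupType) (S : G -> Prop) g :
    generated (fun y => S y \/ central y) g ->
  exists t z, [/\ generated S t, central z & g = t * z].
Proof.
elim=> {g} [g [Sg|cg]||g h _ [t [z [St cz ->]]] _|g _ [t [z [St cz ->]]]].
- exists g, 1; split;
  [exact: generated_in | exact: central1 | by rewrite mulg1].
- by exists 1, g; split; rewrite ?mul1g //; exact: generated_1.
- exists 1, 1; split; [exact: generated_1 | exact: central1 | by rewrite mulg1].
- case=> t' [z' [St' cz' ->]]; exists (t * t'), (z * z'); split.
  + exact: generated_M.
  + exact: centralM.
  + by rewrite -!mulgA; congr (_ * _); rewrite !mulgA cz.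
- exists t^-1, z^-1; split; [exact: generated_V | exact: centralV |].
  by rewrite invgM (centralV cz).
Qed.

(* Frattini argument. *)
Lemma generated_comm_mod_center (G : groupType) (S : G -> Prop) :
    comm_central G -> (forall g, generated (fun y => S y \/ central y) g) ->
  forall g h, generated S [~ g, h].
Proof.
move=> G2 GS g h.
have [t [z [St cz ->]]] := generated_or_central (GS g).
have [t' [z' [St' cz' ->]]] := generated_or_central (GS h).
rewrite comm_centralMg // comm_centralgM //.
exact: generated_R.
Qed.

Lemma generated_prod_factor (G : groupType) (S : G -> Prop) n (F : 'I_n -> G) i
  :
    generated S (\prod_k F k) -> (forall k, k != i -> generated S (F k)) ->
  generated S (F i).
Proof.
have := index_enum_uniq 'I_n;
  have : i \in index_enum 'I_n by rewrite mem_index_enum.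
case/splitPr=> r1 r2;
  rewrite cat_uniq /= => /and3P[_ /norP[ir1 _] /andP[ir2 _]].
rewrite big_cat big_cons /= => SF Sk.
have Sr r : i \notin r -> generated S (\prod_(k <- r) F k).
  move=> ir; rewrite big_seq_cond; apply: generated_prod => k /andP[kr _].
  by apply: Sk; apply: contraNneq ir => <-.
set P1 := bigop _ _ _ in SF; set P2 := bigop _ _ _ in SF.
have -> : F i = P1^-1 * (P1 * (F i * P2)) * P2^-1 by rewrite mulKg mulgK.
apply: generated_M; last exact: generated_V (Sr _ ir2).
exact: generated_M (generated_V (Sr _ ir1)) SF.
Qed.

Section MinimalGeneration.
Variables (p : nat) (p_pr : prime p) (G : groupType) (G2 : comm_central G).
Variables (n : nat) (x : 'I_n -> G).
Hypothesis x_p : forall i, x i ^+ p = 1.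
Hypothesis x_gen : forall g, generated (fun y => exists i, y = x i) g.

(** If v_i <> 0, the relation expresses x_i through the other generators and commutators. Modulo the
    centre the other generators suffice, so by the Frattini argument the subgroup they generate
    contains all commutators. It then contains x_i, and n - 1 elements generate G. *)
Lemma normal_form_indep (v : 'rV['F_p]_n) A :
  ~ n_generated G n.-1 -> normal_form x v A = 1 -> v = 0%R.
Proof.
move=> not_gen vA1; apply/eqP; apply: (contra_notT _ not_gen) => /rV0Pn[i vi].
pose S g := exists2 j, j != i & g = x j.
pose F k := x k ^+ v 0%R k.
have PE : \prod_k F k = (comm_prod x (fun i j => A i j))^-1.
  by apply: divg1_eq; rewrite invgK.
have xi_inv : F i ^+ (v 0%R i)^-1%R = x i.
  by rewrite -expgnA -expg_FpM // mulfV // (expg_Fp p_pr 1%N) // expg1.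
have Fi : generated (fun y => S y \/ central y) (x i).
    rewrite -xi_inv; apply: generated_X.
  apply: (@generated_prod_factor _ _ _ F) => [|k ne_k]; last first.
    by apply: generated_X; apply: generated_in; left; exists k.
  rewrite PE.
  by apply: generated_in; right; apply: centralV; exact: comm_prod_central.
have SZ g : generated (fun y => S y \/ central y) g.
  apply: generated_sub (x_gen g) => _ [j ->].
  by have [->//|ne_j] := eqVneq j i; apply: generated_in; left; exists j.
have SR := generated_comm_mod_center G2 SZ.
have Si : generated S (x i).
    rewrite -xi_inv; apply: generated_X.
  apply: (@generated_prod_factor _ _ _ F) => [|k ne_k]; last first.
    by apply: generated_X; apply: generated_in; exists k.
  rewrite PE.
  apply: generated_V; apply: generated_prod => j _;
    apply: generated_prod => k _.
  by apply: generated_X; exact: SR.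
have sz : size [seq x j | j <- enum 'I_n & j != i] == n.-1.
  rewrite size_map -rem_filter ?enum_uniq // size_rem ?mem_enum //.
  by rewrite size_enum_ord.
exists (Tuple sz) => g; apply: generated_sub (x_gen g) => _ [j ->].
have [->|ne_j] := eqVneq j i.
  apply: generated_sub Si => _ [k ne_k ->]; apply: generated_in.
  by apply: map_f; rewrite mem_filter ne_k mem_enum.
by apply: generated_in; apply: map_f; rewrite mem_filter ne_j mem_enum.
Qed.

Definition relator (A : 'M['F_p]_n) := normal_form x 0%R A = 1.

(** The space U, encoded as the annihilator of the relators so that [G, G] need not be given a
    vector space structure. *)
Definition relator_forms (w : 'M['F_p]_n) :=
  alternating w /\ forall A, relator A -> upper_pairing w A = 0%R.

Lemma relatorD A B : relator A -> relator B -> relator (A + B)%R.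
Proof.
move=> A1 B1; have := normal_formM p_pr G2 x_p 0%R A 0%R B.
by rewrite trmx0 mul0mx !addr0 A1 B1 mulg1 => /esym.
Qed.

Lemma relator0 : relator 0%R.
Proof. exact: normal_form0. Qed.

Lemma relatorZ c A : relator A -> relator (c *: A)%R.
Proof.
move=> A1; rewrite -[c]natr_Zp scaler_nat; elim: (nat_of_ord c) => [|k IHk].
  by rewrite mulr0n; exact: relator0.
by rewrite mulrS; exact: relatorD.
Qed.

Lemma relator_delta (i j : 'I_n) : ~~ (i < j)%N -> relator (delta_mx i j)%R.
Proof. by move=> ge_ij; rewrite /relator normal_form_comm // (negPf ge_ij). Qed.

Lemma relator_sum I (r : seq I) (P : pred I) (B : I -> 'M['F_p]_n) :
  (forall i, P i -> relator (B i)) -> relator (\sum_(i <- r | P i) B i)%R.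
Proof.
move=> rB; elim/big_rec: _ => [|i C Pi rC]; first exact: relator0.
exact: relatorD (rB _ Pi) rC.
Qed.

(** Double annihilator. The relators, finitely many, are the rows of [M], and each column of its
    cokernel is a functional [phi] killing them. Matrix units on and below the diagonal are
    relators, so [phi] is determined by its values above the diagonal, which extend to the
    alternating form [w]. *)
Lemma relator_separation A :
  (forall w, relator_forms w -> upper_pairing w A = 0%R) -> relator A.
Proof.
move=> wA; pose R := [set B | `[< relator B >]].
pose M := (\matrix_(i < #|R|) mxvec (enum_val i))%R.
have RP (i : 'I_#|R|) : relator (enum_val i).
  by have := enum_valP i; rewrite inE => /asboolP.
have relM B : (mxvec B <= M)%MS -> relator B.
  case/submxP=> D BE; have -> : B = (\sum_i D 0%R i *: enum_val i)%R.
    apply: (can_inj mxvecK); rewrite linear_sum BE mulmx_sum_row.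
    by apply: eq_bigr => i _; rewrite linearZ rowK.
  by apply: relator_sum => i _; exact: relatorZ.
apply: relM; rewrite submxE; apply/eqP/rowP=> k; rewrite [RHS]mxE.
pose phi B := ((mxvec B *m cokermx M) 0 k)%R.
have phiR B : relator B -> phi B = 0%R.
  move=> rB; have RB : B \in R by rewrite inE; apply/asboolP.
  have : (mxvec B <= M)%MS.
    have -> : mxvec B = row (enum_rank_in RB B) M by rewrite rowK enum_rankK_in.
    exact: row_sub.
  by rewrite submxE /phi => /eqP->; rewrite mxE.
pose w := (\matrix_(i, j) if (i < j)%N then phi (delta_mx i j) else
             if (j < i)%N then - phi (delta_mx j i) else 0)%R.
have phi_sum I (r : seq I) (P : pred I) (B : I -> 'M_n) :
    phi (\sum_(i <- r | P i) B i)%R = (\sum_(i <- r | P i) phi (B i))%R.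
  by rewrite /phi linear_sum mulmx_suml summxE.
have phiZ c B : phi (c *: B)%R = (c * phi B)%R.
  by rewrite /phi linearZ -scalemxAl mxE.
have phiE B : phi B = upper_pairing w B.
  rewrite {1}(matrix_sum_delta B) phi_sum.
  under eq_bigr do rewrite phi_sum.
  rewrite exchange_big /=; apply: eq_bigr => j _; rewrite [RHS]big_mkcond /=.
  apply: eq_bigr => i _; rewrite phiZ; case: ifPn => [lt_ij|ge_ij].
    by rewrite [w i j]mxE lt_ij mulrC.
  by rewrite phiR ?mulr0 //; exact: relator_delta.
rewrite -/(phi A) phiE wA //; split; last by move=> B rB; rewrite -phiE phiR.
split=> [i|i j]; rewrite !mxE ?ltnn //.
by case: ltngtP; rewrite ?opprK ?oppr0.
Qed.

End MinimalGeneration.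

(** * Central extensions *)

(** If s commutes with a and b, a lift of s to H conjugates their lifts into central multiples,
    hence fixes the commutator of the lifts. The same holds for c and d, whose lifted commutator
    agrees with that of a and b up to a central factor. So the lift of [a, b] commutes with lifts of
    all generators and is central. *)
Lemma not_capable_commuting (G : groupType) (a b c d : G) :
    [~ a, b] = [~ c, d] -> [~ a, b] <> 1 ->
    (forall g, generated (fun s => commute s a /\ commute s b \/
                                   commute s c /\ commute s d) g) ->
  ~ capable G.
Proof.
move=> abcd ab1 gen [H [f [f' fK f'K]]]; apply: ab1; apply: (can_inj fK).
pose q := quotient_proj (center_nsub H).
have qM : {morph q : x y / x * y} by exact: quotient_projM.
have fM : {morph f : x y / x * y} by exact: gmulfM.
pose l g : H := repr (f g).
have lK g : q (l g) = f g by exact: quotient_reprK.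
rewrite [RHS](morphism1 fM) (morphismR fM) -!lK -(morphismR qM) -(morphism1 qM).
have commP x y : commute x y -> central [~ l x, l y].
  move=> cxy; have /quotient_projP : q 1 = q [~ l x, l y].
    rewrite (morphism1 qM) (morphismR qM) !lK -(morphismR fM).
    by have /commgP/eqP-> := cxy; rewrite (morphism1 fM).
  by rewrite invg1 mul1g.
have conjE x y : commute x y -> exists2 z, central z & l x ^ l y = l x * z.
  by move=> /commP; exists [~ l x, l y] => //; rewrite mulKVg.
(* s commutes with x, y modulo the center, so it fixes their commutator. *)
have fix_comm x y s : commute s x -> commute s y -> commute [~ l x, l y] (l s).
  move=> sx sy; have /conjE[z cz zE] := commute_sym sx.
  have /conjE[t ct tE] := commute_sym sy.
  apply/commgP/conjg_fixP; rewrite conjRg zE tE.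
  by rewrite comm_centralMg // comm_centralgM.
have qE x y : q x = q y -> exists2 t, central t & y = x * t.
    by move=> /quotient_projP ct; exists (x^-1 * y); rewrite ?mulVKg.
  have abP g z : q z = f g -> commute [~ l a, l b] z.
    elim: (gen g) z => {g} [g gS||g h _ gab _ hab|g _ gab] z zE.
    - have [t ct ->] : exists2 t, central t & z = l g * t by apply: qE;
      rewrite lK.
      apply: commuteM; last exact/commute_sym/ct.
      case: gS => [[ga gb]|[gc gd]]; first exact: fix_comm.
      have [r cr ->] : exists2 r, central r & [~ l a, l b] = [~ l c, l d] * r.
        by apply: qE; rewrite !(morphismR qM) !lK -!(morphismR fM) abcd.
      apply: commute_sym; apply: commuteM; last exact/commute_sym/cr.
      exact/commute_sym/fix_comm.
    - have [t ct ->] : exists2 t, central t & z = 1 * t.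
        by apply: qE; rewrite zE (morphism1 fM) (morphism1 qM).
      by rewrite mul1g; exact/commute_sym/ct.
    - have [t ct ->] : exists2 t, central t & z = l g * l h * t.
        by apply: qE; rewrite qM !lK zE fM.
      apply: commuteM; last exact/commute_sym/ct.
      by apply: commuteM; [apply: gab | apply: hab]; rewrite lK.
    - rewrite -[z]invgK; apply: commuteV; apply: gab.
      by rewrite (morphismV qM) zE (morphismV fM) invgK.
  apply/esym/quotient_projP; rewrite invg1 mul1g => z.
  by apply: (abP (f' (q z))); rewrite f'K.
Qed.

Definition normalized_cocycle (G : groupType) (V : zmodType) (f : G -> G -> V)
  :=
  [/\ forall g, f 1 g = 0%R, forall g, f g 1 = 0%R
    & forall g h k, (f g h + f (g * h)%g k = f h k + f g (h * k)%g)%R].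

Section CocycleExtension.
Variables (G : groupType) (V : zmodType).
Local Open Scope ring_scope.

Definition cocycle := {f : G -> G -> V | normalized_cocycle f}.

(* Using all the cocycles at once makes one extension detect every element    *)
(* that some cocycle detects.                                                 *)
Definition cocycle_ext : Type := (G * (cocycle -> V))%type.

Implicit Types x y : cocycle_ext.

Definition cext_mul x y : cocycle_ext :=
  ((x.1 * y.1)%g, fun c => x.2 c + y.2 c + sval c x.1 y.1).
Definition cext_one : cocycle_ext := (1%g, fun=> 0).
Definition cext_inv x : cocycle_ext :=
  ((x.1^-1)%g, fun c => - x.2 c - sval c (x.1^-1)%g x.1).

Lemma cext_mulA : associative cext_mul.
Proof.
move=> [g a] [h b] [k c]; congr pair; first exact: mulgA.
apply/funext => -[f [f1g fg1 fA]] /=.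
by rewrite -!addrA; congr (_ + (_ + _)); rewrite -fA addrCA.
Qed.

Lemma cext_mul1g : left_id cext_one cext_mul.
Proof.
move=> [g a]; congr pair; first exact: mul1g.
by apply/funext => -[f [f1g fg1 fA]] /=; rewrite f1g add0r addr0.
Qed.

Lemma cext_mulg1 : right_id cext_one cext_mul.
Proof.
move=> [g a]; congr pair; first exact: mulg1.
by apply/funext => -[f [f1g fg1 fA]] /=; rewrite fg1 !addr0.
Qed.

Lemma cext_mulVg : left_inverse cext_one cext_inv cext_mul.
Proof.
move=> [g a]; congr pair; first exact: mulVg.
apply/funext => -[f [f1g fg1 fA]] /=.
by rewrite addrAC addrNK addNr.
Qed.

Lemma cext_mulgV : right_inverse cext_one cext_inv cext_mul.
Proof.
move=> [g a]; congr pair; first exact: mulgV.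
apply/funext => -[f [f1g fg1 fA]] /=.
have := fA g g^-1%g g; rewrite mulgV mulVg f1g fg1 !addr0 => ->.
by rewrite addrA subrr add0r addNr.
Qed.

HB.instance Definition _ := Choice.on cocycle_ext.
HB.instance Definition _ := isGroup.Build cocycle_ext
  cext_mulA cext_mul1g cext_mulg1 cext_mulVg cext_mulgV.

Lemma cextME x y : (x * y)%g = cext_mul x y.
Proof. by []. Qed.

Lemma cext_central (a : cocycle -> V) : central ((1%g, a) : cocycle_ext).
Proof.
move=> [h c]; rewrite /commute !cextME /cext_mul /=.
congr pair; first by rewrite mul1g mulg1.
by apply/funext => -[f [f1g fg1 fA]] /=; rewrite f1g fg1 !addr0 addrC.
Qed.

(** The lifts (g, 0) and (h, 0) commute only if every cocycle takes equal values at (g, h) and (h,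
    g). So the centre of the extension is exactly the kernel of its projection to G. *)
Lemma capable_of_cocycles :
    (forall g : G, central g -> g <> 1%g ->
       exists f h, normalized_cocycle f /\ f g h <> f h g :> V) ->
  capable G.
Proof.
move=> Gf; exists cocycle_ext.
pose q := quotient_proj (center_nsub cocycle_ext).
pose s (g : G) : cocycle_ext := (g, fun=> 0).
have qE (x y : cocycle_ext) : x.1 = y.1 -> q x = q y.
  move=> xy; apply/quotient_projP.
  rewrite [(_ * _)%g]surjective_pairing /= xy mulVg; exact: cext_central.
have qM : {morph q : x y / (x * y)%g} by exact: quotient_projM.
apply: (@isomorphic_bij _ _ (q \o s)) => [g h|]; first by rewrite /= -qM;
  exact: qE.
apply: surj_inj_bij => [|y]; last first.
  by exists (repr y).1; rewrite -[RHS]quotient_reprK; exact: qE.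
apply: morphism_inj => [g h|g]; first by rewrite /= -qM; exact: qE.
rewrite /= -(morphism1 qM) => /esym/quotient_projP; rewrite invg1 mul1g => cg.
apply: contrapT => /Gf[h|f [h [f_cocycle]]].
  by have [] := cg (s h).
have [_ /(congr1 (fun a => a (exist _ f f_cocycle))) /=] := cg (s h).
by rewrite !add0r.
Qed.

End CocycleExtension.

(** * Cubic coboundaries *)

Section Coboundaries.
Variables (F : fieldType) (n : nat).
Local Open Scope ring_scope.
Local Notation V := 'rV[F]_n.
Implicit Types (x y z : V) (i j k : 'I_n).

(** The coboundary of a 2-cochain on the additive group V. The cochain is normalised so that adding
    it to a function on G keeps the result normalised. *)
Definition coboundary (T : V -> V -> V -> F) :=
  exists2 q : V -> V -> F, (forall y, q 0 y = 0) /\ (forall x, q x 0 = 0)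
    & forall x y z, T x y z = q y z - q (x + y) z + q x (y + z) - q x y.

Definition mono i j k x y z : F := x 0 i * y 0 j * z 0 k.

Lemma coboundary_ext T T' : (forall x y z, T x y z = T' x y z) ->
  coboundary T -> coboundary T'.
Proof. by move=> TT' [q q0 qE]; exists q => // x y z; rewrite -TT'. Qed.

Lemma coboundary0 : coboundary (fun _ _ _ => 0).
Proof. by exists (fun _ _ => 0) => // x y z; rewrite !subr0 addr0. Qed.

Lemma coboundaryD T T' : coboundary T -> coboundary T' ->
  coboundary (fun x y z => T x y z + T' x y z).
Proof.
move=> [q [q0 q0'] qE] [r [r0 r0'] rE]; exists (fun x y => q x y + r x y).
  by split=> x; rewrite ?(q0, r0, q0', r0') addr0.
by move=> x y z; rewrite qE rE; ring.
Qed.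

Lemma coboundaryZ c T : coboundary T -> coboundary (fun x y z => c * T x y z).
Proof.
move=> [q [q0 q0'] qE]; exists (fun x y => c * q x y).
  by split=> x; rewrite ?(q0, q0') mulr0.
by move=> x y z; rewrite qE; ring.
Qed.

Lemma coboundary_sum I (r : seq I) (P : pred I) (T : I -> V -> V -> V -> F) :
    (forall l, P l -> coboundary (T l)) ->
  coboundary (fun x y z => \sum_(l <- r | P l) T l x y z).
Proof.
move=> cT; elim: r => [|l r IHr].
  by apply: coboundary_ext coboundary0 => x y z; rewrite big_nil.
case Pl: (P l); last by apply: coboundary_ext IHr => x y z; rewrite big_cons Pl.
apply: coboundary_ext (coboundaryD (cT l Pl) IHr) => x y z.
by rewrite big_cons Pl.
Qed.

(** Polarisation of the quadratic function x_i x_j in the first argument. Together with the mirror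
    statement it makes transpositions of indices act by -1 modulo coboundaries. *)
Lemma coboundary_swapl i j k :
  coboundary (fun x y z => mono i j k x y z + mono j i k x y z).
Proof.
exists (fun x y => - (x 0 i * x 0 j * y 0 k)).
  by split=> x; rewrite !mxE; ring.
by move=> x y z; rewrite /mono !mxE; ring.
Qed.

Lemma coboundary_swapr i j k :
  coboundary (fun x y z => mono i j k x y z + mono i k j x y z).
Proof.
exists (fun x y => x 0 i * y 0 j * y 0 k).
  by split=> x; rewrite !mxE; ring.
by move=> x y z; rewrite /mono !mxE; ring.
Qed.

Hypothesis two_neq0 : 2%:R != 0 :> F.

(* Modulo coboundaries the monomials are alternating, so every monomial is    *)
(* plus or minus its sorted form. Going through sorted monomials avoids the   *)
(* division by 3 of the symmetric formula for q.                              *)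
Definition sorted_corr i j k : V -> V -> V -> F :=
  fun x y z =>
    ((i < j) && (j < k))%N%:R * mono i j k x y z
    - ((i < k) && (k < j))%N%:R * mono i k j x y z
    + ((k < i) && (i < j))%N%:R * mono k i j x y z.

(** The sign is that of the permutation sorting (j, i, k). With a repeated index the monomial equals
    its own negative modulo coboundaries, and dividing by 2 removes it. *)
Lemma coboundary_sorted i j k : (i < j)%N ->
  coboundary (fun x y z => mono j i k x y z + sorted_corr i j k x y z).
Proof.
move=> lt_ij; rewrite /sorted_corr lt_ij andbT /=.
have [jk|kj|jk] := ltngtP j k.
- rewrite (ltn_trans lt_ij jk) ltnNge ltnW ?(ltn_trans lt_ij jk) //=.
  by apply: coboundary_ext (coboundary_swapl i j k) => x y z; ring.
- have [ik|ki|ik] := ltngtP i k => /=.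
  + apply: coboundary_ext (coboundaryD (coboundary_swapl i j k)
      (coboundaryZ (-1) (coboundary_swapr i j k))) => x y z; ring.
  + apply: coboundary_ext (coboundaryD (coboundary_swapr j i k) (coboundaryD
      (coboundaryZ (-1) (coboundary_swapl j k i)) (coboundary_swapr k i j)))
      => x y z; ring.
  + have /val_inj <- := ik.
    apply: coboundary_ext (coboundaryZ 2%:R^-1 (coboundary_swapr j i i))
      => x y z; field; exact: two_neq0.
- rewrite -(val_inj jk) lt_ij ltnNge ltnW //=.
  apply: coboundary_ext (coboundaryD (coboundary_swapl i j j)
    (coboundaryZ (- 2%:R^-1) (coboundary_swapr i j j))) => x y z; field;
      exact: two_neq0.
Qed.

(** Once monomials are sorted, the one with indices i < j < k carries the cyclic sum of t, which is
    0. For the tensor of sum_k w_k (x) a_k this sum is the coefficient of the 3-form sum_k w_k /\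
    a_k. *)
Lemma cubic_coboundary (t : 'I_n -> 'I_n -> 'I_n -> F) :
    (forall i j k, t j i k = - t i j k) ->
    (forall i j k, t i j k + t j k i + t k i j = 0) ->
  coboundary (fun x y z =>
    \sum_(j < n) \sum_(i < n | (i < j)%N) \sum_k t i j k * mono j i k x y z).
Proof.
move=> tN tJ.
have cT : coboundary (fun x y z => \sum_(j < n) \sum_(i < n | (i < j)%N) \sum_k
    t i j k * (mono j i k x y z + sorted_corr i j k x y z)).
  apply: coboundary_sum => j _; apply: coboundary_sum => i lt_ij.
  by apply: coboundary_sum => k _; apply: coboundaryZ; exact: coboundary_sorted.
apply: coboundary_ext cT => x y z.
pose T1 i j k := t i j k * mono j i k x y z.
pose T2 i j k := t i j k * sorted_corr i j k x y z.
transitivity (\sum_(j < n) \sum_(i < n | (i < j)%N) \sum_k T1 i j k +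
              \sum_(j < n) \sum_(i < n | (i < j)%N) \sum_k T2 i j k).
  rewrite -big_split; apply: eq_bigr => j _ /=.
  rewrite -big_split; apply: eq_bigr => i _ /=.
  by rewrite -big_split; apply: eq_bigr => k _ /=; rewrite mulrDr.
suff -> : \sum_(j < n) \sum_(i < n | (i < j)%N) \sum_k T2 i j k = 0.
  by rewrite addr0.
pose h i j k : F := ((i < j) && (j < k))%N%:R * mono i j k x y z.
transitivity (\sum_i \sum_j \sum_k t i j k * (h i j k - h i k j + h k i j)).
  rewrite exchange_big /=; apply: eq_bigr => j _; rewrite big_mkcond /=.
  apply: eq_bigr => i _; case: ifPn => // ge_ij; apply/esym/big1 => k _.
  rewrite /h (negPf ge_ij) andbF.
  have -> : (i < k)%N && (k < j)%N = false.
    by apply/negbTE; apply: contra ge_ij => /andP[]; exact: ltn_trans.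
  by rewrite !mul0r subr0 addr0 mulr0.
transitivity (\sum_i \sum_j \sum_k (t i j k - t i k j + t j k i) * h i j k);
  last first.
  rewrite big1 // => i _; rewrite big1 // => j _; rewrite big1 // => k _.
  have -> : t i k j = - t k i j by exact: tN.
  by rewrite opprK addrAC tJ mul0r.
rewrite (_ : \sum_i _ = \sum_i \sum_j \sum_k t i j k * h i j k
  - \sum_i \sum_j \sum_k t i j k * h i k j
  + \sum_i \sum_j \sum_k t i j k * h k i j); last first.
  rewrite -sumrB -big_split; apply: eq_bigr => i _ /=.
  rewrite -sumrB -big_split; apply: eq_bigr => j _ /=.
  rewrite -sumrB -big_split; apply: eq_bigr => k _ /=.
  by rewrite mulrDr mulrBr.
have -> : \sum_i \sum_j \sum_k t i j k * h i k j =
    \sum_i \sum_j \sum_k t i k j * h i j k.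
  by apply: eq_bigr => i _; rewrite exchange_big.
have -> : \sum_i \sum_j \sum_k t i j k * h k i j =
    \sum_i \sum_j \sum_k t j k i * h i j k.
  transitivity (\sum_i \sum_k \sum_j t i j k * h k i j).
    by apply: eq_bigr => i _; rewrite exchange_big.
  by rewrite exchange_big.
rewrite -sumrB -big_split; apply: eq_bigr => i _ /=.
rewrite -sumrB -big_split; apply: eq_bigr => j _ /=.
rewrite -sumrB -big_split; apply: eq_bigr => k _ /=.
by rewrite mulrDl mulrBl.
Qed.

End Coboundaries.

(** * From non-capability to a condition on tensors *)

Definition linear_form (F : fieldType) n (a x : 'rV[F]_n) : F :=
  (a *m x^T)%R 0%R 0%R.

Definition wedge (F : fieldType) n (w : 'M[F]_n) (a x y z : 'rV[F]_n) : F :=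
  (form w x y * linear_form a z + form w y z * linear_form a x
   + form w z x * linear_form a y)%R.

Section LinearForm.
Variables (F : fieldType) (n : nat).
Local Open Scope ring_scope.
Implicit Types a x y : 'rV[F]_n.

Lemma linear_formE a x : linear_form a x = \sum_k a 0 k * x 0 k.
Proof. by rewrite /linear_form mxE; apply: eq_bigr => k _; rewrite mxE. Qed.
Lemma linear_formD a x y : linear_form a (x + y) = linear_form a x +
  linear_form a y.
Proof. by rewrite /linear_form linearD mulmxDr mxE. Qed.
Lemma linear_formZ a k x : linear_form a (k *: x) = k * linear_form a x.
Proof. by rewrite /linear_form linearZ -scalemxAr mxE. Qed.
Lemma linear_form0 a : linear_form a 0 = 0.
Proof. by rewrite /linear_form trmx0 mulmx0 mxE. Qed.
Lemma linear_form_delta a k : linear_form a (delta_mx 0 k) = a 0 k.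
Proof. by rewrite /linear_form trmx_delta -colE mxE. Qed.

End LinearForm.

(* With U the commutator forms of G and eps := upper_pairing ^~ A0, the       *)
(* kernel of U (x) V^* -> Lambda^3 V^* is killed by eps (x) 1.                *)
Lemma not_capable_relator (p : nat) (G : groupType) n (x : 'I_n -> G) :
    prime p -> odd p -> comm_central G -> (1 < n)%N ->
    (forall i, x i ^+ p = 1) ->
    (forall g, generated (fun y => exists i, y = x i) g) ->
    (forall (v : 'rV['F_p]_n) A, normal_form x v A = 1 -> v = 0%R) ->
    ~ capable G ->
  exists A0 : 'M['F_p]_n, ~ relator x A0 /\
    forall (w : 'I_3 -> 'M['F_p]_n) (a : 'I_3 -> 'rV['F_p]_n),
      (forall k, relator_forms x (w k)) ->
      (forall u v t, \sum_k wedge (w k) (a k) u v t = 0)%R ->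
    (\sum_k upper_pairing (w k) A0 *: a k = 0)%R.
Proof.
move=> p_pr p_odd G2 n_gt1 x_p x_gen x_indep not_cap.
have surj := normal_form_surj p_pr G2 x_p x_gen.
have /choice[vA vAE] g : exists b : 'rV['F_p]_n * 'M['F_p]_n,
    g = normal_form x b.1 b.2.
  by have [v [A ->]] := surj g; exists (v, A).
have nfP (v w : 'rV['F_p]_n) A B : normal_form x v A = normal_form x w B ->
    v = w /\ relator x (A - B)%R.
  move=> E; have := normal_formM p_pr G2 x_p v A (- w)%R (- B + w^T *m w)%R.
  rewrite -normal_formV // E mulgV => /esym E1.
  have /subr0_eq vw := x_indep _ _ E1; split=> //.
  move: E1; rewrite vw subrr linearN /= mulNmx.
  by rewrite addrA addrK.
have vM g h : (vA (g * h)).1 = ((vA g).1 + (vA h).1)%R /\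
    relator x ((vA (g * h)%g).2 - ((vA g).2 + (vA h).2 + (vA h).1^T *m (vA
      g).1))%R.
  by apply: nfP; rewrite -normal_formM // -!vAE.
have v1 : (vA 1).1 = 0%R /\ relator x (vA 1).2.
  have [-> r] : (vA 1).1 = 0%R /\ relator x ((vA 1%g).2 - 0)%R.
    by apply: nfP; rewrite normal_form0 -vAE.
  by rewrite subr0 in r.
(* A nontrivial central element that no cocycle detects. *)
have [g [cg g1 g_cocycle]] : exists g : G, [/\ central g, g <> 1 &
    forall (f : G -> G -> 'F_p) h, normalized_cocycle f -> f g h = f h g].
  apply: contrapT => no_g; apply: not_cap; apply: (@capable_of_cocycles _ 'F_p).
  move=> g cg g1; apply: contrapT => no_f; apply: no_g; exists g;
    split=> // f h fc.
  by apply: contrapT => ne_f; apply: no_f; exists f, h.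
(* Otherwise the bilinear cocycle a_i b_j, with i a nonzero coordinate of g and j another index,
   distinguishes (g, h) from (h, g) for h = x_j. *)
have vg : (vA g).1 = 0%R.
  apply/eqP; apply/contraT => /rV0Pn[i vi].
  have [j ne_ij] : exists j : 'I_n, j != i.
    move: n_gt1 (i); clear; case: n => [|[|m]] // _ i.
    have [->|i0] := eqVneq i ord0; first by exists ord_max.
    by exists ord0; rewrite eq_sym.
  pose f a b : 'F_p := ((vA a).1 0 i * (vA b).1 0 j)%R.
  pose h := normal_form x (delta_mx 0 j : 'rV['F_p]_n)%R 0%R.
  have vh : (vA h).1 = delta_mx 0%R j.
    by have [] := nfP _ _ _ _ (esym (vAE h)).
  have fc : normalized_cocycle f.
    split=> [a|a|a b c]; rewrite /f ?(v1.1, mxE, mul0r, mulr0) //.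
    by rewrite !(vM _ _).1 !mxE; ring.
  have := g_cocycle f h fc; rewrite /f vh !mxE !eqxx /= mulr1.
  by rewrite eq_sym (negPf ne_ij) mul0r => /eqP; rewrite (negPf vi).
exists (vA g).2; split=> [rg|w a Uw J].
  by apply: g1; rewrite (vAE g) vg.
have wM k a' b' : upper_pairing (w k) (vA (a' * b')%g).2 =
    (upper_pairing (w k) (vA a').2 + upper_pairing (w k) (vA b').2
     + upper_pairing (w k) ((vA b').1^T *m (vA a').1))%R.
  by apply/subr0_eq; rewrite -!linearD -linearB; apply: (Uw k).2;
    exact: (vM _ _).2.
pose t i j l := (\sum_k w k i j * a k 0 l)%R.
have tN i j l : t j i l = (- t i j l)%R.
  by rewrite /t -sumrN; apply: eq_bigr => k _; rewrite (Uw k).1.2 mulNr.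
have tJ i j l : (t i j l + t j l i + t l i j = 0)%R.
  rewrite -(J (delta_mx 0 i) (delta_mx 0 j) (delta_mx 0 l))%R -!big_split /=.
  by apply: eq_bigr => k _; rewrite /wedge !form_delta !linear_form_delta.
have two_neq0 : (2%:R != 0 :> 'F_p)%R.
  by rewrite -(dvdn_pcharf (pchar_Fp p_pr)) dvdn_prime2 //;
    apply: contraL p_odd => /eqP ->.
have [q [q0l q0r] qE] := cubic_coboundary two_neq0 tN tJ.
have {}qE u v z : (\sum_k upper_pairing (w k) (v^T *m u) * linear_form (a k) z
    = q v z - q (u + v) z + q u (v + z) - q u v)%R.
  rewrite -qE; under eq_bigr => k _ do rewrite linear_formE /upper_pairing.
  under eq_bigr => k _ do rewrite mulr_suml.
  rewrite exchange_big; apply: eq_bigr => j _ /=.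
  under eq_bigr => k _ do rewrite mulr_suml.
  rewrite exchange_big; apply: eq_bigr => i _ /=.
  under eq_bigr => k _ do rewrite mulr_sumr.
  rewrite exchange_big; apply: eq_bigr => l _ /=.
  rewrite /t mulr_suml; apply: eq_bigr => k _.
  by rewrite mxE big_ord1 mxE /mono; ring.
(* Additive in the second argument; in the first its defect is the cubic function of [qE], which
   adding q cancels. *)
pose L b c := (\sum_k upper_pairing (w k) (vA b).2 * linear_form (a k) (vA
  c).1)%R.
have LMl b c d : L (b * c) d = (L b d + L c d + (q (vA c).1 (vA d).1
    - q ((vA b).1 + (vA c).1) (vA d).1 + q (vA b).1 ((vA c).1 + (vA d).1)
    - q (vA b).1 (vA c).1))%R.
  rewrite -qE -!big_split; apply: eq_bigr => k _ /=.
  by rewrite wM !mulrDl.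
have LMr b c d : L b (c * d) = (L b c + L b d)%R.
  rewrite -big_split; apply: eq_bigr => k _ /=.
  by rewrite (vM c d).1 linear_formD mulrDr.
have L1l c : L 1 c = 0%R.
  by apply: big1 => k _; rewrite (Uw k).2 ?mul0r //; exact: v1.2.
have L1r b : L b 1 = 0%R.
  by apply: big1 => k _; rewrite v1.1 linear_form0 mulr0.
pose f b c := (L b c + q (vA b).1 (vA c).1)%R.
have fc : normalized_cocycle f.
  split=> [b|b|b c d]; rewrite /f ?L1l ?L1r ?v1.1 ?q0l ?q0r ?addr0 //.
  by rewrite LMl LMr !(vM _ _).1; ring.
apply/rowP=> j; rewrite summxE mxE.
pose h := normal_form x (delta_mx 0 j : 'rV['F_p]_n)%R 0%R.
have vh : (vA h).1 = delta_mx 0%R j.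
  by have [] := nfP _ _ _ _ (esym (vAE h)).
(* The image of g in V is 0, so f h g vanishes, while f g h is the j-th coordinate of the required
   sum. *)
have Lh : L h g = 0%R by apply: big1 => k _; rewrite vg linear_form0 mulr0.
have := g_cocycle f h fc; rewrite /f vg q0l q0r Lh !addr0 => Lg;
  rewrite -[RHS]Lg.
by apply: eq_bigr => k _; rewrite vh linear_form_delta mxE.
Qed.

(** * Classification of the spaces of forms *)

Section FormClassification.
Local Open Scope ring_scope.

Definition o0 : 'I_5 := @Ordinal 5 0 isT.
Definition o1 : 'I_5 := @Ordinal 5 1 isT.
Definition o2 : 'I_5 := @Ordinal 5 2 isT.
Definition o3 : 'I_5 := @Ordinal 5 3 isT.
Definition o4 : 'I_5 := @Ordinal 5 4 isT.

Lemma ord5_ind (P : 'I_5 -> Prop) :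
  P o0 -> P o1 -> P o2 -> P o3 -> P o4 -> forall i, P i.
Proof.
move=> P0 P1 P2 P3 P4; case=> [[|[|[|[|[|]]]]]] // h.
- by rewrite (_ : Ordinal h = o0) //; apply: val_inj.
- by rewrite (_ : Ordinal h = o1) //; apply: val_inj.
- by rewrite (_ : Ordinal h = o2) //; apply: val_inj.
- by rewrite (_ : Ordinal h = o3) //; apply: val_inj.
- by rewrite (_ : Ordinal h = o4) //; apply: val_inj.
Qed.

Lemma big5 (T : Type) (idx : T) (op : Monoid.law idx) (f : 'I_5 -> T) :
  \big[op/idx]_i f i = op (op (op (op (f o0) (f o1)) (f o2)) (f o3)) (f o4).
Proof.
by rewrite !big_ord_recr big_ord0 /= Monoid.mul1m;
  congr (op (op (op (op (f _) (f _)) (f _)) (f _)) (f _)); apply: val_inj.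
Qed.

Section Coordinates.
Variable F : fieldType.
Implicit Types (w u : 'M[F]_5) (x y z a : 'rV[F]_5).

Lemma sum5 (f : 'I_5 -> F) : \sum_i f i = f o0 + f o1 + f o2 + f o3 + f o4.
Proof. exact: big5. Qed.

Definition row5 (a0 a1 a2 a3 a4 : F) : 'rV[F]_5 :=
  \row_i nth 0 [:: a0; a1; a2; a3; a4] i.

Lemma row5E (a0 a1 a2 a3 a4 : F) : (row5 a0 a1 a2 a3 a4 0 o0 = a0) *
  (row5 a0 a1 a2 a3 a4 0 o1 = a1) * (row5 a0 a1 a2 a3 a4 0 o2 = a2) *
  (row5 a0 a1 a2 a3 a4 0 o3 = a3) * (row5 a0 a1 a2 a3 a4 0 o4 = a4).
Proof. by rewrite !mxE. Qed.

Lemma form5E w x y : alternating w -> form w x y =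
    w o0 o1 * (x 0 o0 * y 0 o1 - x 0 o1 * y 0 o0)
  + w o0 o2 * (x 0 o0 * y 0 o2 - x 0 o2 * y 0 o0)
  + w o0 o3 * (x 0 o0 * y 0 o3 - x 0 o3 * y 0 o0)
  + w o0 o4 * (x 0 o0 * y 0 o4 - x 0 o4 * y 0 o0)
  + w o1 o2 * (x 0 o1 * y 0 o2 - x 0 o2 * y 0 o1)
  + w o1 o3 * (x 0 o1 * y 0 o3 - x 0 o3 * y 0 o1)
  + w o1 o4 * (x 0 o1 * y 0 o4 - x 0 o4 * y 0 o1)
  + w o2 o3 * (x 0 o2 * y 0 o3 - x 0 o3 * y 0 o2)
  + w o2 o4 * (x 0 o2 * y 0 o4 - x 0 o4 * y 0 o2)
  + w o3 o4 * (x 0 o3 * y 0 o4 - x 0 o4 * y 0 o3).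
Proof.
move=> [w0 wN]; rewrite formE sum5 !(sum5 (fun j => _)) !w0.
rewrite (wN o0 o1) (wN o0 o2) (wN o0 o3) (wN o0 o4) (wN o1 o2) (wN o1 o3).
rewrite (wN o1 o4) (wN o2 o3) (wN o2 o4) (wN o3 o4); ring.
Qed.

Lemma linear_form5E a x : linear_form a x = a 0 o0 * x 0 o0 + a 0 o1 * x 0 o1
  + a 0 o2 * x 0 o2 + a 0 o3 * x 0 o3 + a 0 o4 * x 0 o4.
Proof. by rewrite linear_formE sum5. Qed.

Lemma wedge_delta w a i j k :
  wedge w a (delta_mx 0 i) (delta_mx 0 j) (delta_mx 0 k) =
  w i j * a 0 k + w j k * a 0 i + w k i * a 0 j.
Proof. by rewrite /wedge !form_delta !linear_form_delta. Qed.

Lemma alternating_eq w u : alternating w -> alternating u ->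
    w o0 o1 = u o0 o1 -> w o0 o2 = u o0 o2 -> w o0 o3 = u o0 o3 ->
    w o0 o4 = u o0 o4 -> w o1 o2 = u o1 o2 -> w o1 o3 = u o1 o3 ->
    w o1 o4 = u o1 o4 -> w o2 o3 = u o2 o3 -> w o2 o4 = u o2 o4 ->
    w o3 o4 = u o3 o4 -> w = u.
Proof.
move=> aw au e01 e02 e03 e04 e12 e13 e14 e23 e24 e34; apply/matrixP => i j.
rewrite -!form_delta !form5E // e01 e02 e03 e04 e12 e13 e14 e23 e24 e34 //.
Qed.

Lemma alternatingD w u : alternating w -> alternating u -> alternating (w + u).
Proof.
move=> [w0 wN] [u0 uN]; split=> [i|i j]; rewrite !mxE ?w0 ?u0 ?addr0 //.
by rewrite (wN i j) (uN i j) opprD.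
Qed.

Lemma alternatingZ c w : alternating w -> alternating (c *: w).
Proof.
move=> [w0 wN]; split=> [i|i j]; rewrite !mxE ?w0 ?mulr0 //.
by rewrite (wN i j) mulrN.
Qed.

Definition ew (i j : 'I_5) : 'M[F]_5 := delta_mx i j - delta_mx j i.

Lemma alternating_ew i j : alternating (ew i j).
Proof.
split=> [k|k l]; rewrite !mxE; first by rewrite [(k == j) && _]andbC subrr.
by rewrite opprB ![(l == _) && _]andbC.
Qed.

Definition symp : 'M[F]_5 := ew o0 o1 + ew o2 o3.

Lemma alternating_symp : alternating symp.
Proof. exact: alternatingD (alternating_ew _ _) (alternating_ew _ _). Qed.

Lemma form_symp x y : form symp x y =
  x 0 o0 * y 0 o1 - x 0 o1 * y 0 o0 + x 0 o2 * y 0 o3 - x 0 o3 * y 0 o2.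
Proof. by rewrite form5E; [rewrite !mxE /=;
  ring | exact: alternating_symp]. Qed.

Lemma form_ew24 x y : form (ew o2 o4) x y = x 0 o2 * y 0 o4 - x 0 o4 * y 0 o2.
Proof. by rewrite form5E; [rewrite !mxE /=; ring | exact: alternating_ew]. Qed.

End Coordinates.

(** * Base change for forms *)

Section Congruence.
Variables (F : fieldType) (n : nat).
Implicit Types (w u P : 'M[F]_n) (x y z a : 'rV[F]_n).

(** The form [w] written in the basis given by the rows of [P]. *)
Definition congr_mx P w := P *m w *m P^T.

Lemma form_congr P w x y : form (congr_mx P w) x y = form w (x *m P) (y *m P).
Proof. by rewrite /form /congr_mx trmx_mul !mulmxA. Qed.

Lemma congr_mxE P w i j : congr_mx P w i j = form w (row i P) (row j P).
Proof. by rewrite -form_delta form_congr -!rowE. Qed.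

Lemma congr_mxM P Q w : congr_mx (P *m Q) w = congr_mx P (congr_mx Q w).
Proof. by rewrite /congr_mx trmx_mul !mulmxA. Qed.

Lemma congr_mxD P w u : congr_mx P (w + u) = congr_mx P w + congr_mx P u.
Proof. by rewrite /congr_mx mulmxDr mulmxDl. Qed.

Lemma congr_mxZ P c w : congr_mx P (c *: w) = c *: congr_mx P w.
Proof. by rewrite /congr_mx -scalemxAr -scalemxAl. Qed.

Lemma congr_mx1 w : congr_mx 1%:M w = w.
Proof. by rewrite /congr_mx trmx1 mulmx1 mul1mx. Qed.

Lemma congr_mxK P w : P \in unitmx -> congr_mx (invmx P) (congr_mx P w) = w.
Proof. by move=> uP; rewrite -congr_mxM mulVmx // congr_mx1. Qed.

Lemma congr_mxVK P w : P \in unitmx -> congr_mx P (congr_mx (invmx P) w) = w.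
Proof. by move=> uP; rewrite -congr_mxM mulmxV // congr_mx1. Qed.

Lemma alternating_congr P w : alternating w -> alternating (congr_mx P w).
Proof.
by move=> aw; split=> [i|i j]; rewrite !congr_mxE ?formuu // formC.
Qed.

(* U is a space of alternating forms with a functional eps on it which        *)
(* annihilates, in the first factor, the kernel of U (x) V^* -> Lambda^3 V^*. *)
Record degenerate (U : 'M[F]_n -> Prop) (eps : 'M[F]_n -> F) : Prop :=
  Degenerate {
  degD : forall w u, U w -> U u -> U (w + u);
  degZ : forall c w, U w -> U (c *: w);
  deg_alt : forall w, U w -> alternating w;
  deg_epsD : forall w u, eps (w + u) = eps w + eps u;
  deg_epsZ : forall c w, eps (c *: w) = c * eps w;
  deg_star : forall w1 w2 w3 a1 a2 a3, U w1 -> U w2 -> U w3 ->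
    (forall x y z, wedge w1 a1 x y z + wedge w2 a2 x y z + wedge w3 a3 x y z =
      0) ->
    eps w1 *: a1 + eps w2 *: a2 + eps w3 *: a3 = 0
}.

Lemma wedge_congr P w a x y z : P \in unitmx ->
  wedge (congr_mx P w) a x y z =
  wedge w (a *m (invmx P)^T) (x *m P) (y *m P) (z *m P).
Proof.
move=> uP; have lE t : linear_form a t = linear_form (a *m (invmx P)^T) (t *m
  P).
  by rewrite /linear_form trmx_mul mulmxA -(mulmxA a) -trmx_mul mulmxV // trmx1
    mulmx1.
by rewrite /wedge !form_congr !lE.
Qed.

Lemma degenerate_congr U eps P : P \in unitmx -> degenerate U eps ->
  degenerate (fun w => U (congr_mx (invmx P) w))
             (fun w => eps (congr_mx (invmx P) w)).
Proof.
move=> uP [UD UZ Ualt eD eZ star].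
have uV : invmx P \in unitmx by rewrite unitmx_inv.
split=> [w u|c w|w Uw|w u|c w|w1 w2 w3 a1 a2 a3 U1 U2 U3 J].
- by rewrite congr_mxD; exact: UD.
- by rewrite congr_mxZ; exact: UZ.
- by rewrite -(congr_mxVK w uP); apply: alternating_congr; exact: Ualt.
- by rewrite congr_mxD.
- by rewrite congr_mxZ.
set Q := (invmx P)^T;
  have QP : Q *m P^T = 1%:M by rewrite -trmx_mul mulmxV // trmx1.
have /(congr1 (mulmx^~ P^T)) : eps (congr_mx (invmx P) w1) *: (a1 *m Q)
    + eps (congr_mx (invmx P) w2) *: (a2 *m Q)
    + eps (congr_mx (invmx P) w3) *: (a3 *m Q) = 0.
  apply: star => // x y z;
    rewrite -(J (x *m invmx P) (y *m invmx P) (z *m invmx P)).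
  have W w a : wedge w a (x *m invmx P) (y *m invmx P) (z *m invmx P) =
      wedge (congr_mx (invmx P) w) (a *m Q) x y z.
    by rewrite -{1}(congr_mxVK w uP) wedge_congr // -!(mulmxA _ _ P) mulVmx //
      !mulmx1.
  by rewrite !W.
by rewrite !mulmxDl mul0mx -!scalemxAl -!mulmxA QP !mulmx1.
Qed.

End Congruence.

(** * Normalising the forms one after the other *)

Section Classification.
Variable F : fieldType.
Local Notation V := 'rV[F]_5.
Local Notation M := 'M[F]_5.
Local Notation J := (symp F).
Implicit Types (w u P : M) (x y z a : V) (U : M -> Prop) (eps : M -> F).

(** [pi] projects onto the orthogonal of the plane spanned by y2 and y3. If w vanished on that
    orthogonal, it would be the wedge of w(., y3) and w(y2, .). So two of its vectors pair
    nontrivially, and one of them can be scaled. *)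
Lemma hyperbolic_complement w y2 y3 : alternating w -> form w y2 y3 = 1 ->
    (forall a b : V, ~ forall x y, form w x y =
       linear_form a x * linear_form b y - linear_form a y * linear_form b x) ->
  exists y0 y1, [/\ form w y0 y1 = 1, form w y0 y2 = 0, form w y0 y3 = 0,
    form w y1 y2 = 0 & form w y1 y3 = 0].
Proof.
move=> aw w23 indec.
have w32 : form w y3 y2 = -1 by rewrite formC // w23.
pose pi x := x + (- form w x y3) *: y2 + form w x y2 *: y3.
have pi2 x : form w (pi x) y2 = 0.
  by rewrite !formDl !formZl w32 formuu //; ring.
have pi3 x : form w (pi x) y3 = 0.
  by rewrite !formDl !formZl w23 formuu //; ring.
have [[x [y wxy]]|no_xy] := pselect (exists x y, form w (pi x) (pi y) != 0).
  exists (pi x), ((form w (pi x) (pi y))^-1 *: pi y).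
  by rewrite formZr !formZl !pi2 !pi3 !mulr0 mulVf.
case: (indec (y3 *m w^T) (y2 *m w)) => x y.
have lE t : linear_form (y3 *m w^T) t = form w t y3.
  rewrite /linear_form /form -[in RHS](trmxK (t *m w *m y3^T)) [RHS]mxE.
  by rewrite !trmx_mul trmxK mulmxA.
have : form w (pi x) (pi y) = 0.
  by apply/eqP/negPn/negP => ne; apply: no_xy; exists x, y.
rewrite {1}/pi !formDl !formZl.
rewrite ![form w _ (pi y)]formC // pi2 pi3 [form w (pi y) x]formC //.
rewrite /pi !formDr !formZr => E; rewrite !lE /linear_form -!/(form _ _ _).
move: E; rewrite (formC y2 y) // (formC y2 x) //.
move/eqP; rewrite oppr0 !mulr0 !addr0 opprK; move/eqP => E.
by apply: subr0_eq; rewrite -E; ring.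
Qed.

(** A row vector killed by P lies in the radical of J, the last coordinate line; since the last row
    of P is nonzero, this vector is 0. *)
Lemma unitmx_congr_symp P w : congr_mx P w = J -> row o4 P != 0 -> P \in unitmx.
Proof.
move=> PJ P4; rewrite unitmxE unitfE; apply/negP => /det0P[v v0 vP].
have vJ : v *m J = 0 by rewrite -PJ /congr_mx !mulmxA vP !mul0mx.
have vJx x : form J v x = 0 by rewrite /form vJ mul0mx mxE.
have v0' i : i != o4 -> v 0 i = 0.
  elim/ord5_ind: i => // _.
  - by have := vJx (delta_mx 0 o1); rewrite form_symp !mxE /= => <-; ring.
  - have := vJx (delta_mx 0 o0); rewrite form_symp !mxE /= => E.
    by apply: oppr_inj; rewrite oppr0 -E; ring.
  - by have := vJx (delta_mx 0 o3); rewrite form_symp !mxE /= => <-; ring.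
  - have := vJx (delta_mx 0 o2); rewrite form_symp !mxE /= => E.
    by apply: oppr_inj; rewrite oppr0 -E; ring.
have vE : v = v 0 o4 *: delta_mx 0 o4.
  apply/rowP=> i; rewrite !mxE eqxx /=; case: eqP => [->|/eqP ne];
    first by rewrite mulr1.
  by rewrite mulr0 v0'.
move: vP v0; rewrite vE -scalemxAl -rowE => /eqP;
  rewrite scaler_eq0 (negPf P4) orbF.
by move=> /eqP ->; rewrite scale0r eqxx.
Qed.

Definition rows5 y0 y1 y2 y3 y4 : M :=
  \matrix_(i < 5) nth 0 [:: y0; y1; y2; y3; y4] i.

Lemma row_rows5 y0 y1 y2 y3 y4 :
  (row o0 (rows5 y0 y1 y2 y3 y4) = y0) * (row o1 (rows5 y0 y1 y2 y3 y4) = y1) *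
  (row o2 (rows5 y0 y1 y2 y3 y4) = y2) * (row o3 (rows5 y0 y1 y2 y3 y4) = y3) *
  (row o4 (rows5 y0 y1 y2 y3 y4) = y4).
Proof. by rewrite !rowK. Qed.

Lemma congr_rows5_symp w y0 y1 y2 y3 y4 : alternating w ->
    form w y0 y1 = 1 -> form w y0 y2 = 0 -> form w y0 y3 = 0 ->
    form w y1 y2 = 0 -> form w y1 y3 = 0 -> form w y2 y3 = 1 ->
    form w y0 y4 = 0 -> form w y1 y4 = 0 -> form w y2 y4 = 0 ->
    form w y3 y4 = 0 ->
  congr_mx (rows5 y0 y1 y2 y3 y4) w = J.
Proof.
move=> aw w01 w02 w03 w12 w13 w23 w04 w14 w24 w34.
apply: alternating_eq;
  [exact: alternating_congr | exact: alternating_symp | ..];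
  rewrite congr_mxE !row_rows5 ?w01 ?w02 ?w03 ?w12 ?w13 ?w23 ?w04 ?w14 ?w24
    ?w34 !mxE /=; ring.
Qed.

(** The tensor w (x) a has image a /\ b /\ a = 0, so eps(w) a = 0. Then a = 0 and w = 0, against
    eps(w) <> 0. *)
Lemma degenerate_indecomposable U eps w a b :
    degenerate U eps -> U w -> eps w != 0 ->
  ~ forall x y, form w x y =
      linear_form a x * linear_form b y - linear_form a y * linear_form b x.
Proof.
move=> deg Uw ew wE.
have U0 : U 0 by rewrite -(scale0r w); exact: (degZ deg).
have f0 x y : form (0 : M) x y = 0 by rewrite /form mulmx0 mul0mx mxE.
have a0 : a = 0.
  have := deg_star deg (a1 := a) (a2 := 0) (a3 := 0) Uw U0 U0.
  rewrite !scaler0 !addr0 => /(_ _)/eqP.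
  rewrite scaler_eq0 (negPf ew) => /(_ _)/eqP; apply => x y z.
  by rewrite /wedge !f0 !wE; ring.
have l0 t : linear_form (0 : V) t = 0 by rewrite /linear_form mul0mx mxE.
have w0 : w = 0.
  by apply/matrixP=> i j; rewrite -form_delta wE a0 !l0 !mul0r subrr mxE.
by move: ew; rewrite w0 -(scale0r w) (deg_epsZ deg) mul0r eqxx.
Qed.

Lemma degenerate_symp U eps : degenerate U eps -> (exists2 w, U w & eps w != 0)
  ->
  exists2 P, P \in unitmx & U (congr_mx (invmx P) J) /\ eps (congr_mx (invmx P)
    J) != 0.
Proof.
move=> deg [w Uw ew]; have aw := deg_alt deg Uw.
have indec a b := @degenerate_indecomposable U eps w a b deg Uw ew.
have [i [j wij]] : exists i j, w i j != 0.
  apply: contrapT => w0; move: ew;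
    rewrite (_ : w = 0 *: w) ?(deg_epsZ deg) ?mul0r ?eqxx //.
  apply/matrixP=> i j; rewrite scale0r mxE; apply/eqP/negPn/negP => wij.
  by apply: w0; exists i, j.
pose y2 : V := delta_mx 0 i; pose y3 : V := (w i j)^-1 *: delta_mx 0 j.
have w23 : form w y2 y3 = 1 by rewrite formZr form_delta mulVf.
have [y0 [y1 [w01 w02 w03 w12 w13]]] := hyperbolic_complement aw w23 indec.
(* Orthogonality to y0, ..., y3 is four linear conditions in dimension 5, so a nonzero y4 satisfies
   them. *)
pose N := row_mx (row_mx (w *m y0^T) (w *m y1^T)) (row_mx (w *m y2^T) (w *m
  y3^T)).
have [y4 y4_neq0 y4N] : exists2 y4 : V, y4 != 0 & y4 *m N = 0.
  have : kermx N != 0.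
    by rewrite kermx_eq0 /row_free neq_ltn (leq_ltn_trans (rank_leq_col N)).
  case/rowV0Pn=> y4 /sub_kermxP; by exists y4.
have w4 y : y4 *m (w *m y^T) = 0 -> form w y y4 = 0.
  by rewrite formC // /form mulmxA => ->; rewrite mxE oppr0.
move: y4N; rewrite !mul_mx_row => /eqP.
rewrite !row_mx_eq0 => /andP[/andP[/eqP N0 /eqP N1] /andP[/eqP N2 /eqP N3]].
pose P := rows5 y0 y1 y2 y3 y4.
have PJ : congr_mx P w = J by apply: congr_rows5_symp; rewrite ?w4.
have uP : P \in unitmx by apply: unitmx_congr_symp PJ _; rewrite row_rows5.
by exists P => //; rewrite -PJ congr_mxK.
Qed.

Section WithSymplecticForm.
Variables (U : M -> Prop) (eps : M -> F).
Hypotheses (deg : degenerate U eps) (UJ : U J) (epsJ : eps J != 0).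

Let U0 : U 0.
Proof. by rewrite -(scale0r J); exact: (degZ deg). Qed.

Let form0 x y : form (0 : M) x y = 0.
Proof. by rewrite /form mulmx0 mul0mx mxE. Qed.

Let wedgeN u b x y z : wedge u (- b) x y z = - wedge u b x y z.
Proof. by rewrite /wedge /linear_form !mulNmx !mxE; ring. Qed.

(** J (x) a - u (x) b lies in the kernel of the wedge product and eps kills u, so eps(J) a = 0. *)
Lemma degenerate_wedge_symp u b a : U u -> eps u = 0 ->
  (forall x y z, wedge J a x y z = wedge u b x y z) -> a = 0.
Proof.
move=> Uu eu E; have := deg_star deg (a1 := a) (a2 := - b) (a3 := 0) UJ Uu U0.
rewrite eu scale0r !addr0 scaler0 addr0 => /(_ _)/eqP.
rewrite scaler_eq0 (negPf epsJ) => /(_ _)/eqP; apply => x y z.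
by rewrite E wedgeN {3}/wedge !form0; ring.
Qed.

(* Kernel vector of the pencil (a, b) |-> J /\ a - u /\ b: contracting u with
  *)
(* the radical of J gives a linear form c with u /\ c = J /\ a.               *)
Lemma degenerate_pencil u : U u -> eps u = 0 ->
  forall x y z, wedge u (row5 (u o0 o4) (u o1 o4) (u o2 o4) (u o3 o4) 0) x y z
    = 0.
Proof.
move=> Uu eu; have au := deg_alt deg Uu; set c := row5 _ _ _ _ _.
(* u /\ c vanishes on e4, because c(e4) = 0 and contracting u with e4 gives -c. It is thus a 3-form
   on the symplectic quotient by e4, and [a] is its preimage under wedging with J. *)
pose a := row5
  (u o0 o2 * u o3 o4 + u o2 o3 * u o0 o4 - u o0 o3 * u o2 o4)
  (u o1 o2 * u o3 o4 + u o2 o3 * u o1 o4 - u o1 o3 * u o2 o4)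
  (u o0 o1 * u o2 o4 + u o1 o2 * u o0 o4 - u o0 o2 * u o1 o4)
  (u o0 o1 * u o3 o4 + u o1 o3 * u o0 o4 - u o0 o3 * u o1 o4) 0.
have JauE x y z : wedge J a x y z = wedge u c x y z.
  rewrite /wedge !form_symp !(form5E _ _ au) !linear_form5E !row5E; ring.
move=> x y z; rewrite -JauE (degenerate_wedge_symp Uu eu JauE) /wedge.
by rewrite /linear_form !mul0mx mxE !mulr0 !addr0.
Qed.

(** Here u lives on the quotient by the radical of J, so for each b on this quotient u /\ b = J /\ a
    for some a, with the coordinates displayed in [key]. Hence a = 0, and letting b run over
    coordinate forms kills all entries of u. *)
Lemma degenerate_contraction_eq0 u : U u -> eps u = 0 ->
  u o0 o4 = 0 -> u o1 o4 = 0 -> u o2 o4 = 0 -> u o3 o4 = 0 -> u = 0.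
Proof.
move=> Uu eu u04 u14 u24 u34; have au := deg_alt deg Uu.
have key (b0 b1 b2 b3 : F) :
    row5 (u o0 o2 * b3 + u o2 o3 * b0 - u o0 o3 * b2)
         (u o1 o2 * b3 + u o2 o3 * b1 - u o1 o3 * b2)
         (u o0 o1 * b2 + u o1 o2 * b0 - u o0 o2 * b1)
         (u o0 o1 * b3 + u o1 o3 * b0 - u o0 o3 * b1) 0 = 0.
  apply: (@degenerate_wedge_symp u (row5 b0 b1 b2 b3 0)) => // x y z.
  rewrite /wedge !form_symp !(form5E _ _ au) !linear_form5E !row5E u04 u14 u24
    u34.
  ring.
have E (a0 a1 a2 a3 a4 : F) : row5 a0 a1 a2 a3 a4 = 0 ->
    [/\ a0 = 0, a1 = 0, a2 = 0 & a3 = 0].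
  move=> /rowP r0; have := (r0 o0, r0 o1, r0 o2, r0 o3).
  by rewrite !row5E !mxE => -[[[-> ->] ->] ->].
have [] := E _ _ _ _ _ (key 1 0 0 0);
  rewrite !(mulr0, mulr1, add0r, subr0, addr0).
move=> u23 _ u12 u13; have [] := E _ _ _ _ _ (key 0 1 0 0).
rewrite !(mulr0, mulr1, add0r, subr0, addr0) => _ _ /eqP u02 /eqP u03.
have [] := E _ _ _ _ _ (key 0 0 1 0).
rewrite !(mulr0, mulr1, add0r, subr0, addr0) => _ _ u01 _.
rewrite !oppr_eq0 in u02 u03; move/eqP in u02; move/eqP in u03.
have a0 : alternating (0 : M) by rewrite -(scale0r u); exact: alternatingZ.
by apply: alternating_eq => //; rewrite mxE.
Qed.

(** Unless U is the line of J, there is u <> 0 in U with eps(u) = 0. Its contraction c with e4 is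
    nonzero and u /\ c = 0, so u = c /\ f. The new basis preserves J and makes c and f the
    coordinate forms of index 2 and 4. *)
Lemma degenerate_split : (forall w, U w <-> exists c, w = c *: J) \/
  exists2 P, P \in unitmx & [/\ U (congr_mx (invmx P) J),
    eps (congr_mx (invmx P) J) != 0, U (congr_mx (invmx P) (ew F o2 o4))
    & eps (congr_mx (invmx P) (ew F o2 o4)) = 0].
Proof.
have [[u [Uu eu u0]]|no_u] := pselect (exists u, [/\ U u, eps u = 0 & u <> 0]);
  last first.
  left=> w; split=> [Uw|[c ->]]; last exact: (degZ deg).
  exists (eps w / eps J); apply: subr0_eq; apply: contrapT => ne.
  apply: no_u; exists (w - (eps w / eps J) *: J); split=> //.
    by rewrite -scaleNr; apply: (degD deg) => //; exact: (degZ deg).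
  by rewrite -scaleNr (deg_epsD deg) (deg_epsZ deg) mulNr divfK // subrr.
right; have au := deg_alt deg Uu; pose e4 : V := delta_mx 0 o4.
pose c := row5 (u o0 o4) (u o1 o4) (u o2 o4) (u o3 o4) 0.
have cE x : linear_form c x = form u x e4.
  by rewrite linear_form5E !row5E (form5E _ _ au) !mxE /=; ring.
have [z cz] : exists z, linear_form c z = 1.
  have [i ci] : exists i, c 0 i != 0.
    apply: contrapT => c0; apply: u0.
    have {}c0 i : c 0 i = 0 by apply/eqP/negPn/negP => ne; apply: c0; exists i.
    have := (c0 o0, c0 o1, c0 o2, c0 o3); rewrite !row5E => -[[[? ?] ?] ?].
    exact: degenerate_contraction_eq0.
  exists ((c 0 i)^-1 *: delta_mx 0 i).
  by rewrite linear_formZ linear_form_delta mulVf.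
pose f x := form u z x.
have uE x y : form u x y = linear_form c x * f y - linear_form c y * f x.
  have := degenerate_pencil Uu eu x y z; rewrite -/c /wedge cz.
  by rewrite [form u y z]formC // -/(f y) -/(f x) => E; apply: subr0_eq;
    rewrite -E; ring.
have fD x y : f (x + y) = f x + f y by exact: formDr.
have fZ k x : f (k *: x) = k * f x by exact: formZr.
have f4 : f e4 = 1 by rewrite /f -cE.
have fz : f z = 0 by exact: formuu.
have J4 x : form J x e4 = 0 by rewrite form_symp !mxE /=; ring.
have aJ := alternating_symp F.
(* A multiple of e4 is subtracted to make f vanish; J does not notice, since e4 lies in its
   radical. *)
pose corr x := x - f x *: e4.
have fc x : f (corr x) = 0 by rewrite /corr -scaleNr fD fZ f4; ring.
have Jc x y : form J (corr x) (corr y) = form J x y.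
  rewrite /corr -!scaleNr !(formDl, formDr, formZl, formZr) !J4.
  by rewrite (formC y e4 aJ) J4; ring.
(* The vector dual to c under J, so that (z, y3) is a hyperbolic pair. *)
pose y3 := corr (row5 (- u o1 o4) (u o0 o4) (- u o3 o4) (u o2 o4) 0).
have Jy3 x : form J x y3 = linear_form c x.
  rewrite /y3 /corr -scaleNr formDr formZr J4 mulr0 addr0.
  by rewrite form_symp linear_form5E !row5E; ring.
have J23 : form J z y3 = 1 by rewrite Jy3.
have indec a b := @degenerate_indecomposable U eps J a b deg UJ epsJ.
have [y0 [y1 [J01 J02 J03 J12 J13]]] := hyperbolic_complement aJ J23 indec.
have czE : corr z = z by rewrite /corr fz scale0r subr0.
have cy3 : corr y3 = y3 by rewrite /corr fc scale0r subr0.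
pose P := rows5 (corr y0) (corr y1) z y3 e4.
have PJ : congr_mx P J = J.
  have Jcz x : form J (corr x) z = form J x z by rewrite -(Jc x z) czE.
  have Jcy x : form J (corr x) y3 = form J x y3 by rewrite -(Jc x y3) cy3.
  apply: congr_rows5_symp => //.
  - by rewrite Jc.
  - by rewrite Jcz.
  - by rewrite Jcy.
  - by rewrite Jcz.
  - by rewrite Jcy.
have uP : P \in unitmx.
  apply: unitmx_congr_symp PJ _; rewrite row_rows5; apply/rV0Pn; exists o4.
  by rewrite mxE oner_eq0.
have PJV : congr_mx (invmx P) J = J by rewrite -{1}PJ congr_mxK.
have PE : congr_mx P u = ew F o2 o4.
  have ca x : linear_form c (corr x) = linear_form c x.
    rewrite -!Jy3 /corr -scaleNr formDl formZl (formC y3 e4 aJ) J4; ring.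
  have c0 : linear_form c y0 = 0 by rewrite -Jy3.
  have c1 : linear_form c y1 = 0 by rewrite -Jy3.
  have c3 : linear_form c y3 = 0 by rewrite -Jy3 formuu.
  have c4 : linear_form c e4 = 0 by rewrite cE formuu.
  have f3 : f y3 = 0 by exact: fc.
  apply: alternating_eq;
    [exact: alternating_congr | exact: alternating_ew | ..];
    rewrite congr_mxE !row_rows5 uE ?c3 ?c4 ?f3 ?fz ?f4 ?cz ?ca ?fc ?c0 ?c1
      !mxE /=;
    ring.
by exists P => //; rewrite PJV -PE congr_mxK.
Qed.

Section WithDecomposable.
Hypotheses (UE : U (ew F o2 o4)) (epsE : eps (ew F o2 o4) = 0).

Let star0 w u a b c : U w -> U u -> eps u = 0 -> eps w != 0 ->
    (forall x y z, wedge w a x y z + wedge u b x y z + wedge (ew F o2 o4) c x y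
      z = 0) ->
  a = 0.
Proof.
move=> Uw Uu eu ew0 E; have := deg_star deg Uw Uu UE E.
rewrite eu epsE !scale0r !addr0 => /eqP.
by rewrite scaler_eq0 (negPf ew0) => /eqP.
Qed.

(** Polarisation: [degenerate_pencil] holds for u and for u + e2 /\ e4, whose contractions with e4
    differ by the coordinate form e2. On the index triples 012, 023 and 123 the difference of the
    two identities leaves only entries of u /\ e2, which gives the first three equations. The last
    two are what remains of the identity for u. *)
Lemma degenerate_second_form u : U u -> eps u = 0 -> u o2 o4 = 0 ->
  [/\ u o0 o1 = 0, u o0 o3 = 0 & u o1 o3 = 0] /\
  [/\ u o0 o2 * u o3 o4 + u o2 o3 * u o0 o4 = 0
    & u o1 o2 * u o3 o4 + u o2 o3 * u o1 o4 = 0].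
Proof.
move=> Uu eu u24; have [_ uN] := deg_alt deg Uu.
have Uv : U (u + ew F o2 o4) by exact: (degD deg).
have ev : eps (u + ew F o2 o4) = 0 by rewrite (deg_epsD deg) eu epsE addr0.
have Eu i j k := degenerate_pencil Uu eu (delta_mx 0 i) (delta_mx 0 j)
  (delta_mx 0 k).
have Ev i j k := degenerate_pencil Uv ev (delta_mx 0 i) (delta_mx 0 j)
  (delta_mx 0 k).
have := (Eu o0 o1 o2, Eu o0 o2 o3, Eu o1 o2 o3).
have := (Ev o0 o1 o2, Ev o0 o2 o3, Ev o1 o2 o3).
rewrite !wedge_delta !row5E !mxE /= (uN o0 o2) (uN o0 o3) (uN o1 o3) u24.
rewrite !(subr0, addr0, mulr0, add0r, mulr1).
move=> [[E1 E2] E3] [[D1 D2] D3].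
have diff (a b : F) : a = 0 -> b = 0 -> a - b = 0 by move=> -> ->;
  rewrite subrr.
have u01 : u o0 o1 = 0 by rewrite -[RHS](diff _ _ E1 D1); ring.
have u03 : u o0 o3 = 0 by rewrite -[RHS](diff _ _ D2 E2); ring.
have u13 : u o1 o3 = 0 by rewrite -[RHS](diff _ _ D3 E3); ring.
by split.
Qed.

(** If u23 <> 0, the two products give u04 = u14 = 0, so the contraction with e4 vanishes. If u23 =
    0, [key] reaches the same conclusion from a relation between J, u and e2 /\ e4; this relation is
    the reason for three terms in [deg_star]. *)
Lemma degenerate_second_eq0 u : U u -> eps u = 0 -> u o2 o4 = 0 ->
  u o3 o4 = 0 -> u = 0.
Proof.
move=> Uu eu u24 u34; have au := deg_alt deg Uu.
have [[u01 u03 u13]] := degenerate_second_form Uu eu u24.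
rewrite u34 !mulr0 !add0r => -[u0 u1].
have key (a b : F) : u o2 o3 = 0 -> a * u o0 o4 + b * u o1 o4 = 0.
  move=> u23; set d := _ + _.
  have /rowP/(_ o4) : row5 0 0 (a * u o0 o2 + b * u o1 o2) 0 d = 0.
    apply: (@star0 J u _ (row5 (- b) a 0 0 0) (row5 0 0 0 d 0)) => // x y z.
    rewrite /wedge !form_symp !form_ew24 !(form5E _ _ au) !linear_form5E !row5E.
    by rewrite u01 u03 u13 u23 u24 u34 /d; ring.
  by rewrite row5E mxE.
apply: degenerate_contraction_eq0 => //.
  move/eqP: u0; rewrite mulf_eq0 => /orP[/eqP u23|/eqP//].
  by have := key 1 0 u23; rewrite mul1r mul0r addr0.
move/eqP: u1; rewrite mulf_eq0 => /orP[/eqP u23|/eqP//].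
by have := key 0 1 u23; rewrite mul1r mul0r add0r.
Qed.

Lemma degenerate_split2 :
  (forall w, U w <-> exists b c, w = b *: J + c *: ew F o2 o4) \/
  exists2 P, P \in unitmx & [/\ U (congr_mx (invmx P) J),
    eps (congr_mx (invmx P) J) != 0 & [/\ U (congr_mx (invmx P) (ew F o2 o4)),
    eps (congr_mx (invmx P) (ew F o2 o4)) = 0, U (congr_mx (invmx P) (ew F o3
      o4))
    & eps (congr_mx (invmx P) (ew F o3 o4)) = 0]].
Proof.
have [[u [Uu eu u34]]|no_u] := pselect (exists u, [/\ U u, eps u = 0 & u o3 o4
  != 0]); last first.
  left=> w; split=> [Uw|[b [c ->]]]; last by apply: (degD deg);
    exact: (degZ deg).
  pose u := w + (- (eps w / eps J)) *: J.
  have Uu : U u by apply: (degD deg) => //; exact: (degZ deg).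
  have eu : eps u = 0 by rewrite (deg_epsD deg) (deg_epsZ deg) mulNr divfK //
    subrr.
  have u34 : u o3 o4 = 0.
    by apply/eqP/negPn/negP => ne; apply: no_u; exists u.
  exists (eps w / eps J), (u o2 o4).
  have : u + (- u o2 o4) *: ew F o2 o4 = 0.
    apply: degenerate_second_eq0.
    - by apply: (degD deg) => //; exact: (degZ deg).
    - by rewrite (deg_epsD deg) (deg_epsZ deg) eu epsE mulr0 addr0.
    - by rewrite !mxE /=; ring.
    - by rewrite [LHS]mxE u34 !mxE /=; ring.
  by rewrite /u !scaleNr => /subr0_eq <-; rewrite addrC subrK.
right; pose v := (u o3 o4)^-1 *: u + (- (u o2 o4 / u o3 o4)) *: ew F o2 o4.
have Uv : U v by apply: (degD deg); exact: (degZ deg).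
have ev : eps v = 0 by rewrite (deg_epsD deg) !(deg_epsZ deg) eu epsE !mulr0
  addr0.
have v34 : v o3 o4 = 1 by rewrite !mxE /= mulVf //; ring.
have v24 : v o2 o4 = 0 by rewrite !mxE /=; field.
have av := deg_alt deg Uv.
have [[v01 v03 v13]] := degenerate_second_form Uv ev v24.
rewrite v34 !mulr1 => -[/eqP + /eqP]; rewrite !addr_eq0 => /eqP v02 /eqP v12.
(* The relations give v = (v04 e0 + v14 e1 + e3) /\ (e4 - v23 e2) in coordinate forms. The rows of
   [P] are a basis in which the two factors become e3 and e4, while J and e2 /\ e4 are unchanged. *)
pose P := rows5 (row5 1 0 0 (- v o0 o4) 0) (row5 0 1 0 (- v o1 o4) 0)
  (row5 (v o1 o4) (- v o0 o4) 1 0 (v o2 o3)) (row5 0 0 0 1 0) (row5 0 0 0 0 1).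
have PJ : congr_mx P J = J.
  by apply: congr_rows5_symp; [exact: alternating_symp | ..];
    rewrite form_symp !row5E; ring.
have uP : P \in unitmx.
  apply: unitmx_congr_symp PJ _; rewrite row_rows5; apply/rV0Pn; exists o4.
  by rewrite row5E oner_eq0.
have PE : congr_mx P (ew F o2 o4) = ew F o2 o4.
  by apply: alternating_eq;
    [exact/alternating_congr/alternating_ew | exact: alternating_ew | ..];
    rewrite congr_mxE !row_rows5 form_ew24 !row5E !mxE /=; ring.
have Pv : congr_mx P v = ew F o3 o4.
  apply: alternating_eq;
    [exact: alternating_congr | exact: alternating_ew | ..];
    rewrite congr_mxE !row_rows5 (form5E _ _ av) !row5E
      v01 v03 v13 v02 v12 v24 v34 !mxE /=; ring.
have PVE w w' : congr_mx P w = w' -> congr_mx (invmx P) w' = w.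
  by move=> <-; rewrite congr_mxK.
by exists P => //; rewrite (PVE _ _ PJ) (PVE _ _ PE) (PVE _ _ Pv).
Qed.

(** Subtracting multiples of J and of the two decomposable forms leaves an element with eps = 0 and
    zero entries 24 and 34, which [degenerate_second_eq0] kills. So the process stops at dimension
    three. *)
Lemma degenerate_split3 : U (ew F o3 o4) -> eps (ew F o3 o4) = 0 ->
  forall w, U w <-> exists b c d, w = b *: J + c *: ew F o2 o4 + d *: ew F o3
    o4.
Proof.
move=> UE' epsE' w; split=> [Uw|[b [c [d ->]]]]; last first.
  by apply: (degD deg); [apply: (degD deg)|]; exact: (degZ deg).
pose u := w + (- (eps w / eps J)) *: J.
have Uu : U u by apply: (degD deg) => //; exact: (degZ deg).
have eu : eps u = 0 by rewrite (deg_epsD deg) (deg_epsZ deg) mulNr divfK //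
  subrr.
exists (eps w / eps J), (u o2 o4), (u o3 o4).
have : u + (- u o2 o4) *: ew F o2 o4 + (- u o3 o4) *: ew F o3 o4 = 0.
  apply: degenerate_second_eq0.
  - by apply: (degD deg); [apply: (degD deg) => //|]; exact: (degZ deg).
  - by rewrite 2!(deg_epsD deg) 2!(deg_epsZ deg) eu epsE epsE' !mulr0 !addr0.
  - by rewrite !mxE /=; ring.
  - by rewrite !mxE /=; ring.
rewrite /u !scaleNr => E; apply: subr0_eq; rewrite -[RHS]E.
by rewrite !opprD !addrA.
Qed.

End WithDecomposable.

End WithSymplecticForm.

End Classification.

End FormClassification.

Lemma congr_mx_invM (F : fieldType) n (P Q w : 'M[F]_n) :
    P \in unitmx -> Q \in unitmx ->
  congr_mx (invmx (P *m Q)) w = congr_mx (invmx Q) (congr_mx (invmx P) w).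
Proof.
move=> uP uQ; rewrite -[in LHS](congr_mxVK w uP).
rewrite -[in LHS](congr_mxVK (congr_mx (invmx P) w) uQ) -(congr_mxM P Q)
  congr_mxK //.
by rewrite unitmx_mul uP.
Qed.

(** * The three standard lists of forms *)

Section StandardForms.
Variable F : fieldType.
Local Open Scope ring_scope.
Implicit Types (s : seq 'M[F]_5) (w : 'M[F]_5).

Definition forms_i : seq 'M[F]_5 := [:: symp F].
Definition forms_iii : seq 'M[F]_5 := [:: symp F; ew F o2 o4].
Definition forms_ii : seq 'M[F]_5 := [:: symp F; ew F o2 o4; ew F o3 o4].

Definition in_span s w := exists c : 'I_(size s) -> F, w = \sum_k c k *: s`_k.

Lemma degenerate_classification U eps : degenerate U eps ->
    (exists2 w, U w & eps w != 0) ->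
  exists2 P, P \in unitmx & exists2 s, s \in [:: forms_i; forms_iii; forms_ii]
    & forall w, U (congr_mx (invmx P) w) <-> in_span s w.
Proof.
move=> deg exw; have [P uP [UJ eJ]] := degenerate_symp deg exw.
have {}deg := degenerate_congr uP deg.
have [E|[Q uQ [{}UJ {}eJ UE eE]]] := degenerate_split deg UJ eJ.
  exists P => //; exists forms_i; first by rewrite inE eqxx.
  move=> w; rewrite E; split=> [[c ->]|[c ->]].
    by exists (fun=> c); rewrite big_ord1.
  by exists (c ord0); rewrite big_ord1.
have {}deg := degenerate_congr uQ deg.
have [E|[R uR [{}UJ {}eJ [{}UE {}eE UE' eE']]]] := degenerate_split2 deg UJ eJ
  UE eE.
  exists (Q *m P); first by rewrite unitmx_mul uQ.
  exists forms_iii; first by rewrite !inE eqxx orbT.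
  move=> w; rewrite congr_mx_invM // E; split=> [[b [c ->]]|[c ->]].
    by exists (fun k => nth 0 [:: b; c] k);
      rewrite !big_ord_recl big_ord0 addr0.
  by exists (c ord0), (c ord_max); rewrite !big_ord_recr big_ord0 /= add0r;
    congr (c _ *: _ + c _ *: _); apply: val_inj.
have {}deg := degenerate_congr uR deg.
exists (R *m (Q *m P)); first by rewrite !unitmx_mul uR uQ.
exists forms_ii; first by rewrite !inE eqxx !orbT.
have E := degenerate_split3 deg UJ eJ UE eE UE' eE'.
move=> w; rewrite congr_mx_invM ?unitmx_mul ?uQ // congr_mx_invM // E.
split=> [[b [c [d ->]]]|[c ->]].
  exists (fun k => nth 0 [:: b; c; d] k).
  by rewrite !big_ord_recl big_ord0 addr0 addrA.
exists (c (@Ordinal 3 0 isT)), (c (@Ordinal 3 1 isT)), (c (@Ordinal 3 2 isT)).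
by rewrite !big_ord_recr big_ord0 /= add0r;
  congr (c _ *: _ + c _ *: _ + c _ *: _); apply: val_inj.
Qed.

End StandardForms.

(** * Changing generators along a base change *)

Section ChangeOfGenerators.
Variables (p : nat) (p_pr : prime p) (G : groupType) (G2 : comm_central G).
Variables (n : nat) (x : 'I_n -> G).
Hypothesis x_p : forall i, x i ^+ p = 1.
Hypothesis x_gen : forall g, generated (fun y => exists i, y = x i) g.

Lemma normal_formR (v w : 'rV['F_p]_n) A B :
  [~ normal_form x v A, normal_form x w B] = normal_form x 0 (w^T *m v - v^T *m
    w).
Proof.
pose N (a : free_model 'F_p n) := normal_form x a.1 a.2.
have NM : {morph N : a b / (a * b)%g} by move=> [? ?] [? ?];
  rewrite normal_formM.
by rewrite -[LHS](morphismR NM (v, A) (w, B)) heis_commE.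
Qed.

Lemma normal_form_comm_prod m (B : 'I_m -> 'I_m -> 'M['F_p]_n) (A : 'M['F_p]_m)
  :
  (\prod_(j < m) \prod_(i < m | (i < j)%N) normal_form x 0 (B i j) ^+ A i j)%g =
  normal_form x 0 (\sum_(j < m) \sum_(i < m | (i < j)%N) A i j *: B i j).
Proof.
have N0D : {morph (fun C : 'M['F_p]_n => normal_form x 0 C) : C D / (C + D)%R
  >-> C * D}.
  by move=> C D; rewrite (normal_formM p_pr G2 x_p) trmx0 mul0mx !addr0.
have N00 : normal_form x (0 : 'rV['F_p]_n) 0 = 1 := normal_form0 p x.
rewrite [RHS](big_morph _ N0D N00); apply: eq_bigr => j _.
rewrite [RHS](big_morph _ N0D N00); apply: eq_bigr => i _.
rewrite -[A i j in RHS]natr_Zp scaler_nat.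
elim: (nat_of_ord (A i j)) => [|k IHk]; first by rewrite expg0 mulr0n.
by rewrite expgS IHk mulrS N0D.
Qed.

Lemma upper_pairing_congr P w A : alternating w ->
  upper_pairing (congr_mx P w) A =
  upper_pairing w (\sum_(j < n) \sum_(i < n | (i < j)%N) A i j *:
    ((row i P)^T *m row j P - (row j P)^T *m row i P))%R :> 'F_p.
Proof.
move=> aw; rewrite linear_sum; apply: eq_bigr => j _.
rewrite linear_sum; apply: eq_bigr => i _.
by rewrite linearZ linearB /= congr_mxE form_upper // mulrC.
Qed.

Section NewGenerators.
Variable P : 'M['F_p]_n.
Hypothesis uP : P \in unitmx.

Definition new_gen i := normal_form x (row i P) 0%R.

(** The commutator of two new generators depends only on two rows of P, and pairing it with a form w
    gives an entry of w in the new basis. [relator_separation] turns these pairings into a test for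
    relators. *)
Lemma new_gen_relator A : relator new_gen A <->
  forall w, relator_forms x w -> upper_pairing (congr_mx P w) A = 0%R.
Proof.
have yE : normal_form new_gen 0%R A = normal_form x 0%R
    (\sum_(j < n) \sum_(i < n | (i < j)%N) A i j *:
      ((row i P)^T *m row j P - (row j P)^T *m row i P))%R.
  rewrite {1}/normal_form big1 ?mul1g => [|i _]; last by rewrite mxE expg0.
  rewrite -normal_form_comm_prod; apply: eq_bigr => j _; apply: eq_bigr => i _.
  by rewrite normal_formR.
rewrite /relator yE; split=> [rA w [aw wA]|wA].
  by rewrite upper_pairing_congr // wA.
apply: relator_separation => // w Uw.
by rewrite -upper_pairing_congr ?wA //; case: Uw.
Qed.

Hypothesis G_p : forall g : G, g ^+ p = 1.

(** Inverting P writes each x_k as a product of new generators times commutators. The commutators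
    lie in the subgroup generated by the new elements by the Frattini argument. *)
Lemma new_gen_generates g : generated (fun h => exists i, h = new_gen i) g.
Proof.
set S := fun h => _.
have vM (v w : 'rV['F_p]_n) g1 g2 :
    (exists A, g1 = normal_form x v A) -> (exists A, g2 = normal_form x w A) ->
  exists A, g1 * g2 = normal_form x (v + w)%R A.
  move=> [A ->] [B ->]; exists (A + B + w^T *m v)%R; exact: normal_formM.
have v1 : exists A, 1 = normal_form x (0 : 'rV['F_p]_n) A.
  by exists 0%R; rewrite normal_form0.
have xE k : exists q (B : 'M['F_p]_n), generated S q /\ x k = q * normal_form x
  0%R B.
  pose q := \prod_i new_gen i ^+ invmx P k i.
  have [A qE] : exists A, q = normal_form x (row k (invmx P) *m P) A.
    rewrite mulmx_sum_row /q.
    apply: (big_rec2 (fun g v => exists A, g = normal_form x v A)) => // i g' v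
      _ IH.
    apply: (vM) => //; rewrite mxE -[X in (X *: _)%R]natr_Zp scaler_nat.
    elim: (nat_of_ord (invmx P k i)) => [|l IHl]; first by rewrite mulr0n.
    by rewrite expgS mulrS; apply: (vM) => //; exists 0%R.
  rewrite -row_mul mulVmx // row1 in qE.
  exists q, (- A)%R; split.
    by apply: generated_prod => i _; apply: generated_X; apply: generated_in;
      exists i.
  by rewrite qE normal_formM // trmx0 mul0mx !addr0 subrr normal_form_gen.
have SZ h : generated (fun y => S y \/ central y) h.
  apply: generated_sub (x_gen h) => _ [k ->]; have [q [B [Sq ->]]] := xE k.
  apply: generated_M.
    by apply: generated_sub Sq => y Sy; apply: generated_in; left.
  apply: generated_in; right; apply: centralM; last exact: comm_prod_central.
  by apply: central_prod => i _; rewrite mxE expg0; exact: central1.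
have SR := generated_comm_mod_center G2 SZ.
apply: generated_sub (x_gen g) => _ [k ->]; have [q [B [Sq ->]]] := xE k.
apply: generated_M => //; apply: generated_M.
  by apply: generated_prod => i _; rewrite mxE expg0; exact: generated_1.
apply: generated_prod => j _; apply: generated_prod => i _.
by apply: generated_X; exact: SR.
Qed.

End NewGenerators.

End ChangeOfGenerators.

(** * Model groups and the main dichotomy *)

Section ModelGroups.
Variable F : fieldType.
Local Open Scope ring_scope.
Implicit Types (s : seq 'M[F]_5) (w A : 'M[F]_5).

Lemma upper_pairingC n (w A : 'M[F]_n) : upper_pairing w A = upper_pairing A w.
Proof. by apply: eq_bigr => j _; apply: eq_bigr => i _; rewrite mulrC. Qed.

Lemma upper_pairing_delta n (w : 'M[F]_n) (i j : 'I_n) : (i < j)%N ->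
  upper_pairing w (delta_mx i j) = w i j.
Proof.
move=> lt_ij; rewrite /upper_pairing (bigD1 j) //= (bigD1 i) //= !mxE !eqxx
  mulr1.
rewrite big1 ?addr0 => [|k /andP[_ ne_k]];
  last by rewrite mxE (negPf ne_k) mulr0.
rewrite big1 ?addr0 // => l ne_l; rewrite big1 // => k _.
by rewrite mxE (negPf ne_l) andbF mulr0.
Qed.

Lemma upper_pairing_delta0 n (w : 'M[F]_n) (i j : 'I_n) : ~~ (i < j)%N ->
  upper_pairing w (delta_mx i j) = 0.
Proof.
move=> ge_ij; rewrite /upper_pairing big1 // => l _; rewrite big1 // => k lt_kl.
rewrite mxE; case: andP => [[/eqP ki /eqP lj]|_]; last by rewrite mulr0.
by rewrite -ki -lj lt_kl in ge_ij.
Qed.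

Lemma upper_pairing_ew (i j : 'I_5) A : (i < j)%N ->
  upper_pairing (ew F i j) A = A i j.
Proof.
move=> lt_ij; rewrite upper_pairingC linearB /= upper_pairing_delta //.
by rewrite upper_pairing_delta0 ?subr0 // -leqNgt ltnW.
Qed.

Definition seq_forms s (k : 'I_(size s)) : 'M[F]_5 := s`_k.
Definition seq_model s : groupType := forms_model (@seq_forms s).

Definition standard : seq (seq 'M[F]_5) :=
  [:: forms_i F; forms_iii F; forms_ii F].

(** The entries (0,1), (2,4) and (3,4) separate the three forms, so a matrix supported there
    realises any prescribed values. *)
Lemma standard_surj s (w : 'rV_(size s)) : s \in standard ->
  exists A, \row_k upper_pairing (@seq_forms s k) A = w.
Proof.
pose A (a b c : F) := a *: delta_mx o0 o1 + b *: delta_mx o2 o4 + c *: delta_mx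
  o3 o4.
have AE u a b c : upper_pairing u (A a b c) = a * u o0 o1 + b * u o2 o4 + c * u
  o3 o4.
  by rewrite !linearD !linearZ /= !upper_pairing_delta.
rewrite !inE => /or3P[] /eqP sE; subst s.
- exists (A (w 0 0) 0 0); apply/rowP=> -[[|//] lt_k].
  by rewrite mxE AE /seq_forms /= !mxE /=; rewrite [X in _ = w 0 X](_ : _ = 0);
    [ring | exact: val_inj].
- exists (A (w 0 0) (w 0 (@Ordinal 2 1 isT)) 0); apply/rowP=> -[[|[|//]] lt_k];
    rewrite mxE AE /seq_forms /= !mxE /=.
    by rewrite [X in _ = w 0 X](_ : _ = 0); [ring | exact: val_inj].
  by rewrite [X in _ = w 0 X](_ : _ = @Ordinal 2 1 isT);
    [ring | exact: val_inj].
exists (A (w 0 0) (w 0 (@Ordinal 3 1 isT)) (w 0 (@Ordinal 3 2 isT))).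
apply/rowP=> -[[|[|[|//]]] lt_k]; rewrite mxE AE /seq_forms /= !mxE /=.
- by rewrite [X in _ = w 0 X](_ : _ = 0); [ring | exact: val_inj].
- by rewrite [X in _ = w 0 X](_ : _ = @Ordinal 3 1 isT);
  [ring | exact: val_inj].
- by rewrite [X in _ = w 0 X](_ : _ = @Ordinal 3 2 isT);
  [ring | exact: val_inj].
Qed.

End ModelGroups.

Theorem capable_or_standard (p : nat) (G : groupType) :
    prime p -> odd p -> comm_central G -> (forall g : G, g ^+ p = 1) ->
    minimally_generated G 5 ->
  capable G \/ exists2 s, s \in standard 'F_p & isomorphic G (seq_model s).
Proof.
move=> p_pr p_odd G2 G_p [[x0 x0_gen] G_min].
pose x i := tnth x0 i.
have x_p i : x i ^+ p = 1 by [].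
have x_gen g : generated (fun y => exists i, y = x i) g.
  by apply: generated_sub (x0_gen g) => y /tnthP[i ->]; apply: generated_in;
    exists i.
have x_indep (v : 'rV['F_p]_5) A : normal_form x v A = 1 -> v = 0%R.
  by apply: normal_form_indep => //; exact: G_min.
have [|not_cap] := pselect (capable G); [by left | right].
have [A0 [nrA0 star]] :=
  not_capable_relator p_pr p_odd G2 (isT : 1 < 5)%N x_p x_gen x_indep not_cap.
have deg : degenerate (relator_forms x) (fun w : 'M['F_p]_5 => upper_pairing w
  A0).
  split=> [w u [aw rw] [au ru]|c w [aw rw]|w [] //|w u|c w|].
  - split=> [|A rA]; first exact: alternatingD.
    by rewrite upper_pairingC linearD /= -!(upper_pairingC _ A) rw ?ru ?addr0.
  - split=> [|A rA]; first exact: alternatingZ.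
    by rewrite upper_pairingC linearZ /= -!(upper_pairingC _ A) rw ?mulr0.
  - by rewrite upper_pairingC linearD /= -!(upper_pairingC _ A0).
  - by rewrite upper_pairingC linearZ /= -!(upper_pairingC _ A0).
  move=> w1 w2 w3 a1 a2 a3 U1 U2 U3 J.
  have := star (fun k => nth 0%R [:: w1; w2; w3] k) (fun k => nth 0%R [:: a1;
    a2; a3] k).
  rewrite !big_ord_recl big_ord0 /= addr0 addrA; apply.
    by case=> [[|[|[|]]]].
  by move=> u v t; rewrite !big_ord_recl big_ord0 /= addr0 addrA; exact: J.
(* The functional is nonzero on U: otherwise [relator_separation] would make A0 a relator. *)
have exw : exists2 w, relator_forms x w & upper_pairing w A0 != 0%R.
  apply: contrapT => no_w; apply: nrA0;
    apply: (relator_separation p_pr G2 x_p) => w rw.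
  by apply/eqP/negPn/negP => ne; apply: no_w; exists w.
have [P uP [s s_std sE]] := degenerate_classification deg exw.
exists s => //.
have y_p i : new_gen x P i ^+ p = 1 by [].
have y_gen := new_gen_generates p_pr G2 x_p x_gen uP.
apply: (@isomorphic_forms_model p p_pr G G2 5 (new_gen x P)) => // [w|v A].
  exact: standard_surj.
split=> [vA1|[-> sA]].
  have v0 : v = 0%R by apply: normal_form_indep vA1 => //; exact: G_min.
  split=> // k; rewrite v0 in vA1.
  have /(new_gen_relator p_pr G2 x_p) rA : relator (new_gen x P) A by [].
  rewrite -[seq_forms k](congr_mxVK _ uP); apply: rA; apply/sE.
  exists (fun j => (j == k)%:R%R);
    rewrite (bigD1 k) //= eqxx scale1r big1 ?addr0 //.
  by move=> j /negPf ->; rewrite scale0r.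
apply/(new_gen_relator p_pr G2 x_p) => // w rw.
have /sE[c ->] : relator_forms x (congr_mx (invmx P) (congr_mx P w)).
  by rewrite congr_mxK.
rewrite upper_pairingC linear_sum big1 // => k _.
by rewrite linearZ /= upper_pairingC sA mulr0.
Qed.

(** * The three exceptional groups *)

Section SeqModels.
Variable F : fieldType.
Local Open Scope ring_scope.
Variable s : seq 'M[F]_5.
Local Notation C := (seq_model s).

Definition model_gen (i : 'I_5) : C := (delta_mx 0 i, 0).

Lemma seq_model_comm_central : comm_central C.
Proof. exact: heis_comm_central. Qed.

Lemma standard_mem w : s \in standard F -> w \in s ->
  [\/ w = symp F, w = ew F o2 o4 | w = ew F o3 o4].
Proof.
rewrite !inE => /or3P[] /eqP->; rewrite !inE.
- by move=> /eqP ->; apply: Or31.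
- by move=> /orP[] /eqP ->; [apply: Or31 | apply: Or32].
- by move=> /or3P[] /eqP ->; [apply: Or31 | apply: Or32 | apply: Or33].
Qed.

Hypothesis s_std : s \in standard F.

Lemma standard_alternating k : alternating (@seq_forms F s k).
Proof.
have [] := standard_mem s_std (mem_nth 0 (ltn_ord k)) => wE;
  rewrite /seq_forms wE.
- exact: alternating_symp.
- exact: alternating_ew.
- exact: alternating_ew.
Qed.

Lemma form_standard k x y (w := @seq_forms F s k) : form w x y =
    w o0 o1 * (x 0 o0 * y 0 o1 - x 0 o1 * y 0 o0)
  + w o0 o1 * (x 0 o2 * y 0 o3 - x 0 o3 * y 0 o2)
  + w o2 o4 * (x 0 o2 * y 0 o4 - x 0 o4 * y 0 o2)
  + w o3 o4 * (x 0 o3 * y 0 o4 - x 0 o4 * y 0 o3).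
Proof.
rewrite form5E; last exact: standard_alternating.
have [] := standard_mem s_std (mem_nth 0 (ltn_ord k));
  rewrite -/(seq_forms k) -/w;
  by move=> ->; rewrite !mxE /=; ring.
Qed.

Lemma seq_model_commE (g h : C) :
  [~ g, h]%g = (0, \row_k form (seq_forms k) h.1 g.1).
Proof.
rewrite [LHS]heis_commE; congr pair; apply/rowP=> k.
by rewrite !mxE form_upper //; exact: standard_alternating.
Qed.

Lemma size_standard : (0 < size s)%N.
Proof. by move: s_std; rewrite !inE => /or3P[] /eqP->. Qed.

Lemma standard_first : seq_forms (Ordinal size_standard) = symp F.
Proof. by rewrite /seq_forms /=; move: s_std;
  rewrite !inE => /or3P[] /eqP->. Qed.

Lemma model_gen10_neq1 : [~ model_gen o1, model_gen o0]%g <> 1%g.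
Proof.
rewrite seq_model_commE => -[/rowP/(_ (Ordinal size_standard))].
rewrite !mxE standard_first form_symp !mxE /= => /eqP.
by rewrite !(mulr0, mul0r, subr0, addr0) mulr1 oner_eq0.
Qed.

(* An element is a product of an element supported on the first two           *)
(* coordinates and one supported on the last three.                           *)
Lemma not_capable_seq_model : ~ capable C.
Proof.
apply: (not_capable_commuting (a := model_gen o1) (b := model_gen o0)
  (c := model_gen o3) (d := model_gen o2)).
- rewrite !seq_model_commE; congr pair; apply/rowP=> k.
  by rewrite !mxE !form_standard !mxE /=; ring.
- exact: model_gen10_neq1.
have comm (g h : C) : (forall k, form (@seq_forms F s k) h.1 g.1 = 0) ->
  commute g h.
  move=> gh; apply/commgP/eqP; rewrite seq_model_commE; congr pair.
  by apply/rowP=> k; rewrite !mxE gh.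
move=> [v w]; pose v1 := row5 (v 0 o0) (v 0 o1) 0 0 0.
pose v2 := row5 0 0 (v 0 o2) (v 0 o3) (v 0 o4).
have -> : (v, w) =
    (((v1, 0) : C) * ((v2, w - forms_bia (@seq_forms F s) v1 v2) : C))%g.
  rewrite heisME /= add0r subrK; congr pair; apply/rowP=> i.
  by elim/ord5_ind: i; rewrite [RHS]mxE !row5E ?addr0 ?add0r.
apply: generated_M; apply: generated_in; [right | left]; split;
  apply: comm => k;
  by rewrite form_standard /= !row5E !mxE /=; ring.
Qed.

End SeqModels.

Lemma capable_isomorphic (G H : groupType) : isomorphic G H -> capable G ->
  capable H.
Proof.
move=> GH [K GK]; exists K; apply: isomorphic_trans GK.
exact: isomorphic_sym.
Qed.

(** The order of a model is p ^ (5 + size s). *)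
Lemma seq_model_size (p : nat) (p_pr : prime p) (s t : seq 'M['F_p]_5) :
  isomorphic (seq_model s) (seq_model t) -> size s = size t.
Proof.
case=> f f_bij; pose f' (a : 'rV['F_p]_5 * 'rV['F_p]_(size s)) :
  'rV['F_p]_5 * 'rV['F_p]_(size t) := f a.
have : bijective f' by exact: f_bij.
move/bij_eq_card; rewrite !card_prod !card_mx card_Fp // => /eqP.
rewrite eqn_pmul2l ?expn_gt0 ?prime_gt0 // !mul1n eqn_exp2l ?prime_gt1 //.
by move/eqP.
Qed.

(** * Universal properties of quotients, nilpotent products and amalgams *)

Lemma quotient_proj_morph (G : groupType) (N : normal_subgroup G) :
  {morph quotient_proj N : x y / x * y}.
Proof. exact: quotient_projM. Qed.

Lemma quotient_lift (G X : groupType) (N : normal_subgroup G) (f : G -> X) :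
    {morph f : x y / x * y} -> (forall x, N x -> f x = 1) ->
  exists2 g : quotient_group N -> X, {morph g : x y / x * y}
    & forall x, g (quotient_proj N x) = f x.
Proof.
move=> fM fN; pose g (x : quotient_group N) := f (repr x).
have gE x : g (quotient_proj N x) = f x.
  apply/esym/divg1_eq; rewrite -(morphismV fM) -fM.
  have /quotient_projP : quotient_proj N (repr (quotient_proj N x)) =
    quotient_proj N x.
    exact: quotient_reprK.
  move=> /(@nsubJ _ _ _ (repr (quotient_proj N x))^-1)/fN.
  by rewrite conjgE invgK -mulgA mulVKg.
exists g => // x y; rewrite -[x]quotient_reprK -[y]quotient_reprK.
by rewrite -quotient_proj_morph !gE fM.
Qed.

(** Words are evaluated letter by letter. Commutators go to central elements of X, so triple
    commutators go to 1 and the evaluation descends. *)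
Lemma nil2_lift (I : choiceType) (A : I -> groupType) (X : groupType)
    (f : forall i, A i -> X) :
    comm_central X -> (forall i, {morph f i : a b / a * b}) ->
  exists2 g : nil2_product A -> X, {morph g : x y / x * y}
    & forall i a, g (nil2_in a) = f i a.
Proof.
move=> X2 fM; pose ev (w : seq (letter A)) := \prod_(l <- w) f (tag l) (tagged
  l).
have evE u v : word_eq u v -> ev u = ev v.
  rewrite /ev; elim=> {u v} // [u v w _ -> _ -> //|u v i|u v i a b].
    by rewrite !big_cat big_cons /= (morphism1 (fM i)) mul1g.
  by rewrite !big_cat !big_cons /= fM !mulgA.
pose h (x : free_product A) := ev (repr x).
have hE w : h (word_class w) = ev w.
  by apply/evE/word_classP; exact: fp_reprK.
have hM : {morph h : x y / x * y}.
  move=> x y; rewrite -[x]fp_reprK -[y]fp_reprK.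
  by rewrite -[_ * _]word_class_cat !hE /ev big_cat.
have h2 x : comm_nsub (whole_nsub _) (whole_nsub _) x -> central (h x).
  elim=> {x} [_ [x [y [_ _ ->]]]||x y _ cx _ cy|x _ cx].
  - by rewrite (morphismR hM); exact: X2.
  - by rewrite (morphism1 hM); exact: central1.
  - by rewrite hM; exact: centralM.
  - by rewrite (morphismV hM); exact: centralV.
have h3 x : gamma3 (free_product A) x -> h x = 1.
  elim=> {x} [_ [x [y [x2 _ ->]]]||x y _ h1 _ h1'|x _ h1].
  - by rewrite (morphismR hM); apply/eqP/commgP; exact: h2.
  - exact: morphism1.
  - by rewrite hM h1 h1' mulg1.
  - by rewrite (morphismV hM) h1 invg1.
have [g gM gE] := quotient_lift hM h3; exists g => // i a.
by rewrite /nil2_in gE hE /ev big_seq1.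
Qed.

Section PowersOfCp.
Variables (p : nat) (p_pr : prime p).

Lemma Cp_gen_expg n : Cp_gen p ^+ n = (n%:R : 'Z_p)%R :> 'Z_p.
Proof. by elim: n => [|n IHn]; rewrite ?expgS ?IHn // mulrS. Qed.

Lemma Cp_gen_p : Cp_gen p ^+ p = 1.
Proof. by rewrite Cp_gen_expg pchar_Zp // prime_gt1. Qed.

Lemma CpE (a : Cp p) : a = Cp_gen p ^+ (a : 'Z_p).
Proof.
by rewrite Cp_gen_expg natr_Zp.
Qed.

Lemma nil2_power_comm_central m : comm_central (nil2_power p m).
Proof. by move=> x y; exact: nil2_comm_central. Qed.

Lemma nil2_in_morph m (i : 'I_m) :
  {morph (@nil2_in _ (fun _ : 'I_m => Cp p) i) : a b / a * b}.
Proof. by move=> a b; rewrite /nil2_in -quotient_proj_morph fp_inM. Qed.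

Lemma nil2_gen_p m (i : 'I_m) : nil2_gen p i ^+ p = 1.
Proof.
rewrite /nil2_gen -(morphismX (@nil2_in_morph m i)).
rewrite Cp_gen_p; exact: (morphism1 (@nil2_in_morph m i)).
Qed.

Lemma nil2_power_generated m (g : nil2_power p m) :
  generated (fun y => exists i : 'I_m, y = nil2_gen p i) g.
Proof.
rewrite -[g]quotient_reprK; set x := repr g; rewrite -[x]fp_reprK.
elim: (repr x) => [|[i a] w IHw]; first exact: generated_1.
have -> : word_class (existT _ i a :: w) =
    @fp_in _ (fun _ : 'I_m => Cp p) i a * word_class w.
  exact: (word_class_cat [:: _] w).
rewrite quotient_proj_morph; apply: generated_M => //.
rewrite [a]CpE; apply: (@generated_sub _ (eq (nil2_gen p i))) => [y <-|].
  by apply: generated_in; exists i.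
by rewrite -/(nil2_in _) (morphismX (@nil2_in_morph m i)); apply: generated_X;
  exact: generated_in.
Qed.

Lemma nil2_power_lift m (X : groupType) (t : 'I_m -> X) :
    comm_central X -> (forall i, t i ^+ p = 1) ->
  exists2 g : nil2_power p m -> X, {morph g : x y / x * y}
    & forall i, g (nil2_gen p i) = t i.
Proof.
move=> X2 tp; have p_gt1 := prime_gt1 p_pr.
(* Addition in ['Z_p] reduces modulo [(Zp_trunc p).+2], which is p because p > 1. *)
have expgp x n : x ^+ p = 1 -> (x : X) ^+ (n %% (Zp_trunc p).+2) = x ^+ n.
  by move=> xp; rewrite Zp_cast // [in RHS](divn_eq n p) expgnDr mulnC expgnA
    xp expg1n mul1g.
have [|g gM gE] := @nil2_lift _ (fun _ : 'I_m => Cp p) X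
    (fun i a => t i ^+ (a : 'Z_p)) X2.
  by move=> i a b; rewrite -expgnDr -[RHS]expgp.
exists g => // i; rewrite /nil2_gen gE -[RHS]expg1; congr (_ ^+ _).
Qed.

End PowersOfCp.

Section AmalgamatedLift.
Variables (G1 G2 X : groupType) (H : normal_subgroup G1) (phi : amalgamation G2
  H).

Definition amalg_in1 (a : G1) : amalgamated_product phi := quotient_proj _ (a,
  1).
Definition amalg_in2 (b : G2) : amalgamated_product phi := quotient_proj _ (1,
  b).

Lemma amalg_in1M : {morph amalg_in1 : a b / a * b}.
Proof. by move=> a b; rewrite -[RHS]quotient_proj_morph; congr quotient_proj;
  congr pair; rewrite ?mulg1. Qed.

Lemma amalg_in2M : {morph amalg_in2 : a b / a * b}.
Proof. by move=> a b; rewrite -[RHS]quotient_proj_morph; congr quotient_proj;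
  congr pair; rewrite ?mulg1. Qed.

Lemma amalg_in_commute a b : commute (amalg_in1 a) (amalg_in2 b).
Proof.
rewrite /commute -!quotient_proj_morph.
by congr quotient_proj; congr pair; rewrite /= ?mulg1 ?mul1g.
Qed.

Lemma amalg_inE x : exists a b, x = amalg_in1 a * amalg_in2 b.
Proof.
exists (repr x).1, (repr x).2;
  rewrite -[LHS]quotient_reprK -quotient_proj_morph.
by congr quotient_proj; case: (repr x) => a b; congr pair;
  rewrite /= ?mulg1 ?mul1g.
Qed.

Lemma amalg_in_phi h : H h -> amalg_in1 h = amalg_in2 (phi h).
Proof.
move=> Hh; apply/quotient_projP; exists h^-1; first exact: nsubV.
rewrite amalg_mapV // invgK.
by congr pair; rewrite /= ?mulg1 ?invg1 ?mul1g.
Qed.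

Lemma amalg_lift (f1 : G1 -> X) (f2 : G2 -> X) :
    {morph f1 : a b / a * b} -> {morph f2 : a b / a * b} ->
    (forall a b, commute (f1 a) (f2 b)) -> (forall h, H h -> f1 h = f2 (phi h))
      ->
  exists2 g : amalgamated_product phi -> X, {morph g : x y / x * y}
    & (forall a, g (amalg_in1 a) = f1 a) /\ (forall b, g (amalg_in2 b) = f2 b).
Proof.
move=> f1M f2M f12 fphi; pose f (z : (G1 * G2)%type) := f1 z.1 * f2 z.2.
have fM : {morph f : x y / x * y}.
  move=> [a b] [c d]; rewrite /f /= f1M f2M -!mulgA; congr (_ * _).
  by rewrite !mulgA f12.
have [_ [h Hh ->]|g gM gE] := @quotient_lift _ _ (amalg_kernel phi) f fM.
  by rewrite /f /= fphi // (morphismV f2M) mulgV.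
exists g => //; split=> [a|b]; rewrite gE /f /=.
  by rewrite (morphism1 f2M) mulg1.
by rewrite (morphism1 f1M) mul1g.
Qed.

End AmalgamatedLift.

Lemma comm_central_epi (G H : groupType) (f : G -> H) :
    {morph f : x y / x * y} -> (forall y, exists x, y = f x) ->
  comm_central G -> comm_central H.
Proof.
move=> fM f_surj G2 x y z; have [a ->] := f_surj x; have [b ->] := f_surj y.
have [c ->] := f_surj z; rewrite -(morphismR fM) /commute -!fM; congr f;
  exact: G2.
Qed.

Lemma comm_central_pair (G H : groupType) :
  comm_central G -> comm_central H -> comm_central (G * H)%type.
Proof.
by move=> G2 H2 [a b] [c d] [e f]; congr pair;
  [exact: (G2 a c e) | exact: (H2 b d f)].
Qed.

Lemma comm_central_quotient (G : groupType) (N : normal_subgroup G) :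
  comm_central G -> comm_central (quotient_group N).
Proof.
apply: (comm_central_epi (f := quotient_proj N));
  first exact: quotient_proj_morph.
by move=> y; exists (repr y); rewrite quotient_reprK.
Qed.

(** * Relations in the models and in the amalgams *)

Section ModelNormalForm.
Variables (p : nat) (p_pr : prime p) (s : seq 'M['F_p]_5).
Hypothesis s_std : s \in standard 'F_p.

Lemma model_comm_prod (A : 'M['F_p]_5) :
  comm_prod (model_gen s) (fun i j => A i j) =
  (0, \row_k upper_pairing (seq_forms k) A)%R.
Proof.
have zM : {morph (fun w => (0%R, w) : seq_model s) : u v / (u + v)%R >-> u * v}.
  exact: heis_centerM.
pose r i j := (\row_k @seq_forms _ s k i j)%R.
transitivity ((0, \sum_(j < 5) \sum_(i < 5 | (i < j)%N) r i j *+ A i j)%R :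
  seq_model s).
  rewrite (big_morph _ zM (erefl _)); apply: eq_bigr => j _.
  rewrite (big_morph _ zM (erefl _)); apply: eq_bigr => i _.
  rewrite seq_model_commE // -heis_centerX; congr (_ ^+ _); congr pair.
  by apply/rowP=> k; rewrite !mxE form_delta.
congr pair; apply/rowP=> k; rewrite !mxE summxE; apply: eq_bigr => j _.
rewrite summxE; apply: eq_bigr => i _.
by rewrite mulmxnE mxE -mulr_natr natr_Zp.
Qed.

(** The model satisfies no relation beyond those its forms impose. A morphism to the model that
    matches generators therefore bounds the relations of its source. *)
Lemma model_normal_form_eq1 (v : 'rV['F_p]_5) A : normal_form (model_gen s) v A
  = 1 ->
  v = 0%R /\ forall k, upper_pairing (@seq_forms _ s k) A = 0%R.
Proof.
have fM : {morph (fun g : seq_model s => g.1) : g h / g * h >-> (g + h)%R} by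
  [].
move=> vA1; have v0 : v = 0%R.
  have := congr1 fst vA1; rewrite /normal_form model_comm_prod /= addr0.
  rewrite (big_morph _ fM (erefl _)) => <-; rewrite [LHS]row_sum_delta.
  apply: eq_bigr => i _; rewrite -[v 0%R i in LHS]natr_Zp scaler_nat.
  elim: (nat_of_ord (v 0%R i)) => [|k IHk]; first by rewrite mulr0n.
  by rewrite expgS mulrS /= -IHk.
split=> // k; move: vA1; rewrite v0 /normal_form model_comm_prod big1 => [|i _].
  by rewrite mul1g => -[/rowP/(_ k)]; rewrite !mxE.
by rewrite mxE expg0.
Qed.

End ModelNormalForm.

Lemma comm_prod5 (G : groupType) (x : 'I_5 -> G) (a : 'I_5 -> 'I_5 -> nat) :
  comm_prod x a =
    [~ x o1, x o0] ^+ a o0 o1 *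
    ([~ x o2, x o0] ^+ a o0 o2 * [~ x o2, x o1] ^+ a o1 o2) *
    ([~ x o3, x o0] ^+ a o0 o3 * [~ x o3, x o1] ^+ a o1 o3 *
     [~ x o3, x o2] ^+ a o2 o3) *
    ([~ x o4, x o0] ^+ a o0 o4 * [~ x o4, x o1] ^+ a o1 o4 *
     [~ x o4, x o2] ^+ a o2 o4 * [~ x o4, x o3] ^+ a o3 o4).
Proof.
rewrite /comm_prod big5; do ![rewrite [in LHS]big_mkcond /= big5 /=].
by rewrite !mulg1 !mul1g.
Qed.

(** Multiplicativity is asked on the cycle only, because an [amalgamation] obeys no law outside its
    domain. *)
Lemma central_cycle_morph (G X : groupType) (z : G) (cz : central z) (f g : G
  -> X) :
    f 1 = g 1 -> f z = g z ->
    (forall a b, central_cycle cz a -> central_cycle cz b ->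
       f (a * b) = f a * f b /\ g (a * b) = g a * g b) ->
  forall h, central_cycle cz h -> f h = g h.
Proof.
move=> fg1 fgz fgM h; elim=> {h} [h <- //|//|a b Ha fga Hb fgb|a Ha fga].
  by have [-> ->] := fgM a b Ha Hb; rewrite fga fgb.
have [fM gM] := fgM a a^-1 Ha (generated_V Ha).
by apply: (mulgI (f a)); rewrite -fM [in RHS]fga -gM mulgV.
Qed.

Lemma model_gen_p (p : nat) (p_pr : prime p) (s : seq 'M['F_p]_5) i :
  model_gen s i ^+ p = 1.
Proof.
have b0 : forms_bia (@seq_forms _ s) (delta_mx 0 i)%R (delta_mx 0 i)%R = 0%R.
  apply/rowP=> k; rewrite !mxE /free_form.
  by rewrite trmx_delta mul_delta_mx upper_pairing_delta0 ?ltnn.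
have XE n : model_gen s i ^+ n = (delta_mx 0 i *+ n, 0)%R.
  elim: n => [|n IHn]; first by rewrite mulr0n.
  rewrite expgS IHn heisME [_.1]/= [_.1]/= [_.2]/= [_.2]/= mulrS; congr pair.
  rewrite !add0r; elim: n {IHn} => [|n IHn]; first by rewrite bia0r.
  by rewrite mulrS biaDr b0 add0r.
by rewrite XE -scaler_nat pchar_Fp_0 // scale0r.
Qed.

Section AmalgamModel.
Variables (p : nat) (p_pr : prime p) (s : seq 'M['F_p]_5).
Hypothesis s_std : s \in standard 'F_p.
Variables (G2 : groupType) (t : 'I_3 -> G2).
Hypotheses (G2_2 : comm_central G2) (t_p : forall i, t i ^+ p = 1).
Hypothesis t_gen : forall g, generated (fun y => exists i, y = t i) g.
Variable phi : amalgamation G2 (H21 p).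
Hypothesis phiE : phi [~ gen_x2 p, gen_x1 p] = [~ t (inord 1), t (inord 0)].
Variable f2 : G2 -> seq_model s.
Hypothesis f2M : {morph f2 : x y / x * y}.
Hypotheses (f2_0 : f2 (t (inord 0)) = model_gen s o2)
  (f2_1 : f2 (t (inord 1)) = model_gen s o3)
  (f2_2 : f2 (t (inord 2)) = model_gen s o4).
Hypothesis rel : forall A, (forall k, upper_pairing (@seq_forms _ s k) A = 0%R)
  ->
  [~ t (inord 2), t (inord 0)] ^+ A o2 o4 *
  [~ t (inord 2), t (inord 1)] ^+ A o3 o4 = 1.

(** The amalgam maps to the model, so its relations hold there. Conversely, cross commutators vanish
    and [z1, z0] = [z3, z2], so a normal form with v = 0 is [t1, t0] ^ (A01 + A23) times the product
    in [rel]; the exponent is the pairing of A with [symp]. *)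
Lemma isomorphic_amalgam_model : isomorphic (amalgamated_product phi)
  (seq_model s).
Proof.
have G1_2 := @nil2_power_comm_central p 2.
pose z (i : 'I_5) : amalgamated_product phi := nth 1
  [:: amalg_in1 phi (gen_x1 p); amalg_in1 phi (gen_x2 p);
      amalg_in2 phi (t (inord 0)); amalg_in2 phi (t (inord 1));
      amalg_in2 phi (t (inord 2))] i.
have in1M := @amalg_in1M _ _ _ phi; have in2M := @amalg_in2M _ _ _ phi.
have z_p i : z i ^+ p = 1.
  elim/ord5_ind: i; rewrite /z /= -?(morphismX in1M) -?(morphismX in2M)
    ?t_p ?nil2_gen_p ?(morphism1 in1M) ?(morphism1 in2M) //.
have Q2 : comm_central (amalgamated_product phi).
  exact: comm_central_quotient (comm_central_pair G1_2 G2_2).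
have ord2E (i : 'I_2) : i = inord 0 \/ i = inord 1.
  by case: i => [[|[|//]] lt_i]; [left | right]; apply: val_inj;
    rewrite /= inordK.
have ord3E (i : 'I_3) : [\/ i = inord 0, i = inord 1 | i = inord 2].
  by case: i => [[|[|[|//]]] lt_i];
    [apply: Or31 | apply: Or32 | apply: Or33]; apply: val_inj;
      rewrite /= inordK.
have z_gen g : generated (fun y => exists i, y = z i) g.
  have [a [b ->]] := amalg_inE g; apply: generated_M.
    apply: generated_sub (generated_morph in1M (nil2_power_generated a)).
    move=> _ [_ [i ->] ->]; apply: generated_in.
    by case: (ord2E i) => ->; [exists o0 | exists o1].
  apply: generated_sub (generated_morph in2M (t_gen b)).
  move=> _ [_ [i ->] ->]; apply: generated_in.
  by case: (ord3E i) => ->; [exists o2 | exists o3 | exists o4].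
apply: (isomorphic_forms_model p_pr Q2 z_p z_gen) => [w|v A].
  exact: standard_surj.
have C2 := @seq_model_comm_central _ s.
have gen_p := @model_gen_p p p_pr s.
have gen_comm i j : [~ model_gen s i, model_gen s j] = (0%R, \row_k seq_forms k
  j i)%R.
  by rewrite seq_model_commE //; congr pair; apply/rowP=> k;
    rewrite !mxE form_delta.
have gen_commE i j : (forall k, form (@seq_forms _ s k) (delta_mx 0 j)
  (delta_mx 0 i) = 0)%R ->
    commute (model_gen s i) (model_gen s j).
  move=> ij0; apply/commgP/eqP; rewrite seq_model_commE //; congr pair.
  by apply/rowP=> k; rewrite !mxE ij0.
split=> [vA1|[-> sA]].
  pose t1 (i : 'I_2) := nth 1 [:: model_gen s o0; model_gen s o1] i.
  have t1_p i : t1 i ^+ p = 1.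
    by case: (ord2E i) => ->; rewrite /t1 inordK //=.
  have [f1 f1M f1E] := nil2_power_lift p_pr C2 t1_p.
  have f10 : f1 (gen_x1 p) = model_gen s o0 by rewrite f1E /t1 inordK.
  have f11 : f1 (gen_x2 p) = model_gen s o1 by rewrite f1E /t1 inordK.
  have f12 a b : commute (f1 a) (f2 b).
    have f1g h : (forall i, commute (f1 (nil2_gen p i)) h) -> commute (f1 a) h.
      move=> ch; apply: commute_sym;
        have := generated_morph f1M (nil2_power_generated a).
      elim=> [_ [_ [i ->] ->]||? ? _ ? _ ?|? _ ?].
      - exact/commute_sym.
      - exact: commute1.
      - exact: commuteM.
      - exact: commuteV.
    apply: f1g => i; have := generated_morph f2M (t_gen b).
    elim=> [_ [_ [j ->] ->]||? ? _ ? _ ?|? _ ?].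
    - case: (ord2E i) => ->; case: (ord3E j) => ->;
        rewrite ?f10 ?f11 ?f2_0 ?f2_1 ?f2_2; apply: gen_commE => k;
        by rewrite form_standard // !mxE /=; ring.
    - exact: commute1.
    - exact: commuteM.
    - exact: commuteV.
  have f12phi h : H21 p h -> f1 h = f2 (phi h).
    apply: (@central_cycle_morph _ _ _ _ f1 (f2 \o phi)) => [||a b Ha Hb] /=.
    - by rewrite amalg_map1 (morphism1 f1M) (morphism1 f2M).
    - rewrite phiE (morphismR f1M) (morphismR f2M) f10 f11 f2_0 f2_1 !gen_comm.
      congr pair; apply/rowP=> k;
        rewrite !mxE -!form_delta !form_standard // !mxE /=.
      ring.
    - by rewrite f1M (amalg_mapM phi Ha Hb) f2M.
  have [psi psiM [psi1 psi2]] := amalg_lift f1M f2M f12 f12phi.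
  apply: (model_normal_form_eq1 s_std).
  rewrite -[RHS](morphism1 psiM) -vA1 (morph_normal_form _ _ _ psiM).
  rewrite (_ : psi \o z = model_gen s) //; apply/funext.
  by elim/ord5_ind; rewrite /= ?psi1 ?psi2.
have in12 a b : [~ amalg_in2 phi b, amalg_in1 phi a] = 1.
  by apply/eqP/commgP/commute_sym/amalg_in_commute.
have z10 : [~ z o1, z o0] = [~ z o3, z o2].
  rewrite /z /= -(morphismR in1M) -(morphismR in2M) -phiE.
  by apply: amalg_in_phi; exact: generated_in.
rewrite /normal_form big1 ?mul1g => [|i _]; last by rewrite mxE expg0.
rewrite comm_prod5 z10 /z /= !in12 !expg1n !mul1g !mulg1.
have s0 := sA (Ordinal (size_standard s_std)).
have A23 : (A o0 o1 + A o2 o3 = 0)%R.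
  by rewrite -s0 standard_first upper_pairingC linearD /= -!(upper_pairingC _ A)
    !upper_pairing_ew.
rewrite -!(morphismR in2M) -!(morphismX in2M) -!in2M !mulgA -expgnDr -mulgA rel
  //.
rewrite mulg1 -(morphism1 in2M); congr (amalg_in2 _ _).
have c_p : [~ t (inord 1), t (inord 0)] ^+ p = 1 by rewrite -commXg // t_p
  comm1g.
by rewrite expgnDr -(expg_FpD p_pr) // A23.
Qed.

End AmalgamModel.

(** * Existence of the amalgamation; cases (ii) and (iii) *)

Lemma expg_eq1_transfer (G H : groupType) (p : nat) (z : G) (z' : H) m n :
    (forall k, z ^+ k = 1 -> p %| k) -> z' ^+ p = 1 ->
  z ^+ m = z ^+ n -> z' ^+ m = z' ^+ n.
Proof.
move=> z_ord z'p; wlog le_mn : m n / m <= n.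
  by move=> th E; have [/th->//|/ltnW/th->] := leqP m n.
move=> E; have /dvdnP[k kE] : p %| n - m by apply: z_ord;
  rewrite expgnFr // E mulgV.
by rewrite -(subnKC le_mn) kE expgnDr mulnC expgnA z'p expg1n mulg1.
Qed.

(** Send z ^ n to z' ^ n: both orders are exactly p, which gives well-definedness and injectivity.
    The exponent is picked by choice, with the default 0 outside the cycle. *)
Lemma amalgamation_of_orders (G H : groupType) (p : nat) (z : G) (cz : central
  z)
    (z' : H) (cz' : central z') :
    0 < p -> z ^+ p = 1 -> z' ^+ p = 1 -> (forall k, z ^+ k = 1 -> p %| k) ->
    (forall k, z' ^+ k = 1 -> p %| k) ->
  exists phi : amalgamation H (central_cycle cz), phi z = z'.
Proof.
move=> p_gt0 zp z'p z_ord z'_ord.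
have powE h : central_cycle cz h -> exists n, h = z ^+ n.
  elim=> {h} [h <-||h k _ [m ->] _ [n ->]|h _ [n ->]].
  - by exists 1%N.
  - by exists 0%N.
  - by exists (m + n)%N; rewrite expgnDr.
  - exists (n * p.-1)%N; apply: mulg1_eq.
    by rewrite expgnA -expgS prednK // expgnAC zp expg1n.
have /choice[e eE] h : exists n, central_cycle cz h -> h = z ^+ n.
  have [/powE[n ->]|no_h] := pselect (central_cycle cz h); first by exists n.
  by exists 0%N => /no_h.
have transfer m n : z ^+ m = z ^+ n -> z' ^+ m = z' ^+ n.
  exact: (expg_eq1_transfer z_ord z'p).
have cHz h : central_cycle cz h -> central h by exact: generated_central.
have phi_central h : central_cycle cz h -> central (z' ^+ e h).
  by move=> _; exact: central_X.
have phiM h k : central_cycle cz h -> central_cycle cz k ->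
    z' ^+ e (h * k) = z' ^+ e h * z' ^+ e k.
  move=> Hh Hk; rewrite -expgnDr; apply: transfer.
  by rewrite expgnDr -!eE //; exact: nsubM.
have phi_inj h k : central_cycle cz h -> central_cycle cz k ->
    z' ^+ e h = z' ^+ e k -> h = k.
  move=> Hh Hk E; rewrite (eE _ Hh) (eE _ Hk).
  exact: (expg_eq1_transfer z'_ord zp E).
exists (Amalgamation cHz phi_central phiM phi_inj) => /=.
rewrite -[RHS]expg1; apply: transfer; rewrite expg1 -eE //.
exact: generated_in.
Qed.

Section CasesIiIii.
Variables (p : nat) (p_pr : prime p).

Lemma ord3_nth (T : Type) (x0 a b c : T) :
  let t (i : 'I_3) := nth x0 [:: a; b; c] i in
  [/\ t (inord 0) = a, t (inord 1) = b & t (inord 2) = c].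
Proof. by rewrite /= !inordK. Qed.

(** The commutator is read in the model on the coordinate of the first form, which is [symp] in
    every standard list. *)
Lemma comm_order (G : groupType) (s : seq 'M['F_p]_5) (f : G -> seq_model s)
    (a b : G) i j : s \in standard 'F_p ->
    {morph f : x y / x * y} -> f a = model_gen s j -> f b = model_gen s i ->
    symp 'F_p i j = 1%R ->
  forall n, [~ a, b] ^+ n = 1 -> p %| n.
Proof.
move=> s_std fM fa fb Jij n /(congr1 f).
rewrite (morphismX fM) (morphismR fM) (morphism1 fM) fa fb seq_model_commE //.
rewrite heis_centerX => -[/rowP/(_ (Ordinal (size_standard s_std)))].
rewrite mulmxnE !mxE standard_first form_delta Jij => /eqP.
by rewrite -(dvdn_pcharf (pchar_Fp p_pr)).
Qed.

Lemma nil2_power2_comm_order n : [~ gen_x2 p, gen_x1 p] ^+ n = 1 -> p %| n.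
Proof.
pose s := forms_i 'F_p; have s_std : s \in standard 'F_p by rewrite inE eqxx.
pose t (i : 'I_2) := nth 1 [:: model_gen s o0; model_gen s o1] i.
have t_p i : t i ^+ p = 1.
  by case: i => [[|[|//]] lt_i]; rewrite /t /= model_gen_p.
have [f fM fE] := nil2_power_lift p_pr (@seq_model_comm_central _ s) t_p.
apply: (comm_order s_std fM (i := o0) (j := o1)).
- by rewrite fE /t inordK.
- by rewrite fE /t inordK.
- by rewrite !mxE /= !(subr0, addr0).
Qed.

Lemma nil2_power3_model (s : seq 'M['F_p]_5) :
  exists2 f : nil2_power p 3 -> seq_model s, {morph f : x y / x * y}
    & [/\ f (gen_x3 p) = model_gen s o2, f (gen_x4 p) = model_gen s o3
        & f (gen_x5 p) = model_gen s o4].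
Proof.
pose t (i : 'I_3) := nth 1 [:: model_gen s o2; model_gen s o3;
  model_gen s o4] i.
have t_p i : t i ^+ p = 1.
  by case: i => [[|[|[|//]]] lt_i]; rewrite /t /= model_gen_p.
have [f fM fE] := nil2_power_lift p_pr (@seq_model_comm_central _ s) t_p.
by exists f => //; rewrite !fE; exact: ord3_nth.
Qed.

Lemma amalgamation_exists (G2 : groupType) (a b : G2) (s : seq 'M['F_p]_5)
    (f : G2 -> seq_model s) :
    s \in standard 'F_p -> comm_central G2 -> a ^+ p = 1 ->
    {morph f : x y / x * y} -> f a = model_gen s o3 -> f b = model_gen s o2 ->
  exists phi : amalgamation G2 (H21 p), phi [~ gen_x2 p, gen_x1 p] = [~ a, b].
Proof.
move=> s_std G2_2 a_p fM fa fb.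
apply: (@amalgamation_of_orders _ _ p) => //.
- exact: prime_gt0.
- by rewrite -(commXg (@nil2_power_comm_central p 2)) nil2_gen_p // comm1g.
- by rewrite -(commXg G2_2) a_p comm1g.
- exact: nil2_power2_comm_order.
- apply: (comm_order s_std fM fa fb).
  by rewrite !mxE /= !(subr0, add0r).
Qed.

(** Every admissible [phi] leads to the same model. For the converse one such [phi] must exist,
    which needs the two commutators to have order p. *)
Lemma case_ii_iff (G : groupType) :
  case_ii p G <-> isomorphic G (seq_model (forms_ii 'F_p)).
Proof.
pose s := forms_ii 'F_p;
  have s_std : s \in standard 'F_p by rewrite !inE eqxx !orbT.
have [f fM [f3 f4 f5]] := nil2_power3_model s.
have C3 := @nil2_power_comm_central p 3.
have amalgE (phi : amalgamation (nil2_power p 3) (H21 p)) :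
    phi [~ gen_x2 p, gen_x1 p] = [~ gen_x4 p, gen_x3 p] ->
  isomorphic (amalgamated_product phi) (seq_model s).
  move=> phiE.
  apply: (isomorphic_amalgam_model p_pr s_std (t := @nil2_gen p 3) C3 _ _ phiE
    fM f3 f4 f5).
  - by move=> i; exact: nil2_gen_p.
  - by move=> g; exact: nil2_power_generated.
  move=> A sA; have := (sA (@Ordinal 3 1 isT), sA (@Ordinal 3 2 isT)).
  by rewrite /seq_forms /= !upper_pairing_ew // => -[-> ->]; rewrite mulg1.
split=> [[phi /amalgE iQ iG]|iG]; first exact: isomorphic_trans iQ.
have [phi phiE] := amalgamation_exists s_std C3 (nil2_gen_p p_pr _) fM f4 f3.
by exists phi => //; apply: isomorphic_trans iG _; apply/isomorphic_sym/amalgE.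
Qed.

Lemma case_iii_iff (G : groupType) :
  case_iii p G <-> isomorphic G (seq_model (forms_iii 'F_p)).
Proof.
pose s := forms_iii 'F_p;
  have s_std : s \in standard 'F_p by rewrite !inE eqxx !orbT.
have [f0 f0M [f03 f04 f05]] := nil2_power3_model s.
pose q := quotient_proj (K54 p);
  have qM : {morph q : x y / x * y} := quotient_proj_morph _.
(* The list for case (iii) lacks e3 /\ e4, so the images of x_4 and x_5 commute in the model. *)
have f0K h : K54 p h -> f0 h = 1.
  apply: (@central_cycle_morph _ _ _ _ f0 (fun=> 1)) => [||a b _ _].
  - exact: morphism1 f0M.
  - rewrite (morphismR f0M) f04 f05 seq_model_commE //; congr pair.
    apply/rowP=> -[[|[|//]] lt_k];
      rewrite !mxE form_delta /seq_forms /= !mxE /=;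
      by rewrite !(subr0, addr0).
  - by rewrite f0M mulg1.
have [f fM fE] := quotient_lift f0M f0K.
have [f3 f4 f5] : [/\ f (q (gen_x3 p)) = model_gen s o2,
    f (q (gen_x4 p)) = model_gen s o3 & f (q (gen_x5 p)) = model_gen s o4].
  by rewrite !fE.
have C3 : comm_central (quotient_group (K54 p)).
  exact/comm_central_quotient/nil2_power_comm_central.
have q_p i : q (nil2_gen p i) ^+ p = 1.
  by rewrite -(morphismX qM) nil2_gen_p // (morphism1 qM).
have amalgE (phi : amalgamation (quotient_group (K54 p)) (H21 p)) :
    phi [~ gen_x2 p, gen_x1 p] = [~ q (gen_x4 p), q (gen_x3 p)] ->
  isomorphic (amalgamated_product phi) (seq_model s).
  move=> phiE.
  apply: (isomorphic_amalgam_model p_pr s_std (t := q \o @nil2_gen p 3) C3 q_p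
    _ phiE fM f3 f4 f5).
    move=> g; rewrite -[g]quotient_reprK.
    apply: generated_sub (generated_morph qM (nil2_power_generated (repr g))).
    by move=> _ [_ [i ->] ->]; apply: generated_in; exists i.
  move=> A sA; have := sA (@Ordinal 2 1 isT).
  rewrite /seq_forms /= !upper_pairing_ew // => ->; rewrite mul1g.
  rewrite -(morphismR qM) -/(gen_x5 p) -/(gen_x4 p).
  have -> : q [~ gen_x5 p, gen_x4 p] = 1; last exact: expg1n.
  rewrite -(morphism1 qM); apply/esym/quotient_projP; rewrite invg1 mul1g.
  exact: generated_in.
split=> [[phi /amalgE iQ iG]|iG]; first exact: isomorphic_trans iQ.
have [phi phiE] := amalgamation_exists s_std C3 (q_p _) fM f4 f3.
by exists phi => //; apply: isomorphic_trans iG _; apply/isomorphic_sym/amalgE.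
Qed.

End CasesIiIii.

(** * Extra-special groups of order p^5 and case (i) *)

Section Extraspecial.
Variables (p : nat) (p_pr : prime p) (gT : finGroupType).

(** A proper subgroup has order at most p ^ 2, hence is abelian, and cannot contain a and b. *)
Lemma nonabelian_p3_gen (S : {group gT}) a b :
    #|S| = (p ^ 3)%N -> a \in S -> b \in S -> [~ a, b] != 1 ->
  S :=: <<[set a; b]>>.
Proof.
move=> oS Sa Sb ab1; have pS : p.-group S by rewrite /pgroup oS pnatX pnat_id.
apply/esym/eqP; have sub : <<[set a; b]>> \subset S.
  by rewrite gen_subG subUset !sub1set Sa Sb.
rewrite eqEcard sub oS leqNgt; apply: contra ab1 => lt_p3.
have [n oT] := p_natP (pgroupS sub pS);
  rewrite oT ltn_exp2l ?prime_gt1 // in lt_p3.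
have : abelian <<[set a; b]>>.
  have [n2|] := ltnP n 2.
    case: n n2 oT {lt_p3} => [|[|//]] _ oT.
      by rewrite (card1_trivg oT) abelian1.
    by rewrite cyclic_abelian // prime_cyclic // oT expn1.
  move=> n2; apply: (p2group_abelian (pgroupS sub pS)).
  by rewrite oT pfactorK.
move/centsP=> ab; apply/commgP; apply: ab; apply: mem_gen;
  by rewrite !inE eqxx ?orbT.
Qed.

Lemma nonabelian_commg (S : {group gT}) : ~~ abelian S ->
  exists a b, [/\ a \in S, b \in S & [~ a, b] != 1].
Proof.
move=> nab; have /subsetPn[a Sa /centP ca] := nab.
have [b Sb ab] : exists2 b, b \in S & ~~ ([~ a, b] == 1).
  apply: contrapT => no_b; apply: ca => b Sb; apply/commgP/negPn/negP => ab.
  by apply: no_b; exists b.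
by exists a, b.
Qed.

Lemma generated_gen (A : {set gT}) x : x \in <<A>> -> generated (fun y => y \in
  A) x.
Proof.
case/gen_prodgP=> n [c cA ->].
by apply: generated_prod => i _; apply: generated_in; exact: cA.
Qed.

(** The group is a central product of two non-abelian subgroups of order p ^ 3, each generated by
    any noncommuting pair. Pairs are chosen in both so that their commutators agree. *)
Lemma extraspecial_p5_gens : extraspecial [set: gT] -> #|[set: gT]| = (p ^ 5)%N
  ->
  comm_central gT /\ exists x0 x1 x2 x3 : gT,
    [/\ [~ x1, x0] = [~ x3, x2],
        [/\ commute x2 x0, commute x3 x0, commute x2 x1 & commute x3 x1]
      & forall g, generated (fun y => [\/ y = x0, y = x1, y = x2 | y = x3]) g].
Proof.
move=> esT oT; have pT : p.-group [set: gT] by rewrite /pgroup oT pnatX pnat_id.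
have oZ := card_center_extraspecial pT esT.
have TZ u v : [~ u, v] \in 'Z([set: gT]).
  by have [[_ <-] _] := esT; rewrite mem_commg ?inE.
have T2 : comm_central gT.
  by move=> u v w; have /centerP[_] := TZ u v; apply; rewrite inE.
split=> //.
have [a [b [Ta Tb ab]]] := nonabelian_commg (extraspecial_nonabelian esT).
have aZ : a \in [set: gT] :\: 'Z([set: gT]).
  rewrite inE Ta andbT; apply: contra ab => /centerP[_ ca].
  by apply/commgP/ca.
have [A [R [[oA oR] [AR _] [_ ZR] [esA _] Rext]]] := split1_extraspecial pT esT
  aZ.
have {}oR : #|R| = (p ^ 3)%N by rewrite oR oT -expnB ?prime_gt0.
have [_ defT cAR] := cprodP AR.
(* An abelian R would be the centre, of order p rather than p ^ 3. *)
have nabR : ~~ abelian R.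
  apply/negP=> cR; rewrite cR in Rext; have := oZ;
    rewrite -Rext oR -[in RHS](expn1 p).
  by move/eqP; rewrite eqn_exp2l ?prime_gt1.
have [x1 [x0 [A1 A0 x10]]] := nonabelian_commg (extraspecial_nonabelian esA).
have [c [d [Rc Rd cd]]] := nonabelian_commg nabR.
have ocd : #[[~ c, d]] = p.
  by apply: nt_prime_order => //; rewrite -oZ expg_cardG ?TZ.
have ZE : 'Z([set: gT]) = <[[~ c, d]]>.
  by apply/esym/eqP; rewrite eqEcard cycle_subG TZ oZ -orderE ocd leqnn.
(* The centre has order p and is generated by [c, d]; replacing c by c ^ k matches the two
   commutators. They are nontrivial, so c ^ k and d still generate R. *)
have [k kE] : exists k, [~ x1, x0] = [~ c, d] ^+ k.
  by apply/cycleP; rewrite -ZE.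
have Rck : c ^+ k \in R by rewrite groupX.
exists x0, x1, d, (c ^+ k).
have x10E : [~ x1, x0] = [~ c ^+ k, d] by rewrite (commXg T2).
split=> // [|g].
  by split; apply: (centsP cAR).
have : g \in A * R by rewrite defT inE.
case/mulsgP=> u v; rewrite (nonabelian_p3_gen oA A1 A0 x10).
rewrite (nonabelian_p3_gen oR Rck Rd) -?x10E // => uA vR ->.
apply: generated_M.
  apply: generated_sub (generated_gen uA) => y; rewrite !inE.
  by move=> /orP[] /eqP ->; apply: generated_in; [apply: Or42 | apply: Or41].
apply: generated_sub (generated_gen vR) => y; rewrite !inE.
by move=> /orP[] /eqP ->; apply: generated_in; [apply: Or44 | apply: Or43].
Qed.

End Extraspecial.

Section CaseI.
Variables (p : nat) (p_pr : prime p).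

Lemma Cp_comm1 (a b : Cp p) : [~ a, b] = 1.
Proof. by apply/eqP/commgP; exact: (@GRing.addrC 'Z_p). Qed.

Lemma extraspecial_pair_model (E : finGroupType) :
    extraspecial [set: E] -> #|[set: E]| = (p ^ 5)%N -> exponent [set: E] = p ->
  isomorphic (E * Cp p)%type (seq_model (forms_i 'F_p)).
Proof.
move=> esE oE expE; pose s := forms_i 'F_p.
have s_std : s \in standard 'F_p by rewrite inE eqxx.
have [E2 [x0 [x1 [x2 [x3 [x10 [c20 c30 c21 c31] x_gen]]]]]] :=
  extraspecial_p5_gens p_pr esE oE.
have E_p (g : E) : g ^+ p = 1 by rewrite -expE expg_exponent ?inE.
have Q2 : comm_central (E * Cp p)%type.
  by apply: comm_central_pair => // a b; rewrite Cp_comm1; exact: central1.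
pose in1 (g : E) : (E * Cp p)%type := (g, 1).
pose in2 (c : Cp p) : (E * Cp p)%type := (1, c).
have in1M : {morph in1 : g h / g * h} by move=> g h; congr pair; rewrite mulg1.
have in2M : {morph in2 : g h / g * h} by move=> g h; congr pair; rewrite mulg1.
have in12 g c : [~ in2 c, in1 g] = 1.
  by apply/eqP/commgP; congr pair; rewrite ?mulg1 ?mul1g.
pose z (i : 'I_5) := nth 1 [:: in1 x0; in1 x1; in1 x2; in1 x3;
  in2 (Cp_gen p)] i.
have z_p i : z i ^+ p = 1.
  by elim/ord5_ind: i; rewrite /z /= -?(morphismX in1M) -?(morphismX in2M)
    ?E_p ?Cp_gen_p ?(morphism1 in1M) ?(morphism1 in2M).
have z_gen g : generated (fun y => exists i, y = z i) g.
  case: g => g c; have -> : (g, c) = in1 g * in2 c.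
    by congr pair; rewrite /= ?mulg1 ?mul1g.
  apply: generated_M.
    apply: generated_sub (generated_morph in1M (x_gen g)) => _ [_ [->|->|->|->]
      ->];
      apply: generated_in; [by exists o0 | by exists o1 | by exists o2 | by
        exists o3].
  rewrite [c]CpE (morphismX in2M); apply: generated_X.
  by apply: generated_in; exists o4.
have symp_up (A : 'M['F_p]_5) : upper_pairing (symp _) A = (A o0 o1 + A o2
  o3)%R.
  by rewrite upper_pairingC linearD /= -!(upper_pairingC _ A) !upper_pairing_ew.
(* All commutators of generators vanish except [z1, z0] = [z3, z2], so a normal form depends only on
   v and on A01 + A23. *)
have zA (A : 'M['F_p]_5) : comm_prod z (fun i j => A i j) =
    [~ z o1, z o0] ^+ upper_pairing (symp _) A.
  rewrite comm_prod5 /z /= !in12 -!(morphismR in1M) -x10.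
  have/commgP/eqP-> := c20; have/commgP/eqP-> := c30.
  have/commgP/eqP-> := c21; have/commgP/eqP-> := c31.
  rewrite (morphism1 in1M) !expg1n !mul1g !mulg1 symp_up expg_FpD //.
  by rewrite -(morphismX in1M) E_p (morphism1 in1M).
(* z presents a quotient of the model; comparing orders shows that it is the  *)
(* whole model.                                                               *)
pose f (a : 'rV['F_p]_5 * 'F_p) : E * 'Z_p :=
  \prod_i z i ^+ a.1 0%R i * [~ z o1, z o0] ^+ a.2.
have f_surj g : exists a, f a = g.
  have [v [A ->]] := normal_form_surj p_pr Q2 z_p z_gen g.
  by exists (v, upper_pairing (symp _) A); rewrite /normal_form zA.
have f_inj : injective f.
  suff /image_injP f_inj : #|[seq f a | a in predT]| == #|{: 'rV['F_p]_5 *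
    'F_p}|.
    by move=> a b fab; apply: f_inj.
  have -> : #|[seq f a | a in predT]| = #|{: E * 'Z_p}|.
    by apply: eq_card => g; have [a <-] := f_surj g; rewrite image_f.
  rewrite !card_prod card_mx mul1n card_Fp // -cardsT oE.
  by rewrite card_ord Zp_cast ?prime_gt1.
apply: (isomorphic_forms_model p_pr Q2 z_p z_gen) => [w|v A].
  exact: standard_surj.
have vAE : normal_form z v A = f (v, upper_pairing (symp _) A).
  by rewrite /normal_form zA.
have f0 : f (0%R, 0%R) = 1.
  by rewrite /f /= expg0 mulg1 big1 // => i _; rewrite mxE expg0.
rewrite vAE -f0; split=> [/f_inj[-> uA]|[-> uA]].
  by split=> // -[[|//] lt_k].
by congr (f (_, _)); exact: (uA ord0).
Qed.

(** Any E with the stated properties gives the same model, and [p^{1+2*2}] supplies one; its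
    exponent is p because p is odd. *)
Lemma case_i_iff (p_odd : odd p) (G : groupType) :
  case_i p G <-> isomorphic G (seq_model (forms_i 'F_p)).
Proof.
split=> [[E [esE oE expE iG]]|iG].
  exact: isomorphic_trans iG (extraspecial_pair_model esE oE expE).
exists p^{1+2*2}%type.
have esE := pX1p2n_extraspecial p_pr (isT : 0 < 2)%N.
have oE : #|[set: p^{1+2*2}]| = (p ^ 5)%N by rewrite card_pX1p2n.
have expE := exponent_pX1p2n 2 p_pr p_odd.
split=> //; apply: isomorphic_trans iG _; apply: isomorphic_sym.
exact: extraspecial_pair_model.
Qed.

End CaseI.

(** * The four alternatives and their exclusivity *)

Theorem theorem7p2 (p : nat) (G : groupType) (p_prime : prime p) (p_odd : odd p)
    (G_gen : minimally_generated G 5) (G_pgroup : is_pgroup G p)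
    (G_class : class_at_most_two G) (G_exp : has_exponent G p) :
  exactly_one_of_four (case_i p G) (case_ii p G) (case_iii p G) (capable G).
Proof.
have i_iff := case_i_iff p_prime p_odd G.
have ii_iff := case_ii_iff p_prime G.
have iii_iff := case_iii_iff p_prime G.
(* The three models have orders p ^ 6, p ^ 7 and p ^ 8. *)
have not_two (s t : seq 'M['F_p]_5) : size s != size t ->
    isomorphic G (seq_model s) -> isomorphic G (seq_model t) -> False.
  move=> /eqP ne_st Gs Gt; apply: ne_st; apply: (seq_model_size p_prime).
  exact: isomorphic_trans (isomorphic_sym Gs) Gt.
have not_cap (s : seq 'M['F_p]_5) : s \in standard 'F_p ->
    isomorphic G (seq_model s) -> capable G -> False.
  by move=> s_std /capable_isomorphic/[apply]; exact: not_capable_seq_model.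
split; last first.
  split; [split=> [[/i_iff Gi /ii_iff Gii]|[/i_iff Gi /iii_iff Giii]|[/i_iff Gi
    Gc]]|
    split=> [[/ii_iff Gii /iii_iff Giii]|[/ii_iff Gii Gc]|[/iii_iff Giii Gc]]].
  - exact: not_two Gi Gii.
  - exact: not_two Gi Giii.
  - by apply: not_cap Gi Gc; rewrite !inE eqxx.
  - exact: not_two Gii Giii.
  - by apply: not_cap Gii Gc; rewrite !inE eqxx !orbT.
  - by apply: not_cap Giii Gc; rewrite !inE eqxx orbT.
have [_ G_p _] := G_exp.
have [Gc|[s s_std Gs]] := capable_or_standard p_prime p_odd
    (comm_central_of_class2 G_class) G_p G_gen; first exact: Or44.
move: s_std; rewrite !inE => /or3P[] /eqP sE; rewrite sE in Gs.
- by apply: Or41; apply/i_iff.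
- by apply: Or43; apply/iii_iff.
- by apply: Or42; apply/ii_iff.
Qed.
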